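(* There are no compact constant mean curvature surfaces in $\mathrm{Sol}_3$, with shape operator $A$, (constant) mean curvature $f=\frac12\operatorname{trace}A$ and Gaussian curvature $K$, such that $$ K(|A|^2-2f^2)\geq 1 $$ at every point of the surface.
   Context: $\mathrm{Sol}_3$ is $\mathbb{R}^3$ with coordinates $(x,y,z)$ and the Riemannian metric $\langle\cdot,\cdot\rangle=e^{2z}dx^2+e^{-2z}dy^2+dz^2$; $\bar\nabla$ is its Levi-Civita connection. A surface in $\mathrm{Sol}_3$ means a smooth isometric immersion $\phi:\Sigma^2\to\mathrm{Sol}_3$ of a connected Riemannian surface without boundary, equipped with a unit normal vector field $\xi$. The shape operator $A$ is defined by $AX=-\bar\nabla_X\xi$ for $X$ tangent; $f=\frac12\operatorname{trace}A$ is the mean curvature function, $|A|^2=\operatorname{trace}(A^2)$, and $K$ is the Gaussian curvature of the induced metric. The surface is a constant mean curvature (CMC) surface if $f$ is constant. *)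

(* Defs.v *)
From HB Require Import structures.
From mathcomp Require Import all_boot all_order all_algebra.
From mathcomp Require Import all_classical all_reals all_analysis.

Set Implicit Arguments.
Unset Strict Implicit.
Unset Printing Implicit Defensive.
Import Order.TTheory GRing.Theory Num.Theory.
Import numFieldNormedType.Exports.
Local Open Scope classical_set_scope.
Local Open Scope ring_scope.

Section LocalCalculus.
Variables (R : realType) (n : nat).

Definition partial (W : normedModType R) (i : 'I_n) (f : 'rV[R]_n -> W)
    (x : 'rV[R]_n) : W :=
  'D_(delta_mx 0 i) f x.

Definition iter_partial (W : normedModType R) (s : seq 'I_n)
    (f : 'rV[R]_n -> W) : 'rV[R]_n -> W :=
  foldr (@partial W) f s.

(* C^oo on U; meant for open U, where the values of f outside U are
   irrelevant. *)
Definition smooth_on (W : normedModType R) (U : set 'rV[R]_n)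
    (f : 'rV[R]_n -> W) : Prop :=
  forall (s : seq 'I_n) (x : 'rV[R]_n), U x ->
    differentiable (iter_partial s f) x.

End LocalCalculus.

Section RiemannianCoordinates.
Variables (R : realType) (n : nat).
(* [g x i j] is the value at x of the metric on the i-th and j-th coordinate
   vector fields. *)
Implicit Type g : 'rV[R]_n -> 'M[R]_n.

(* The symbol with upper index k and lower indices i, j: in coordinates the
   Levi-Civita connection sends (d_i, d_j) to
   \sum_k christoffel g k i j *: d_k. *)
Definition christoffel g (k i j : 'I_n) (x : 'rV[R]_n) : R :=
  2^-1 * \sum_l invmx (g x) k l *
    (partial i (fun y => g y j l) x + partial j (fun y => g y i l) x
     - partial l (fun y => g y i j) x).

(* The d_l-component of R(d_i, d_j) d_k, for
   R(X, Y) Z = D_X D_Y Z - D_Y D_X Z - D_[X, Y] Z. *)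
Definition curvature g (l i j k : 'I_n) (x : 'rV[R]_n) : R :=
  partial i (christoffel g l j k) x - partial j (christoffel g l i k) x
  + \sum_m (christoffel g m j k x * christoffel g l i m x
            - christoffel g m i k x * christoffel g l j m x).

End RiemannianCoordinates.

(* < R(d_0, d_1) d_1, d_0 > / (g_00 g_11 - g_01 ^ 2) *)
Definition gauss_curvature_of_metric (R : realType)
    (g : 'rV[R]_2 -> 'M[R]_2) (x : 'rV[R]_2) : R :=
  (\sum_l curvature g l 0 1 1 x * g x l 0) / \det (g x).

(* The coordinates x, y, z are the entries of index 0, 1, 2. *)
Definition sol_metric (R : realType) (q : 'rV[R]_3) : 'M[R]_3 :=
  let z := q 0 ord_max in
  diag_mx (\row_i [:: expR (2 * z); expR (- (2 * z)); 1]`_i).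

Section SmoothSurfaces.
Variables (R : realType) (M : topologicalType).

(* [coord] and [param] are mutually inverse homeomorphisms between the open
   sets [source] and [target]; their values elsewhere are irrelevant. *)
Record chart : Type := Chart {
  source : set M;
  target : set 'rV[R]_2;
  coord : M -> 'rV[R]_2;
  param : 'rV[R]_2 -> M;
  source_open : open source;
  target_open : open target;
  coord_target : forall p, source p -> target (coord p);
  param_source : forall x, target x -> source (param x);
  coordK : forall p, source p -> param (coord p) = p;
  paramK : forall x, target x -> coord (param x) = x;
  coord_continuous : {within source, continuous coord};
  param_continuous : {within target, continuous param}
}.

Record smooth_surface (atlas : set chart) : Prop := SmoothSurface {
  surface_hausdorff : hausdorff_space M;
  surface_second_countable : @second_countable M;
  atlas_cover : forall p, exists2 c, atlas c & source c p;
  atlas_compatible : forall c d, atlas c -> atlas d ->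
    smooth_on (target c `&` param c @^-1` source d) (coord d \o param c)
}.

Definition smooth_map (W : normedModType R) (atlas : set chart) (f : M -> W) :
    Prop :=
  forall c, atlas c -> smooth_on (target c) (f \o param c).

Variables (phi xi : M -> 'rV[R]_3).

(* All the objects below are expressed in the coordinate frame d_0, d_1 of a
   chart c, at the point with coordinates x. *)

(* Row i is the image of d_i under the differential of phi. *)
Definition tangent_frame (c : chart) (x : 'rV[R]_2) : 'M[R]_(2, 3) :=
  'J (phi \o param c) x.

Definition induced_metric (c : chart) (x : 'rV[R]_2) : 'M[R]_2 :=
  tangent_frame c x *m sol_metric (phi (param c x)) *m (tangent_frame c x)^T.

(* Row i is the covariant derivative along phi, for the Levi-Civita connection
   of Sol_3, of the vector field xi in the direction d_i. *)
Definition nabla_normal (c : chart) (x : 'rV[R]_2) : 'M[R]_(2, 3) :=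
  'J (xi \o param c) x +
  \matrix_(i, k) \sum_a \sum_b
    christoffel (@sol_metric R) k a b (phi (param c x)) *
    tangent_frame c x i a * xi (param c x) 0 b.

(* Row i holds the components of A d_i = - nabla_(d_i) xi in the frame
   d_0, d_1: multiplying on the right by [pinvmx (tangent_frame c x)] returns
   the coefficients of a tangent vector in the basis d(phi) d_0, d(phi) d_1. *)
Definition shape_operator (c : chart) (x : 'rV[R]_2) : 'M[R]_2 :=
  - nabla_normal c x *m pinvmx (tangent_frame c x).

Definition mean_curvature (c : chart) (p : M) : R :=
  \tr (shape_operator c (coord c p)) / 2.

Definition shape_norm2 (c : chart) (p : M) : R :=
  \tr (shape_operator c (coord c p) *m shape_operator c (coord c p)).

Definition gauss_curvature (c : chart) (p : M) : R :=
  gauss_curvature_of_metric (induced_metric c) (coord c p).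

Record surface_in_sol (atlas : set chart) : Prop := SurfaceInSol {
  sol_surface_smooth : smooth_surface atlas;
  sol_surface_nonempty : [set: M] !=set0;
  sol_surface_connected : connected [set: M];
  phi_smooth : smooth_map atlas phi;
  phi_immersion : forall c x, atlas c -> target c x ->
    row_free (tangent_frame c x);
  xi_smooth : smooth_map atlas xi;
  xi_unit : forall p, xi p *m sol_metric (phi p) *m (xi p)^T = 1%:M;
  xi_normal : forall c x, atlas c -> target c x ->
    tangent_frame c x *m sol_metric (phi (param c x)) *m (xi (param c x))^T = 0
}.

End SmoothSurfaces.

(* Main.v *)
(* By self-adjointness [psi = |A|^2 - 2 f^2] is nonnegative, so [K psi >= 1] forces [K > 0] and [psi > 0]:
   there are no umbilics, and [A] has everywhere two distinct principal curvatures. The principal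
   directions for the larger one give, up to sign, a global unit field [e]; complete it locally to an
   orthonormal coframe [(p, q)] and let [alpha] be the connection form, so that [d alpha = K p /\ q].
   The sign of [e] does not affect [alpha], and a coordinate change multiplies it only by the sign of its
   Jacobian, so [alpha] is a global 1-form twisted by the orientation and [d alpha] a positive density.
   On a compact surface without boundary this contradicts Stokes' theorem. *)

Require Import Defs.
From HB Require Import structures.
From mathcomp Require Import all_boot all_order all_algebra.
From mathcomp Require Import all_classical all_reals all_analysis.
From mathcomp Require Import ring lra.

Set Implicit Arguments.
Unset Strict Implicit.
Unset Printing Implicit Defensive.
Import Order.TTheory GRing.Theory Num.Theory.
Import numFieldNormedType.Exports.
Local Open Scope classical_set_scope.
Local Open Scope ring_scope.

(** * Partial derivatives and functions of class [C^k] *)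

(** The larger principal curvature is [f + gap], and the rows of [A - (f - gap)] are eigenvectors
    for it that vary smoothly because [gap > 0]. Either row may vanish but never both, so each chart
    is split into two domains, one per row. On an overlap two normalised rows differ by a sign of
    square 1; its derivative is zero, so it cancels from the connection form. The Jacobian sign
    survives because the second covector is built with the positive root of [\det g]. That sign
    makes [d alpha] and [d chi /\ alpha] transform by the absolute value of the Jacobian, so their
    integrals agree between charts with no orientation chosen. Integrals are iterated one-variable
    integrals of compactly supported functions on the plane. Their invariance comes from the
    divergence theorem for maps that are the identity off a compact set; a coordinate change is
    brought to that form by localising, splitting off its affine part and interpolating with the
    identity. *)

Lemma near_eq_differentiable (R : realType) (V W : normedModType R) (f g : V -> W) (x : V) :
  (\near x, f x = g x) -> differentiable f x -> differentiable g x.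
Proof.
move=> fg df.
have dgf : differentiable (g \- f) x.
  (* Near [x] the difference [g - f] vanishes identically, so the zero map is its differential. *)
  pose L : {linear V -> W} := \0.
  have L0 : (L : V -> W) = cst 0 by apply/funext.
  have cL : continuous L by rewrite L0; exact: cst_continuous.
  have h0 : (g \- f) \o shift x = cst ((g \- f) x) + L +o_ (0 : V) id.
    apply/eqaddoP => _/posnumP[e].
    move: (fg); rewrite (near_shift 0 x) subr0 => fg0.
    near=> h; rewrite L0 !fctE /=.
    have -> : f (h + x) = g (h + x) by near: h.
    rewrite (nbhs_singleton fg) !subrr.
    by rewrite ?subrr ?addr0 ?subr0 normr0 mulr_ge0.
  apply/diff_locallyP; rewrite (diff_unique cL h0).
  by split.
have -> : g = f + (g \- f) by apply/funext => y; rewrite !fctE subrKC.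
exact: differentiableD.
Unshelve. all: by end_near. Qed.

Section Partials.
Variables (R : realType) (n : nat).
Implicit Types (f g : 'rV[R]_n -> R) (x : 'rV[R]_n) (i : 'I_n).

Lemma partial_near i (W : normedModType R) (f g : 'rV[R]_n -> W) x : (\near x, f x = g x) -> partial i f x = partial i g x.
Proof. exact: near_eq_derive. Qed.

Lemma partial_cst i (c : R) : partial i (fun _ : 'rV[R]_n => c) = fun=> 0.
Proof. by apply/funext => x; exact: derive_cst. Qed.

Lemma partialD i f g x : differentiable f x -> differentiable g x ->
  partial i (fun y => f y + g y) x = partial i f x + partial i g x.
Proof. by move=> df dg; apply: deriveD; exact: diff_derivable. Qed.

Lemma partialN i f x : differentiable f x ->
  partial i (fun y => - f y) x = - partial i f x.
Proof. by move=> df; apply: deriveN; exact: diff_derivable. Qed.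

Lemma partialB i f g x : differentiable f x -> differentiable g x ->
  partial i (fun y => f y - g y) x = partial i f x - partial i g x.
Proof. by move=> df dg; apply: deriveB; exact: diff_derivable. Qed.

Lemma partialM i f g x : differentiable f x -> differentiable g x ->
  partial i (fun y => f y * g y) x = partial i f x * g x + f x * partial i g x.
Proof.
move=> df dg; rewrite /partial.
have -> : (fun y => f y * g y) = f * g by [].
rewrite deriveM; [|exact: diff_derivable..].
by rewrite addrC [X in X + _]mulrC.
Qed.

Lemma partialZ i (c : R) f x : differentiable f x ->
  partial i (fun y => c * f y) x = c * partial i f x.
Proof.
move=> df; rewrite partialM //.
by rewrite partial_cst mul0r add0r.
Qed.

Lemma differentiable_bigsum (I : Type) (r : seq I) (P : pred I) (F : I -> 'rV[R]_n -> R) x :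
  (forall k, differentiable (F k) x) -> differentiable (fun y => \sum_(k <- r | P k) F k y) x.
Proof.
move=> dF; elim: r => [|k r IH].
  have -> : (fun y => \sum_(k <- [::] | P k) F k y) = cst 0 by apply/funext => y; rewrite big_nil.
  exact: differentiable_cst.
have -> : (fun y => \sum_(k <- k :: r | P k) F k y) =
   (if P k then F k else cst 0) + (fun y => \sum_(k <- r | P k) F k y).
  by apply/funext => y; rewrite big_cons /GRing.add /=; case: (P k) => //=; rewrite add0r.
by apply: differentiableD => //; case: (P k) => //; exact: differentiable_cst.
Qed.

Lemma partial_sum i (I : Type) (r : seq I) (P : pred I) (F : I -> 'rV[R]_n -> R) x :
  (forall k, differentiable (F k) x) ->
  partial i (fun y => \sum_(k <- r | P k) F k y) x = \sum_(k <- r | P k) partial i (F k) x.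
Proof.
move=> dF; elim: r => [|k r IH].
  have -> : (fun y => \sum_(k <- [::] | P k) F k y) = fun=> 0 by apply/funext => y; rewrite big_nil.
  by rewrite partial_cst big_nil.
rewrite big_cons -IH; have [Pk|Pk] := boolP (P k).
  rewrite -partialD//; last exact: differentiable_bigsum.
  by congr (partial _ _ _); apply/funext => y; rewrite big_cons Pk.
by congr (partial _ _ _); apply/funext => y; rewrite big_cons (negbTE Pk).
Qed.

Lemma partial_comp1 i (h : R -> R) f x : differentiable f x -> derivable h (f x) 1 ->
  partial i (fun y => h (f y)) x = 'D_1 h (f x) * partial i f x.
Proof.
move=> df dh; have dh' : differentiable h (f x) by exact/derivable1_diffP.
rewrite /partial deriveE; last exact: differentiable_comp.
rewrite (diff_comp df dh') /= (deriveE _ df) (deriveE _ dh').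
set u := 'd f x _; rewrite -{1}[u]mulr1 -[X in 'd h _ X]/(u *: 1) linearZ /=.
by rewrite mulrC.
Qed.

Lemma differentiable_comp1 (h : R -> R) f x : differentiable f x -> derivable h (f x) 1 ->
  differentiable (fun y => h (f y)) x.
Proof.
by move=> df dh; apply: differentiable_comp => //; exact/derivable1_diffP.
Qed.

Lemma partialV i f x : differentiable f x -> f x != 0 ->
  partial i (fun y => (f y)^-1) x = - partial i f x / f x ^+ 2.
Proof.
move=> df f0; rewrite /partial deriveE; last exact: differentiableV.
rewrite diffV //= -deriveE //.
by rewrite -[LHS]/(_ * _) mulrC mulrN mulNr.
Qed.

Lemma partial_sqrt i f x : differentiable f x -> 0 < f x ->
  partial i (fun y => Num.sqrt (f y)) x = (2 * Num.sqrt (f x))^-1 * partial i f x.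
Proof.
move=> df f0; rewrite partial_comp1 ?derive_sqrt //.
by have := is_derive1_sqrt f0; case.
Qed.

Lemma partial_exp i f x : differentiable f x ->
  partial i (fun y => expR (f y)) x = expR (f x) * partial i f x.
Proof.
move=> df; rewrite partial_comp1 ?derive_val //.
Qed.

Lemma differentiable_rowP (m : nat) (F : 'rV[R]_n -> 'rV[R]_m) x :
  differentiable F x <-> forall j, differentiable (fun y => F y 0 j) x.
Proof.
split=> [dF j|dF].
  exact: (differentiable_comp dF (differentiable_coord _ _ _)).
have -> : F = \sum_(j < m) (fun y => F y 0 j *: delta_mx 0 j).
  apply/funext => y; rewrite fct_sumE; apply/rowP => k.
  rewrite summxE (bigD1 k) //= mxE mxE !eqxx mulr1 big1 ?addr0 // => l lk.
  by rewrite mxE mxE eqxx /= eq_sym (negbTE lk) mulr0.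
by apply: differentiable_sum => j; exact: differentiableZl.
Qed.

Lemma partial_coord (m : nat) i (F : 'rV[R]_n -> 'rV[R]_m) x j : differentiable F x ->
  partial i F x 0 j = partial i (fun y => F y 0 j) x.
Proof.
by move=> dF; rewrite /partial derive_mx; [rewrite mxE|exact: diff_derivable].
Qed.

Lemma deriveE_partial f x v : differentiable f x ->
  'D_v f x = \sum_i v 0 i * partial i f x.
Proof.
move=> df; rewrite deriveE // {1}(matrix_sum_delta v) big_ord1 linear_sum /=.
apply: eq_bigr => i _; rewrite linearZ /= -deriveE // /partial.
Qed.

End Partials.

Lemma partial_comp (R : realType) (n m : nat) (f : 'rV[R]_m -> R) (tau : 'rV[R]_n -> 'rV[R]_m) i x :
  differentiable tau x -> differentiable f (tau x) ->
  partial i (fun y => f (tau y)) x =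
  \sum_j partial i (fun y => tau y 0 j) x * partial j f (tau x).
Proof.
move=> dt df; rewrite {1}/partial deriveE; last exact: differentiable_comp.
rewrite (diff_comp dt df) /= -(deriveE _ dt) -(deriveE _ df) deriveE_partial //.
by apply: eq_bigr => j _; rewrite -partial_coord.
Qed.

Section Ck.
Variables (R : realType) (n : nat).
Implicit Types (f g : 'rV[R]_n -> R) (x : 'rV[R]_n) (i : 'I_n) (U : set 'rV[R]_n).

(** Regularity is counted because each construction costs derivatives: a coframe of class 3 has a
    connection form of class 2, whose exterior derivative is of class 1. Full differentiability is
    demanded at each level so that the chain rule applies directly. *)
Fixpoint ck (k : nat) U f : Prop :=
  if k is k'.+1 then (forall x, U x -> differentiable f x) /\ forall i, ck k' U (partial i f)
  else forall x, U x -> {for x, continuous f}.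

Lemma open_near_eq U f g x : open U -> (forall y, U y -> f y = g y) -> U x -> \near x, f x = g x.
Proof.
move=> oU fg Ux; have : nbhs x U by apply: open_nbhs_nbhs.
by apply: filterS => y /fg.
Qed.

Lemma ck_ext k U f g : open U -> (forall x, U x -> f x = g x) -> ck k U f -> ck k U g.
Proof.
move=> oU; elim: k f g => [|k IH] f g fg /=.
  move=> cf x Ux; have fgx := open_near_eq oU fg Ux.
  rewrite /prop_for /continuous_at -fg //.
  exact: cvg_trans (near_eq_cvg fgx) (cf x Ux).
move=> [df pf]; split=> [x Ux|i].
  by apply: near_eq_differentiable (df x Ux); exact: open_near_eq Ux.
apply: IH (pf i) => x Ux; apply: partial_near; exact: open_near_eq Ux.
Qed.

Lemma ck_sub k U V f : V `<=` U -> ck k U f -> ck k V f.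
Proof.
move=> VU; elim: k f => [|k IH] f /=; first by move=> cf x /VU/cf.
by move=> [df pf]; split=> [x /VU/df //|i]; exact: IH.
Qed.

Lemma ckW k U f : ck k.+1 U f -> ck k U f.
Proof.
elim: k f => [|k IH] f /= [df pf]; first by move=> x /df/differentiable_continuous.
by split=> // i; apply: IH; exact: pf.
Qed.

Lemma ck_le k l U f : (l <= k)%N -> ck k U f -> ck l U f.
Proof.
elim: k => [|k IH]; first by rewrite leqn0 => /eqP ->.
by rewrite leq_eqVlt => /predU1P[-> //|lk] /ckW; exact: IH.
Qed.

Lemma ck_diff k U f x : ck k.+1 U f -> U x -> differentiable f x.
Proof. by move=> [df _]; exact: df. Qed.

Lemma ck_partial k U f i : ck k.+1 U f -> ck k U (partial i f).
Proof. by move=> [_]; exact. Qed.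

Lemma ck_cont k U f x : ck k U f -> U x -> {for x, continuous f}.
Proof. by move=> /(ck_le (leq0n k)) cf /cf. Qed.

Lemma ck_local k U f : (forall x, U x -> exists2 V, open V /\ V x & ck k V f) -> ck k U f.
Proof.
elim: k f => [|k IH] f H /=.
  by move=> x /H[V [_ Vx] /= cf]; exact: cf.
split=> [x /H[V [_ Vx] /= [df _]]|i]; first exact: df.
by apply: IH => x /H[V [oV Vx] /= [_ pf]]; exists V.
Qed.

Lemma ck_cst k U (c : R) : ck k U (fun=> c).
Proof.
elim: k c => [|k IH] c /=; first by move=> x _; exact: cst_continuous.
by split=> [x _|i]; [exact: differentiable_cst|rewrite partial_cst].
Qed.

Variable U : set 'rV[R]_n.
Hypothesis oU : open U.

Lemma ckD k f g : ck k U f -> ck k U g -> ck k U (fun x => f x + g x).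
Proof.
elim: k f g => [|k IH] f g; first by move=> cf cg x Ux; exact: cvgD (cf x Ux) (cg x Ux).
move=> [df pf] [dg pg]; split=> [x Ux|i]; first exact: differentiableD (df x Ux) (dg x Ux).
apply: ck_ext (IH _ _ (pf i) (pg i)) => // x Ux.
by rewrite partialD //; [exact: df|exact: dg].
Qed.

Lemma ckM k f g : ck k U f -> ck k U g -> ck k U (fun x => f x * g x).
Proof.
elim: k f g => [|k IH] f g; first by move=> cf cg x Ux; exact: cvgM (cf x Ux) (cg x Ux).
move=> cf cg; have [df pf] := cf; have [dg pg] := cg.
split=> [x Ux|i]; first exact: differentiableM (df x Ux) (dg x Ux).
apply: ck_ext (ckD (IH _ _ (pf i) (ckW cg)) (IH _ _ (ckW cf) (pg i))) => // x Ux.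
by rewrite partialM //; [exact: df|exact: dg].
Qed.

Lemma ckZ k c f : ck k U f -> ck k U (fun x => c * f x).
Proof. by apply: ckM; exact: ck_cst. Qed.

Lemma ckN k f : ck k U f -> ck k U (fun x => - f x).
Proof.
move=> cf; apply: ck_ext (ckZ (-1) cf) => // x _; exact: mulN1r.
Qed.

Lemma ckB k f g : ck k U f -> ck k U g -> ck k U (fun x => f x - g x).
Proof. by move=> cf cg; exact: ckD cf (ckN cg). Qed.

Lemma ck_sum k (I : Type) (r : seq I) (P : pred I) (F : I -> 'rV[R]_n -> R) :
  (forall j, ck k U (F j)) -> ck k U (fun y => \sum_(j <- r | P j) F j y).
Proof.
move=> cF; elim: r => [|j r IH].
  by apply: ck_ext (ck_cst k U 0) => // x _; rewrite big_nil.
have [Pj|Pj] := boolP (P j).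
  by apply: ck_ext (ckD (cF j) IH) => // x _; rewrite big_cons Pj.
by apply: ck_ext IH => // x _; rewrite big_cons (negbTE Pj).
Qed.

(** The induction closes because the derivative of $1/f$ is a polynomial in $f'$ and $1/f$ itself,
    the latter already known one class lower. [ck_sqrt] and [ck_exp] follow the same pattern. *)
Lemma ckV k f : (forall x, U x -> f x != 0) -> ck k U f -> ck k U (fun x => (f x)^-1).
Proof.
move=> f0; elim: k => [|k IH].
  by move=> cf x Ux; apply: cvgV (cf x Ux); exact: f0.
move=> cf; have [df pf] := cf; split=> [x Ux|i].
  by apply: differentiableV; [exact: df|exact: f0].
have cV := IH (ckW cf).
apply: ck_ext (ckM (ckN (pf i)) (ckM cV cV)) => // x Ux.
rewrite partialV; [|exact: df|exact: f0].
by rewrite expr2 invfM.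
Qed.

Lemma ck_sqrt k f : (forall x, U x -> 0 < f x) -> ck k U f -> ck k U (fun x => Num.sqrt (f x)).
Proof.
move=> f0; elim: k => [|k IH].
  move=> cf x Ux; apply: (@continuous_comp _ _ _ f Num.sqrt); first exact: cf.
  exact: sqrt_continuous.
move=> cf; have [df pf] := cf; split=> [x Ux|i].
  apply: differentiable_comp1; first exact: df.
  by have := is_derive1_sqrt (f0 x Ux); case.
have cV := IH (ckW cf).
have c2 : ck k U (fun x => (2 * Num.sqrt (f x))^-1).
  apply: ckV (ckZ 2 cV) => x Ux.
  by rewrite mulf_neq0 // gt_eqF // sqrtr_gt0 f0.
apply: ck_ext (ckM c2 (pf i)) => // x Ux.
by rewrite partial_sqrt //; [exact: df|exact: f0].
Qed.

Lemma ck_exp k f : ck k U f -> ck k U (fun x => expR (f x)).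
Proof.
elim: k => [|k IH].
  move=> cf x Ux; apply: (@continuous_comp _ _ _ f expR); first exact: cf.
  exact: continuous_expR.
move=> cf; have [df pf] := cf; split=> [x Ux|i].
  by apply: differentiable_comp1; [exact: df|exact: derivable_expR].
apply: ck_ext (ckM (IH (ckW cf)) (pf i)) => // x Ux.
by rewrite partial_exp //; exact: df.
Qed.

End Ck.

Lemma ck_comp (R : realType) (n m k : nat) (U : set 'rV[R]_n) (V : set 'rV[R]_m)
   (f : 'rV[R]_m -> R) (tau : 'rV[R]_n -> 'rV[R]_m) :
  open U -> U `<=` tau @^-1` V -> (forall j, ck k U (fun x => tau x 0 j)) ->
  (forall x, U x -> {for x, continuous tau}) ->
  ck k V f -> ck k U (fun x => f (tau x)).
Proof.
move=> oU UV; elim: k f => [|k IH] f ct c0 cf.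
  by move=> x Ux; apply: (@continuous_comp _ _ _ tau f); [exact: c0|apply: cf; exact: UV].
have dt x : U x -> differentiable tau x.
  by move=> Ux; apply/differentiable_rowP => j; exact: (ck_diff (ct j)).
split=> [x Ux|i].
  by apply: differentiable_comp; [exact: dt|apply: (ck_diff cf); exact: UV].
have H j : ck k U (fun x => partial i (fun y => tau y 0 j) x * partial j f (tau x)).
  apply: ckM => //; first exact: ck_partial.
  by apply: IH => //; [move=> l; exact: ckW|exact: ck_partial].
apply: ck_ext (ck_sum oU (index_enum 'I_m) xpredT H) => // x Ux.
by rewrite partial_comp //; [exact: dt|apply: (ck_diff cf); exact: UV].
Qed.

Lemma smooth_on_ck (R : realType) (n m k : nat) (U : set 'rV[R]_n) (F : 'rV[R]_n -> 'rV[R]_m) j :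
  open U -> smooth_on U F -> ck k U (fun x => F x 0 j).
Proof.
move=> oU sF.
suff H s : ck k U (fun x => iter_partial s F x 0 j) by exact: (H [::]).
elim: k s => [|k IH] s.
  move=> x Ux; apply: (@continuous_comp _ _ _ (iter_partial s F) (fun M => M 0 j)).
    exact/differentiable_continuous/sF.
  exact: coord_continuous.
split=> [x Ux|i]; first by move/differentiable_rowP : (sF s x Ux).
apply: ck_ext (IH (i :: s)) => // x Ux.
by rewrite /= partial_coord //; exact: sF.
Qed.

(** * Symmetry of second derivatives, and differentiability from continuous partial derivatives *)

Section Schwarz.
Variables (R : realType).

Lemma derive_line (V W : normedModType R) (f : V -> W) (x v : V) (s : R) :
  derivable f (x + s *: v) v ->
  is_derive s 1 (fun t : R => f (x + t *: v)) ('D_v f (x + s *: v)).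
Proof.
move=> df.
have E : (fun h : R => h^-1 *: (f (x + (h *: 1 + s) *: v) - f (x + s *: v))) =
   (fun h => h^-1 *: (f (h *: v + (x + s *: v)) - f (x + s *: v))).
  apply/funext => h; congr (_ *: (f _ - _)).
  by rewrite [h *: 1]mulr1 scalerDl addrCA.
by split; [rewrite /derivable E|rewrite /derive E].
Qed.

Lemma mean_value_line (V : normedModType R) (f : V -> R) (x v : V) :
  (forall s, 0 <= s <= 1 -> derivable f (x + s *: v) v) ->
  exists2 s, 0 <= s <= 1 & f (x + v) - f x = 'D_v f (x + s *: v).
Proof.
move=> df.
have [||s s01] := @MVT_segment R (fun t : R => f (x + t *: v)) (fun s => 'D_v f (x + s *: v)) 0 1 ler01.
- move=> s; rewrite in_itv /= => /andP[/ltW s0 /ltW s1].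
  by apply: derive_line; apply: df; rewrite s0.
- apply: derivable_within_continuous => s; rewrite in_itv /= => s01.
  by have [] := derive_line (df s s01).
rewrite scale0r addr0 scale1r subr0 mulr1 => ->.
by exists s; rewrite // -in_itv.
Qed.

(** Homogeneity in the direction when only the derivative along [v] is known to exist, which is the
    situation in [differentiable_C1]. *)
Lemma deriveZv (V W : normedModType R) (f : V -> W) x v (c : R) :
  derivable f x v -> is_derive x (c *: v) f (c *: 'D_v f x).
Proof.
move=> df.
have d0 : is_derive (0:R) 1 (fun t : R => f (x + t *: v)) ('D_v f x).
  have := @derive_line _ _ f x v 0; rewrite scale0r addr0; exact.
have d1 : differentiable (fun t : R => f (x + t *: v)) 0.
  by apply/derivable1_diffP; case: d0.
have d2 : differentiable (fun t : R => f (x + t *: (c *: v))) 0.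
  have -> : (fun t : R => f (x + t *: (c *: v))) = (fun t : R => f (x + t *: v)) \o ( *%R^~ c).
    by apply/funext => t /=; rewrite scalerA.
  by apply: differentiable_comp; rewrite ?mul0r.
have E : (fun h : R => f (h *: (c *: v) + x)) = (fun t : R => f (x + t *: (c *: v))).
  by apply/funext => h; rewrite addrC.
have dd : derivable f x (c *: v) by apply/derivable1P; rewrite E; apply/derivable1_diffP.
split => //.
have := @derive_line _ _ f x (c *: v) 0; rewrite scale0r addr0 => /(_ dd)[_ <-].
have -> : (fun t : R => f (x + t *: (c *: v))) = (fun t : R => f (x + t *: v)) \o ( *%R^~ c).
  by apply/funext => t /=; rewrite scalerA.
rewrite deriveE; last by apply: differentiable_comp; rewrite ?mul0r.
rewrite diff_comp /=; [|by []|by rewrite mul0r].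
rewrite mul0r; case: d0 => _ <-; rewrite (deriveE _ d1).
rewrite -linearZ /= -[c *: 1]/(c * 1) mulr1; congr ('d _ _ _).
have -> : ( *%R^~ c) = ( *:%R^~ c : R -> R) by [].
by rewrite diff_val /= -[_ *: _]/(1 * c) mul1r.
Qed.

Lemma mean_value_diff (V : normedModType R) (f : V -> R) (x v : V) :
  (forall s, 0 <= s <= 1 -> differentiable f (x + s *: v)) ->
  exists2 s, 0 <= s <= 1 & f (x + v) - f x = 'D_v f (x + s *: v).
Proof. by move=> df; apply: mean_value_line => s s01; apply: diff_derivable; exact: df. Qed.

Lemma deriveZv_diff (V : normedModType R) (f : V -> R) x v (c : R) :
  differentiable f x -> 'D_(c *: v) f x = c * 'D_v f x.
Proof. by move=> df; rewrite !deriveE // linearZ. Qed.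

Lemma derive_translate (V W : normedModType R) (f : V -> W) (x v c : V) :
  'D_v (fun y => f (y + c)) x = 'D_v f (x + c).
Proof.
rewrite /derive; set F := fun _ : R => _; set G := fun _ : R => _.
by suff -> : F = G by []; apply/funext => u; rewrite /F /G /= addrA.
Qed.

Lemma dist4_lt (p q r s e : R) : `|p - q| < e -> `|s - r| < e -> q = r -> `|p - s| < e + e.
Proof.
move=> pq sr qr; have -> : p - s = (p - q) + (r - s) by rewrite qr; ring.
by apply: le_lt_trans (ler_normD _ _) _; apply: ltrD => //; rewrite distrC.
Qed.

(** The second difference of [f] over a small square equals $h^2$ times either mixed derivative,
    each taken at some point near [x]. If the two derivatives differed at [x], continuity would keep
    them apart on a whole ball. *)
Lemma partial_partialC n (U : set 'rV[R]_n) (f : 'rV[R]_n -> R) x i j :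
  open U -> U x -> ck 2 U f -> partial i (partial j f) x = partial j (partial i f) x.
Proof.
move=> oU Ux cf; apply/eqP; apply/negP => /negP ne.
set a := partial i (partial j f); set b := partial j (partial i f).
(* Half the gap: two errors below it cannot add up to the gap itself. *)
have e0 : 0 < `|a x - b x| / 2 by rewrite divr_gt0 // normr_gt0 subr_eq0.
set e := `|a x - b x| / 2 in e0.
have ca : {for x, continuous a} by exact: (ck_cont (ck_partial _ (ck_partial _ cf))).
have cb : {for x, continuous b} by exact: (ck_cont (ck_partial _ (ck_partial _ cf))).
have /cvgrPdist_lt/(_ _ e0) na := ca.
have /cvgrPdist_lt/(_ _ e0) nb := cb.
have nU : nbhs x U by exact: open_nbhs_nbhs.
have [r /= r0 Hr] := (nbhs_ballP _ _).1 (filterI nU (filterI na nb)).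
have [h h0 hr] : exists2 h : R, 0 < h & h + h < r.
  by exists (r / 4); [rewrite divr_gt0|move: r0; clear; lra].
have inb (s t : R) (k l : 'I_n) : 0 <= s <= 1 -> 0 <= t <= 1 ->
    ball x r (x + s *: (h *: 'e_k) + t *: (h *: 'e_l)).
  move=> /andP[s0 s1] /andP[t0 t1]; rewrite -ball_normE /= distrC -[x + _ + _]addrA (addrC x) addrK.
  have ne1 (m : 'I_n) : `|('e_m : 'rV[R]_n)| <= 1.
    rewrite {1}/Num.norm /= mx_normrE; apply: bigmax_le => //= -[p q] _.
    by rewrite mxE normr_nat lern1 leq_b1.
  apply: le_lt_trans (ler_normD _ _) _; rewrite !normrZ (ger0_norm s0) (ger0_norm t0) !(ger0_norm (ltW h0)).
  have bnd (u v : R) : 0 <= u <= 1 -> 0 <= v <= 1 -> u * (h * v) <= h.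
    by move=> /andP[u0 u1] /andP[v0 v1]; rewrite mulrCA ler_piMr ?mulr_ile1 // ltW.
  have := bnd s `|'e_k : 'rV[R]_n|; rewrite s0 s1 normr_ge0 ne1 => /(_ isT isT).
  have := bnd t `|'e_l : 'rV[R]_n|; rewrite t0 t1 normr_ge0 ne1 => /(_ isT isT).
  by move=> b1 b2; apply: le_lt_trans hr; exact: lerD.
(* Mean value theorem along ['e_k] for the increment [G] in direction ['e_l], then along ['e_l] for
   [partial k f]. *)
have key (k l : 'I_n) : exists2 y, ball x r y &
   f (x + h *: 'e_k + h *: 'e_l) - f (x + h *: 'e_k) - (f (x + h *: 'e_l) - f x)
    = h * (h * partial l (partial k f) y).
  pose G y := f (y + h *: 'e_l) - f y.
  have dfy y : ball x r y -> differentiable f y.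
    by move=> /Hr[Uy _]; exact: (ck_diff cf).
  have zo : 0 <= (0:R) <= 1 by rewrite lexx ler01.
  have oo : 0 <= (1:R) <= 1 by rewrite lexx ler01.
  have inb0 (s : R) : 0 <= s <= 1 -> ball x r (x + s *: (h *: 'e_k)).
    by move=> s01; have := inb s 0 k l s01 zo; rewrite scale0r addr0.
  have inb1 (s : R) : 0 <= s <= 1 -> ball x r (x + s *: (h *: 'e_k) + h *: 'e_l).
    by move=> s01; have := inb s 1 k l s01 oo; rewrite scale1r.
  have dG1 (s : R) : 0 <= s <= 1 -> differentiable (fun y => f (y + h *: 'e_l)) (x + s *: (h *: 'e_k)).
    move=> s01; apply: (differentiable_comp (f := fun y => y + h *: 'e_l)) => //.
    by apply: dfy; exact: inb1.
  have dG (s : R) : 0 <= s <= 1 -> differentiable G (x + s *: (h *: 'e_k)).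
    by move=> s01; apply: differentiableB; [exact: dG1|apply: dfy; exact: inb0].
  have [s s01 Gs] := mean_value_diff dG.
  have dpf y : ball x r y -> differentiable (partial k f) y.
    by move=> /Hr[Uy _]; exact: (ck_diff (ck_partial _ cf)).
  have [t t01 Pt] := @mean_value_diff _ (partial k f) (x + s *: (h *: 'e_k)) (h *: 'e_l)
     (fun t t01 => dpf _ (inb s t k l s01 t01)).
  exists (x + s *: (h *: 'e_k) + t *: (h *: 'e_l)); first exact: inb.
  rewrite -[LHS]/(G (x + h *: 'e_k) - G x) Gs.
  rewrite (deriveZv_diff _ _ (dG s s01)); congr (_ * _).
  rewrite deriveB; [|exact/diff_derivable/dG1|exact/diff_derivable/dfy/inb0].
  rewrite derive_translate -[X in X - _ = _]/(partial k f _) -/(partial k f _) Pt.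
  exact: (deriveZv_diff _ _ (dpf _ (inb s t k l s01 t01))).
have [y /Hr[_ [ay by_]] Ey] := key j i.
have [z /Hr[_ [az bz]] Ez] := key i j.
have swap : x + h *: 'e_j + h *: 'e_i = x + h *: 'e_i + h *: 'e_j by exact: addrAC.
rewrite swap in Ey.
have : h * (h * a y) = h * (h * b z).
  apply: etrans (esym Ey) (etrans _ Ez).
  move: (f _) (f _) (f _) (f _) => u v w z'; ring.
have hn0 : h != 0 by rewrite gt_eqF.
move=> /(mulfI hn0) /(mulfI hn0) ayz.
have := dist4_lt ay bz ayz.
by rewrite -splitr ltxx.
Qed.

Lemma ball_rV2 (x y : 'rV[R]_2) r : 0 < r ->
   ball x r y <-> `|x 0 0 - y 0 0| < r /\ `|x 0 1 - y 0 1| < r.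
Proof.
move=> r0; split=> [[_ H]|[H0 H1]]; first by split; exact: H.
split=> // i [[|[|//]] p]; rewrite ord1.
  by have -> : Ordinal p = 0 by exact: val_inj.
by have -> : Ordinal p = 1 by exact: val_inj.
Qed.

Lemma rV2E (h : 'rV[R]_2) : h = h 0 0 *: 'e_0 + h 0 1 *: 'e_1.
Proof.
apply/rowP => -[[|[|//]] p]; rewrite !mxE /= ?mulr1 ?mulr0 ?addr0 ?add0r; congr (h _ _); exact: val_inj.
Qed.

Lemma norm_lincomb2_le (p q a b a' b' m e : R) : `|p| <= m -> `|q| <= m ->
  `|a - a'| < e / 2 -> `|b - b'| < e / 2 -> `|p * (a' - a) + q * (b' - b)| <= e * m.
Proof.
move=> pm qm ae be; apply: le_trans (ler_normD _ _) _; rewrite !normrM.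
have -> : e * m = m * (e / 2) + m * (e / 2) by field.
by apply: lerD; apply: ler_pM => //; rewrite distrC ltW.
Qed.

(** The increment is split into a horizontal and a vertical leg. The mean value theorem on each leg
    gives a partial derivative at a nearby point, which continuity compares with its value at [x].
    This serves [prim], whose partial derivatives come from one-variable calculus. *)
Lemma differentiable_C1 (U : set 'rV[R]_2) (f : 'rV[R]_2 -> R) x :
  open U -> U x -> (forall i y, U y -> derivable f y 'e_i) ->
  (forall i, {for x, continuous (partial i f)}) -> differentiable f x.
Proof.
move=> oU Ux df cp.
pose L (h : 'rV[R]_2) : R := h 0 0 * partial 0 f x + h 0 1 * partial 1 f x.
have linL : linear L.
  by move=> a u v; rewrite /L !mxE /GRing.scale /=; ring.
pose Lm := GRing.isLinear.Build _ _ _ _ _ linL.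
pose LL : {linear _ -> _} := HB.pack L Lm.
have cL : continuous LL.
  have c i c0 : continuous (fun h : 'rV[R]_2 => h 0 i * c0).
    by move=> y; exact: (cvgM (@coord_continuous _ _ _ 0 i y) (cvg_cst _)).
  by move=> y; exact: (cvgD (c 0 _ y) (c 1 _ y)).
have h0 : f \o shift x = cst (f x) + LL +o_ (0 : 'rV[R]_2) id.
  apply/eqaddoP => _/posnumP[e].
  have e2 : 0 < e%:num / 2 by [].
  have /cvgrPdist_lt/(_ _ e2) n0 := cp 0.
  have /cvgrPdist_lt/(_ _ e2) n1 := cp 1.
  have nU : nbhs x U by exact: open_nbhs_nbhs.
  have [r /= r0 Hr] := (nbhs_ballP _ _).1 (filterI nU (filterI n0 n1)).
  apply/nbhs_ballP; exists r => // h.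
  move/(ball_rV2 _ _ r0); rewrite !mxE !sub0r !normrN => -[h0r h1r].
  have inb (s t : R) : 0 <= s <= 1 -> 0 <= t <= 1 ->
      ball x r (x + s *: (h 0 0 *: 'e_0) + t *: (h 0 1 *: 'e_1)).
    move=> /andP[s0 s1] /andP[t0 t1]; apply/(ball_rV2 _ _ r0).
    have sub (u v : R) : u - (u + v) = - v by ring.
    rewrite !mxE /= !mulr0 !mulr1 !addr0 !sub !normrN !normrM (ger0_norm s0) (ger0_norm t0).
    by split; [apply: le_lt_trans h0r|apply: le_lt_trans h1r]; rewrite ler_piMl.
  have zo : 0 <= (0:R) <= 1 by rewrite lexx ler01.
  have oo : 0 <= (1:R) <= 1 by rewrite lexx ler01.
  have inb0 (s : R) : 0 <= s <= 1 -> ball x r (x + s *: (h 0 0 *: 'e_0)).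
    by move=> s01; have := inb s 0 s01 zo; rewrite scale0r addr0.
  have inb1 (s : R) : 0 <= s <= 1 -> ball x r (x + h 0 0 *: 'e_0 + s *: (h 0 1 *: 'e_1)).
    by move=> s01; have := inb 1 s oo s01; rewrite scale1r.
  have dd i y c : ball x r y -> is_derive y (c *: 'e_i) f (c * partial i f y).
    by move=> /Hr[Uy _]; exact: deriveZv (df i y Uy).
  have [s s01 Es] := @mean_value_line _ f x (h 0 0 *: 'e_0)
     (fun s s01 => (@ex_derive _ _ _ _ _ _ _ (dd 0 _ (h 0 0) (inb0 s s01)))).
  have [t t01 Et] := @mean_value_line _ f (x + h 0 0 *: 'e_0) (h 0 1 *: 'e_1)
     (fun s s01 => (@ex_derive _ _ _ _ _ _ _ (dd 1 _ (h 0 1) (inb1 s s01)))).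
  move: Es Et.
  have [_ ->] := dd 0 _ (h 0 0) (inb0 s s01).
  have [_ ->] := dd 1 _ (h 0 1) (inb1 t t01).
  rewrite -addrA -rV2E => Es Et.
  rewrite !fctE /= [h + x]addrC.
  have [_ [a0 _]] := Hr _ (inb0 s s01); have [_ [_ a1]] := Hr _ (inb1 t t01).
  set A := partial 0 f _ in Es a0; set B := partial 1 f _ in Et a1.
  have -> : f (x + h) - (f x + L h) = h 0 0 * (A - partial 0 f x) + h 0 1 * (B - partial 1 f x).
    rewrite /L; move: Es Et; move: (f (x + h)) (f (x + _)) (f x) => u v w Es Et.
    have -> : u = (u - v) + (v - w) + w by ring.
    by rewrite Es Et; ring.
  have nh i : `|h 0 i| <= `|h|.
    by rewrite [leRHS]/Num.norm /= mx_normrE; apply: le_trans (le_bigmax _ _ (0, i)) => /=.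
  exact: (norm_lincomb2_le (nh 0) (nh 1) a0 a1).
by apply/diff_locallyP; rewrite (diff_unique cL h0); split.
Qed.

End Schwarz.

Section Coord.
Variables (R : realType) (n : nat).

Lemma partial_coordE j i : partial j (fun x : 'rV[R]_n => x 0 i) = fun=> (i == j)%:R.
Proof.
apply/funext => x.
have did : differentiable (@id 'rV[R]_n) x by [].
have := partial_coord j i did; rewrite /partial derive_id mxE eqxx /=.
by move=> <-; rewrite /= eq_sym.
Qed.

Lemma ck_coord k U i : ck k U (fun x : 'rV[R]_n => x 0 i).
Proof.
case: k => [|k] /=; first by move=> x _; exact: coord_continuous.
split=> [x _|j]; first exact: differentiable_coord.
by rewrite partial_coordE; exact: ck_cst.
Qed.
End Coord.

Lemma ck0P (R : realType) n (U : set 'rV[R]_n) f : ck 0 U f <-> forall x, U x -> {for x, continuous f}.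
Proof. by []. Qed.

Lemma ckSP (R : realType) n k (U : set 'rV[R]_n) f : ck k.+1 U f <->
  (forall x, U x -> differentiable f x) /\ forall i, ck k U (partial i f).
Proof. by []. Qed.

(* Unification must not unfold [ck] into limits of difference quotients. *)
Global Opaque ck.

(** * Integration of compactly supported functions on the plane *)

Section Int1.
Variable R : realType.
Notation mu := (@lebesgue_measure R).
Implicit Types (f g : R -> R).

Definition Int1 f : R := (\int[mu]_x f x)%R.

Definition cc1 f := continuous f /\ exists N : R, forall x, N < `|x| -> f x = 0.

Lemma suppRestrict f (a b : R) : (forall x, x < a -> f x = 0) -> (forall x, b < x -> f x = 0) ->
  f \_ `[a, b] = f.
Proof.
move=> fa fb; apply/funext => x; rewrite patchE; case: ifPn => //.
rewrite notin_setE /= in_itv /= => /negP; rewrite negb_and -!ltNge => /orP[xa|bx].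
  by rewrite fa.
by rewrite fb.
Qed.

Lemma integrable_supp f (a b : R) : continuous f ->
  (forall x, x < a -> f x = 0) -> (forall x, b < x -> f x = 0) ->
  mu.-integrable setT (EFin \o f).
Proof.
move=> cf fa fb; rewrite -(suppRestrict fa fb) -restrict_EFin; have mI : measurable (`[a, b] : set R) by [].
move: (integrable_mkcond (mu := mu) (EFin \o f) mI) => [H _]; apply: H.
apply: continuous_compact_integrable; first exact: segment_compact.
exact: continuous_subspaceT.
Qed.

Lemma integrable_cc1 f : cc1 f -> mu.-integrable setT (EFin \o f).
Proof.
move=> [cf [N fN]]; apply: (@integrable_supp _ (- N) N) => // x xN; apply: fN.
  by rewrite ltr_normr; apply/orP; right; rewrite ltrNr.
exact: lt_le_trans (ler_norm _).
Qed.

Lemma Int1_itv f (a b : R) : (forall x, x < a -> f x = 0) -> (forall x, b < x -> f x = 0) ->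
  Int1 f = (\int[mu]_(x in `[a, b]) f x)%R.
Proof. by move=> fa fb; rewrite Rintegral_mkcond (suppRestrict fa fb). Qed.

(** A primitive that is constant on both ends turns the integral into a difference of end values,
    without limits at infinity. *)
Lemma Int1_prim f (F : R -> R) (N c0 c1 : R) : continuous f ->
  (forall x : R, is_derive x 1 F (f x)) ->
  (forall x, x <= - N -> F x = c0) -> (forall x, N <= x -> F x = c1) ->
  Int1 f = c1 - c0.
Proof.
move=> cf dF F0 F1.
(* Strictly beyond [N], and positive: past [M] the primitive is constant on a neighbourhood, so its
   derivative [f] vanishes there. *)
pose M := `|N| + 1.
have M0 : 0 < M by rewrite ltr_pwDr.
have NM : N < M by rewrite /M; apply: le_lt_trans (ler_norm _) _; rewrite ltrDl.
have fa x : x < - M -> f x = 0.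
  move=> xM; have [_ <-] := dF x.
  rewrite -(derive_cst c0 x 1); apply: near_eq_derive.
  near=> y; apply: F0; apply: ltW.
  by near: y; apply: lt_nbhsl; apply: lt_trans xM _; rewrite ltrN2.
have fb x : M < x -> f x = 0.
  move=> xM; have [_ <-] := dF x.
  rewrite -(derive_cst c1 x 1); apply: near_eq_derive.
  near=> y; apply: F1; apply: ltW.
  by near: y; apply: lt_nbhsr; apply: lt_trans xM.
rewrite (Int1_itv fa fb) /Rintegral (@continuous_FTC2 _ f F) //=.
- have -> : F M = c1 by apply: F1; exact: ltW.
  by have -> : F (- M) = c0 by apply: F0; rewrite lerN2 ltW.
- by rewrite gtrN.
- exact: continuous_subspaceT.
- have cF : continuous F.
    by move=> x; apply: differentiable_continuous; apply/derivable1_diffP; case: (dF x).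
  split=> [x _||]; first by case: (dF x).
    exact: cvg_at_right_filter (cF _).
  exact: cvg_at_left_filter (cF _).
- by move=> x _; rewrite derive1E; case: (dF x).
Unshelve. all: by end_near. Qed.

Lemma ftc1_cc1 f (x : R) : cc1 f -> is_derive x 1 (fun x => (\int[mu]_(t in `]-oo, x]) f t)%R) (f x).
Proof.
move=> cf; have intf := integrable_cc1 cf.
have [] := @continuous_FTC1 _ f -oo%O x (x + 1) _ _ _ (cf.1 x).
- by rewrite ltrDl.
- exact: integrableS intf.
- by rewrite ltNyr.
by move=> dF F'; apply: DeriveDef; [exact: dF|rewrite -derive1E; exact: F'].
Qed.

Lemma prim_0 f N x : (forall y, N < `|y| -> f y = 0) -> x < - N -> (\int[mu]_(t in `]-oo, x]) f t)%R = 0.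
Proof.
move=> fN xN; rewrite (@eq_Rintegral _ _ _ _ _ (cst 0)) ?Rintegral_cst ?mul0r // => t.
rewrite inE /= in_itv /= => tx; apply: fN; rewrite ltr_normr; apply/orP; right; lra.
Qed.

Lemma prim_Int1 f N x : (forall y, N < `|y| -> f y = 0) -> N < x -> (\int[mu]_(t in `]-oo, x]) f t)%R = Int1 f.
Proof.
move=> fN xN; rewrite Rintegral_mkcond /Int1; congr (Rintegral _ _ _); apply/funext => t.
rewrite patchE; case: ifPn => //; rewrite notin_setE /= in_itv /= => /negP.
by rewrite -ltNge => xt; rewrite fN // ltr_normr; apply/orP; left; lra.
Qed.

Lemma prim_exists f : cc1 f -> exists F : R -> R, exists N : R,
  [/\ forall x : R, is_derive x 1 F (f x), forall x, x <= - N -> F x = 0 &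
      forall x, N <= x -> F x = Int1 f].
Proof.
move=> cf; have [N fN] := cf.2.
exists (fun x => \int[mu]_(t in `]-oo, x]) f t)%R, (N + 1); split=> [x|x xN|x xN].
- exact: ftc1_cc1.
- by rewrite (prim_0 fN) //; lra.
- by rewrite (prim_Int1 fN) //; lra.
Qed.

Lemma Int1D f g : cc1 f -> cc1 g -> Int1 (fun x => f x + g x) = Int1 f + Int1 g.
Proof. by move=> cf cg; apply: RintegralD => //; exact: integrable_cc1. Qed.

Lemma Int1Z c f : cc1 f -> Int1 (fun x => c * f x) = c * Int1 f.
Proof. by move=> cf; apply: RintegralZl => //; exact: integrable_cc1. Qed.

Lemma Int1_ge0 f : (forall x, 0 <= f x) -> 0 <= Int1 f.
Proof. by move=> f0; exact: Rintegral_ge0. Qed.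

(** The function $a^{-1} F(a x + b)$ is a primitive of the integrand. For $a < 0$ its two end values
    are exchanged, which is where the absolute value comes from. *)
Lemma Int1_affine f a b : a != 0 -> cc1 f -> Int1 (fun x => f (a * x + b)) = `|a|^-1 * Int1 f.
Proof.
move=> a0 cf; have [F [N [dF F0 F1]]] := prim_exists cf.
have cd : continuous (fun x => f (a * x + b)).
  move=> x; apply: (@continuous_comp _ _ _ (fun x => a * x + b) f); last exact: cf.1.
  exact: (cvgD (cvgM (cvg_cst a) (@cvg_id _ (nbhs x))) (cvg_cst b)).
have dd (x : R) : is_derive x 1 (fun x => a^-1 * F (a * x + b)) (f (a * x + b)).
  have dl : is_derive x 1 (fun x => a * x + b : R) a.
    by apply: is_derive_eq; rewrite addr0 [_ *: 1]mulr1.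
  have dF' : is_derive x 1 (F \o (fun x => a * x + b)) (f (a * x + b) * a).
    exact: is_derive1_comp.
  have -> : (fun x => a^-1 * F (a * x + b)) = a^-1 \*: (F \o (fun x => a * x + b)) by [].
  apply: is_derive_eq; rewrite -[_ *: _]/(_ * _); field.
  exact: a0.
have [ap|an|a0'] := ltrgtP a 0; last by rewrite a0' eqxx in a0.
- rewrite (@Int1_prim _ _ ((`|N| + `|b|) / `|a|) (a^-1 * Int1 f) 0 cd dd).
  + by rewrite ltr0_norm // sub0r invrN mulNr.
  + move=> x xN; rewrite F1 //.
    have : (`|N| + `|b|) / `|a| <= - x by lra.
    rewrite ler_pdivrMr ?normr_gt0 // (ltr0_norm ap) => H.
    have := ler_norm N; have := ler_norm (- b); rewrite normrN; lra.
  + move=> x; rewrite ler_pdivrMr ?normr_gt0 // (ltr0_norm ap) => H.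
    rewrite F0 ?mulr0 //; have := ler_norm N; have := ler_norm b; lra.
- rewrite (@Int1_prim _ _ ((`|N| + `|b|) / `|a|) 0 (a^-1 * Int1 f) cd dd).
  + by rewrite gtr0_norm // subr0.
  + move=> x xN; rewrite F0 ?mulr0 //.
    have : (`|N| + `|b|) / `|a| <= - x by lra.
    rewrite ler_pdivrMr ?normr_gt0 // (gtr0_norm an) => H.
    have := ler_norm N; have := ler_norm b; lra.
  + move=> x; rewrite ler_pdivrMr ?normr_gt0 // (gtr0_norm an) => H.
    rewrite F1 //; have := ler_norm N; have := ler_norm (- b); rewrite normrN; lra.
Qed.

End Int1.

(** * Integrals depending on a parameter *)

Section Under.
Variable R : realType.
Notation mu := (@lebesgue_measure R).

Lemma bump_integrable (N M : R) (B : set R) : measurable B ->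
  mu.-integrable B (EFin \o (fun y => M * \1_(`[- N, N]%classic) y)).
Proof.
move=> mB; apply: (integrableS measurableT) => //.
have -> : (fun y : R => M * \1_(`[- N, N]%classic) y) = (cst M) \_ `[- N, N].
  by apply/funext => y; rewrite patchE indicE; case: ifP => _; rewrite ?mulr1 ?mulr0.
have mI : measurable (`[- N, N] : set R) by [].
rewrite -restrict_EFin; move: (integrable_mkcond (mu := mu) (EFin \o cst M) mI) => [H _]; apply: H.
apply: continuous_compact_integrable; first exact: segment_compact.
by move=> y; exact: cst_continuous.
Qed.

Lemma le_bump (N M z y : R) : `|z| <= M -> (N < `|y| -> z = 0) -> `|z| <= M * \1_(`[- N, N]%classic) y.
Proof.
move=> zM z0; rewrite indicE; case: (boolP (y \in _)) => [_|]; first by rewrite mulr1.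
rewrite notin_setE /= in_itv /= -ler_norml => /negP; rewrite -ltNge => /z0 ->.
by rewrite normr0 mulr0.
Qed.

(** The common support in $[-N, N]$ and the bound [M] give the integrable majorant $M 1_{[-N,N]}$
    required for differentiating under the integral. *)
Lemma derive_under (f f' : R -> R -> R) (B : set R) (N M a : R) : measurable B ->
  (forall x y : R, is_derive x 1 (fun x => f x y) (f' x y)) ->
  (forall x, continuous (f x)) -> (forall x y, N < `|y| -> f x y = 0) ->
  (forall x y, `|f' x y| <= M) ->
  is_derive a 1 (fun x => (\int[mu]_(y in B) f x y)%R) ((\int[mu]_(y in B) f' a y)%R).
Proof.
move=> mB df cf fN fM.
have M0 : 0 <= M by apply: le_trans (fM 0 0).
have Ia : (`]a - 1, a + 1[%classic : set R) a by rewrite /= in_itv /=; apply/andP; split; lra.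
have f'E : partial1of2 f = f'.
  by apply/funext => x; apply/funext => y; rewrite partial1of2E; case: (df x y).
have i1 (x : R) : `]a - 1, a + 1[%classic x -> mu.-integrable B (EFin \o f x).
  move=> _; apply: (integrableS measurableT) => //; apply: integrable_cc1; split => //.
  by exists N => y; exact: fN.
have i2 (x y : R) : `]a - 1, a + 1[%classic x -> B y -> derivable (f^~ y) x 1.
  by move=> _ _; case: (df x y).
pose G (y : R) := M * \1_(`[- N, N]%classic) y : R.
have G0 y : 0 <= G y by rewrite mulr_ge0 // indicE ler0n.
have f'0 x y : N < `|y| -> f' x y = 0.
  move=> Ny; have [_ <-] := df x y.
  have -> : (fun x => f x y) = cst 0 by apply/funext => z; exact: fN.
  exact: derive_cst.
have i4 (x y : R) : `]a - 1, a + 1[%classic x -> B y -> `|partial1of2 f x y| <= G y.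
  by move=> _ _; rewrite f'E; apply: le_bump => //; exact: f'0.
have iG := bump_integrable N M mB.
have E := @differentiation_under_integral R _ _ mu f B mB a (a - 1) (a + 1) Ia i1 i2 G G0 iG i4.
have D := @derivable_under_integral R _ _ mu f B mB a (a - 1) (a + 1) Ia i1 i2 G G0 iG i4.
by apply: DeriveDef; [exact: D|rewrite -derive1E E f'E].
Qed.

Lemma continuous_under (f : R -> R -> R) (B : set R) (N M : R) : measurable B ->
  (forall y, continuous (fun x => f x y)) ->
  (forall x, continuous (f x)) -> (forall x y, N < `|y| -> f x y = 0) ->
  (forall x y, `|f x y| <= M) ->
  continuous (fun x => (\int[mu]_(y in B) f x y)%R).
Proof.
move=> mB cf1 cf fN fM a.
have Ia : a \in (`]a - 1, a + 1[%classic : set R).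
  by rewrite inE /= in_itv /=; apply/andP; split; lra.
apply: (@continuity_under_integral _ _ _ mu f B mB (a - 1) (a + 1) _ _ (fun y => M * \1_(`[- N, N]%classic) y) _ _ a Ia).
- move=> x _; apply: (integrableS measurableT) => //; apply: integrable_cc1; split => //.
  by exists N => y; exact: fN.
- by apply: aeW => y By x _; exact: cf1.
- exact: bump_integrable.
- by move=> x _; apply: aeW => y By; apply: le_bump => //; exact: fN.
Qed.

End Under.

(** * Iterated integrals over the plane *)

Section Int2.
Variable R : realType.
Notation mu := (@lebesgue_measure R).
Implicit Types (F : 'rV[R]_2 -> R).

Definition rv (s t : R) : 'rV[R]_2 := s *: 'e_0 + t *: 'e_1.

Lemma rv0 s t : rv s t 0 0 = s.
Proof. by rewrite /rv !mxE /= mulr1 mulr0 addr0. Qed.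

Lemma rv1 s t : rv s t 0 1 = t.
Proof. by rewrite /rv !mxE /= mulr1 mulr0 add0r. Qed.

Lemma rvK (x : 'rV[R]_2) : rv (x 0 0) (x 0 1) = x.
Proof. by rewrite /rv -rV2E. Qed.

Lemma norm_rV2_lt (x : 'rV[R]_2) N : 0 < N -> `|x| < N <-> `|x 0 0| < N /\ `|x 0 1| < N.
Proof.
move=> N0; have := @ball_rV2 R 0 x N N0; rewrite -ball_normE /= sub0r normrN !mxE !sub0r !normrN.
exact.
Qed.

Lemma norm_coord_le (x : 'rV[R]_2) i : `|x 0 i| <= `|x|.
Proof. by rewrite [leRHS]/Num.norm /= mx_normrE; apply: le_trans (le_bigmax _ _ (0, i)) => /=. Qed.

Lemma continuous_rv0 t : continuous (fun s => rv s t).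
Proof.
move=> s; apply: (@cvgD _ 'rV[R]_2); last exact: cvg_cst.
exact: scalel_continuous.
Qed.

Lemma continuous_rv1 s : continuous (fun t => rv s t).
Proof.
move=> t; apply: (@cvgD _ 'rV[R]_2); first exact: cvg_cst.
exact: scalel_continuous.
Qed.

Lemma is_derive_rv0 F s t : derivable F (rv s t) 'e_0 ->
  is_derive s 1 (fun s => F (rv s t)) (partial 0 F (rv s t)).
Proof.
rewrite /rv addrC => dF; have := derive_line dF.
by have -> : (fun u : R => F (t *: 'e_1 + u *: 'e_0)) = (fun s => F (s *: 'e_0 + t *: 'e_1))
  by apply/funext => u; rewrite addrC.
Qed.

Lemma is_derive_rv1 F s t : derivable F (rv s t) 'e_1 ->
  is_derive t 1 (fun t => F (rv s t)) (partial 1 F (rv s t)).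
Proof. exact: derive_line. Qed.

Definition cc2 k F := ck k setT F /\ exists N : R, forall x, N < `|x| -> F x = 0.

Lemma cc2_supp k F : cc2 k F -> exists2 N : R, 0 < N &
   forall s t, N < `|s| \/ N < `|t| -> F (rv s t) = 0.
Proof.
move=> [_ [N FN]]; exists (`|N| + 1); first by rewrite ltr_pwDr.
have NN : N < `|N| + 1 by apply: le_lt_trans (ler_norm _) _; rewrite ltrDl.
move=> s t [h|h]; apply: FN; apply: lt_trans NN _; apply: lt_le_trans h _.
  by have := norm_coord_le (rv s t) 0; rewrite rv0.
by have := norm_coord_le (rv s t) 1; rewrite rv1.
Qed.

Lemma cc2_partial k F i : cc2 k.+1 F -> cc2 k (partial i F).
Proof.
move=> [cF [N FN]]; split; first exact: ck_partial.
exists N => x xN; rewrite -(congr1 (fun h => h x) (partial_cst i 0)); apply: partial_near.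
have : nbhs x [set y | N < `|y|].
  apply: open_nbhs_nbhs; split => //.
  apply: (@open_comp _ _ (fun y : 'rV[R]_2 => `|y|) [set z | N < z]); last exact: open_gt.
  by move=> y _; exact: norm_continuous.
by apply: filterS => y /FN ->.
Qed.

Lemma cc2_le k l F : (l <= k)%N -> cc2 k F -> cc2 l F.
Proof. by move=> lk [cF sF]; split => //; exact: ck_le cF. Qed.

Lemma cc2D k F G : cc2 k F -> cc2 k G -> cc2 k (fun x => F x + G x).
Proof.
move=> [cF [N FN]] [cG [N' GN]]; split; first exact: (ckD openT cF cG).
exists (Num.max N N') => x; rewrite gt_max => /andP[h h'].
by rewrite FN // GN // addr0.
Qed.

Lemma cc2M k F G : ck k setT F -> cc2 k G -> cc2 k (fun x => F x * G x).
Proof.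
move=> cF [cG [N' GN]]; split; first exact: (ckM openT cF cG).
by exists N' => x h; rewrite GN // mulr0.
Qed.

Lemma cc2Z k c F : cc2 k F -> cc2 k (fun x => c * F x).
Proof. by apply: cc2M; exact: ck_cst. Qed.

Lemma cc2_0 k : cc2 k (fun=> 0).
Proof. by split; [exact: ck_cst|exists 0]. Qed.

Lemma cc2_sum k (I : Type) (r : seq I) (P : pred I) (F : I -> 'rV[R]_2 -> R) :
  (forall j, cc2 k (F j)) -> cc2 k (fun y => \sum_(j <- r | P j) F j y).
Proof.
move=> cF; elim: r => [|j r IH].
  have -> : (fun y => \sum_(j <- [::] | P j) F j y) = fun=> 0 by apply/funext => y; rewrite big_nil.
  exact: cc2_0.
have [Pj|Pj] := boolP (P j).
  have -> : (fun y => \sum_(k <- j :: r | P k) F k y) = fun y => F j y + \sum_(k <- r | P k) F k y.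
    by apply/funext => y; rewrite big_cons Pj.
  exact: cc2D.
have -> : (fun y => \sum_(k <- j :: r | P k) F k y) = fun y => \sum_(k <- r | P k) F k y.
  by apply/funext => y; rewrite big_cons (negbTE Pj).
exact: IH.
Qed.

Lemma cc2_cont k F : cc2 k F -> continuous F.
Proof. by move=> [cF _] x; exact: (ck_cont cF). Qed.

Lemma cc2_bounded k F : cc2 k F -> exists M : R, forall x, `|F x| <= M.
Proof.
move=> cF; have cont := cc2_cont cF; have [N N0 FN] := cc2_supp cF.
pose A := [set x : 'rV[R]_2 | `|x| <= N].
have cA : compact A.
  apply: bounded_closed_compact.
    by exists N; split; [exact: num_real|move=> m Nm x /= xN; apply: le_trans xN (ltW Nm)].
  apply: (@closed_comp _ _ (fun y : 'rV[R]_2 => `|y|) [set z | z <= N]); last exact: closed_le.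
  by move=> y _; exact: norm_continuous.
have A0 : A !=set0 by exists 0; rewrite /A /= normr0 ltW.
have cn : {within A, continuous (fun x => `|F x|)}.
  apply: continuous_subspaceT => x; apply: (@continuous_comp _ _ _ F (fun z => `|z|)); first exact: cont.
  exact: norm_continuous.
have [c cA' cM] := EVT_max_rV A0 cA cn.
exists (`|F c|) => x; have [xA|xA] := pselect (A x); first by apply: cM; rewrite inE.
suff -> : F x = 0 by rewrite normr0.
rewrite -(rvK x); apply: FN; apply: contrapT => h; apply: xA; rewrite /A /=.
apply: contrapT => /negP; rewrite -ltNge => xN.
have [x0 x1] : `|x 0 0| <= N /\ `|x 0 1| <= N.
  by split; rewrite leNgt; apply/negP => i; apply: h; [left|right].
have := (norm_rV2_lt x (lt_trans N0 xN)).2 (conj (le_lt_trans x0 xN) (le_lt_trans x1 xN)).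
by rewrite ltxx.
Qed.

Lemma cc2_cc1_0 k F t : cc2 k F -> cc1 (fun s => F (rv s t)).
Proof.
move=> cF; have [N N0 FN] := cc2_supp cF; split; last by exists N => s sN; apply: FN; left.
by move=> s; apply: (@continuous_comp _ _ _ (fun s => rv s t) F); [exact: continuous_rv0|exact: cc2_cont cF _].
Qed.

Lemma cc2_cc1_1 k F s : cc2 k F -> cc1 (fun t => F (rv s t)).
Proof.
move=> cF; have [N N0 FN] := cc2_supp cF; split; last by exists N => t tN; apply: FN; right.
by move=> t; apply: (@continuous_comp _ _ _ (fun t => rv s t) F); [exact: continuous_rv1|exact: cc2_cont cF _].
Qed.

Definition inner F (t : R) : R := Int1 (fun s => F (rv s t)).
Definition Int2 F : R := Int1 (inner F).

Lemma inner_cc1 k F : cc2 k F -> cc1 (inner F).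
Proof.
move=> cF; have [N N0 FN] := cc2_supp cF; have [M FM] := cc2_bounded cF; split.
  apply: (@continuous_under R (fun t s => F (rv s t)) setT N M) => //.
  - by move=> s; have [] := cc2_cc1_1 s cF.
  - by move=> t; have [] := cc2_cc1_0 t cF.
  - by move=> t s sN; apply: FN; left.
exists N => t tN; rewrite /inner.
have -> : (fun s => F (rv s t)) = (fun=> 0) by apply/funext => s; apply: FN; right.
by rewrite /Int1 Rintegral_cst // mul0r.
Qed.

Lemma cc2_derive0 k F (s t : R) : cc2 k.+1 F -> is_derive s 1 (fun s => F (rv s t)) (partial 0 F (rv s t)).
Proof. by move=> [cF _]; apply: is_derive_rv0; apply: diff_derivable; exact: (ck_diff cF). Qed.

Lemma cc2_derive1 k F (s t : R) : cc2 k.+1 F -> is_derive t 1 (fun t => F (rv s t)) (partial 1 F (rv s t)).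
Proof. by move=> [cF _]; apply: is_derive_rv1; apply: diff_derivable; exact: (ck_diff cF). Qed.

Lemma inner_derive k F (t : R) : cc2 k.+1 F -> is_derive t 1 (inner F) (inner (partial 1 F) t).
Proof.
move=> cF; have [N N0 FN] := cc2_supp cF; have [M FM] := cc2_bounded (cc2_partial 1 cF).
apply: (@derive_under R (fun t s => F (rv s t)) (fun t s => partial 1 F (rv s t)) setT N M) => //.
- by move=> u s; exact: (cc2_derive1 s u cF).
- by move=> u; have [] := cc2_cc1_0 u cF.
- by move=> u s sN; apply: FN; left.
Qed.

(** With [Int2_partial1] this is the divergence theorem for compactly supported fields. Here the
    inner integral already vanishes; in the other direction the inner integral is differentiated as
    a function of the second coordinate. *)
Lemma Int2_partial0 k F : cc2 k.+1 F -> Int2 (partial 0 F) = 0.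
Proof.
move=> cF; rewrite /Int2; have -> : inner (partial 0 F) = fun=> 0.
  apply/funext => t; have [N N0 FN] := cc2_supp cF.
  have [cp _] := cc2_cc1_0 t (cc2_partial 0 cF).
  rewrite /inner (Int1_prim (N := N + 1) (c0 := 0) (c1 := 0) cp (fun s => cc2_derive0 s t cF)) ?subr0 //.
  - by move=> s sN; apply: FN; left; rewrite ltr_normr; apply/orP; right; lra.
  - by move=> s sN; apply: FN; left; rewrite ltr_normr; apply/orP; left; lra.
by rewrite /Int1 Rintegral_cst // mul0r.
Qed.

Lemma Int2_partial1 k F : cc2 k.+1 F -> Int2 (partial 1 F) = 0.
Proof.
move=> cF; have [ci [N iN]] := inner_cc1 cF; have [cp _] := inner_cc1 (cc2_partial 1 cF).
rewrite /Int2 (Int1_prim (N := N + 1) (c0 := 0) (c1 := 0) cp (fun t => inner_derive t cF)) ?subr0 //.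
- by move=> s sN; apply: iN; rewrite ltr_normr; apply/orP; right; lra.
- by move=> s sN; apply: iN; rewrite ltr_normr; apply/orP; left; lra.
Qed.

Lemma Int2D k F G : cc2 k F -> cc2 k G -> Int2 (fun x => F x + G x) = Int2 F + Int2 G.
Proof.
move=> cF cG; rewrite /Int2 -Int1D; [|exact: inner_cc1 cF|exact: inner_cc1 cG].
congr Int1; apply/funext => t; rewrite /inner -Int1D //; [exact: cc2_cc1_0 cF|exact: cc2_cc1_0 cG].
Qed.

Lemma Int2Z k c F : cc2 k F -> Int2 (fun x => c * F x) = c * Int2 F.
Proof.
move=> cF; rewrite /Int2 -Int1Z; last exact: inner_cc1 cF.
congr Int1; apply/funext => t; rewrite /inner -Int1Z //; exact: cc2_cc1_0 cF.
Qed.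

Lemma Int2_0 : Int2 (fun=> 0) = 0.
Proof.
have i0 : Int1 (fun=> 0 : R) = 0 by rewrite /Int1 Rintegral_cst // mul0r.
by rewrite /Int2; have -> : inner (fun=> 0) = fun=> 0 by apply/funext => t; exact: i0.
Qed.

Lemma Int2_sum k (I : Type) (r : seq I) (P : pred I) (F : I -> 'rV[R]_2 -> R) :
  (forall j, cc2 k (F j)) -> Int2 (fun y => \sum_(j <- r | P j) F j y) = \sum_(j <- r | P j) Int2 (F j).
Proof.
move=> cF; elim: r => [|j r IH].
  rewrite big_nil -[RHS]Int2_0; congr Int2; apply/funext => y; exact: big_nil.
rewrite big_cons; have [Pj|Pj] := boolP (P j).
  rewrite -IH -(Int2D (cF j) (cc2_sum _ _ cF)).
  by congr Int2; apply/funext => y; rewrite big_cons Pj.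
by rewrite -IH; congr Int2; apply/funext => y; rewrite big_cons (negbTE Pj).
Qed.

End Int2.

(** * Primitives in the first variable, and exchange of the order of integration *)

Section Primitive.
Variable R : realType.
Notation mu := (@lebesgue_measure R).
Implicit Types (F : 'rV[R]_2 -> R).

Lemma partial_rv0 F (s t d : R) : is_derive s 1 (fun s => F (rv s t)) d ->
  derivable F (rv s t) 'e_0 /\ partial 0 F (rv s t) = d.
Proof.
have E : (fun h : R => h^-1 *: (F (rv (h *: 1 + s) t) - F (rv s t))) =
   (fun h => h^-1 *: (F (h *: 'e_0 + rv s t) - F (rv s t))).
  apply/funext => h; congr (_ *: (F _ - _)).
  by rewrite [h *: 1]mulr1 /rv scalerDl addrA.
move=> [+ +]; rewrite /derivable E => H; rewrite /derive /= E => H'.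
by split.
Qed.

Lemma partial_rv1 F (s t d : R) : is_derive t 1 (fun t => F (rv s t)) d ->
  derivable F (rv s t) 'e_1 /\ partial 1 F (rv s t) = d.
Proof.
have E : (fun h : R => h^-1 *: (F (rv s (h *: 1 + t)) - F (rv s t))) =
   (fun h => h^-1 *: (F (h *: 'e_1 + rv s t) - F (rv s t))).
  apply/funext => h; congr (_ *: (F _ - _)).
  by rewrite [h *: 1]mulr1 /rv scalerDl addrCA.
move=> [+ +]; rewrite /derivable E => H; rewrite /derive /= E => H'.
by split.
Qed.

Definition prim F (x : 'rV[R]_2) : R := (\int[mu]_(u in `]-oo, x 0 0]) F (rv u (x 0 1)))%R.

Lemma prim_derive0 k F (s t : R) : cc2 k F -> is_derive s 1 (fun s => prim F (rv s t)) (F (rv s t)).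
Proof.
move=> cF; have := @ftc1_cc1 R _ s (cc2_cc1_0 t cF).
rewrite /prim; under [in X in _ -> X]eq_fun do rewrite rv0 rv1.
exact.
Qed.

Lemma prim_continuous1 k F s : cc2 k F -> continuous (fun t => prim F (rv s t)).
Proof.
move=> cF; have [N N0 FN] := cc2_supp cF; have [M FM] := cc2_bounded cF.
rewrite /prim; under [in X in continuous X]eq_fun do rewrite rv0 rv1.
apply: (@continuous_under R (fun t u => F (rv u t)) `]-oo, s]%classic N M) => //.
- by move=> u; have [] := cc2_cc1_1 u cF.
- by move=> t; have [] := cc2_cc1_0 t cF.
- by move=> t u uN; apply: FN; left.
Qed.

Lemma prim_derive1 k F (s t : R) : cc2 k.+1 F ->
  is_derive t 1 (fun t => prim F (rv s t)) (prim (partial 1 F) (rv s t)).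
Proof.
move=> cF; have [N N0 FN] := cc2_supp cF; have [M FM] := cc2_bounded (cc2_partial 1 cF).
rewrite /prim rv0 rv1; under [X in is_derive _ _ X _]eq_fun do rewrite rv0 rv1.
apply: (@derive_under R (fun t u => F (rv u t)) (fun t u => partial 1 F (rv u t)) `]-oo, s]%classic N M) => //.
- by move=> u v; exact: (cc2_derive1 v u cF).
- by move=> u; have [] := cc2_cc1_0 u cF.
- by move=> u v vN; apply: FN; left.
Qed.

(** A Lipschitz bound in the first variable, uniform in the second: it upgrades separate continuity
    of [prim F] to joint continuity. *)
Lemma prim_lip k F : cc2 k F -> exists2 M : R, 0 < M & forall s s' t, `|prim F (rv s t) - prim F (rv s' t)| <= M * `|s - s'|.
Proof.
move=> cF; have [M FM] := cc2_bounded cF; exists (`|M| + 1); first by rewrite ltr_pwDr.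
move=> s s' t.
have dv (u : R) : is_derive (s' + u *: (s - s')) (s - s') (fun s => prim F (rv s t)) ((s - s') * F (rv (s' + u *: (s - s')) t)).
  have [d1 d2] := prim_derive0 (s' + u *: (s - s')) t cF.
  have := deriveZv (s - s') d1; rewrite d2 [(s - s') *: 1]mulr1; exact.
have [u _] := @mean_value_line R _ (fun s => prim F (rv s t)) s' (s - s')
   (fun u _ => let: DeriveDef d _ := dv u in d).
have [_ ->] := dv u; rewrite subrKC => ->.
rewrite normrM mulrC ler_wpM2r //; apply: le_trans (FM _) _.
by apply: le_trans (ler_norm _) _; rewrite lerDl.
Qed.

Lemma prim_continuous k F : cc2 k F -> continuous (prim F).
Proof.
move=> cF x; have [M M0 HM] := prim_lip cF; apply/(@cvgrPdist_lt _ _ _ (nbhs x)) => e e0.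
have e2 : 0 < e / 2 by rewrite divr_gt0.
have c1 := @prim_continuous1 k F (x 0 0) cF.
have /cvgrPdist_lt/(_ _ e2) := c1 (x 0 1).
move=> /nbhs_ballP[r /= r0 Hr].
have d0 : 0 < e / 2 / M by rewrite divr_gt0.
pose m := Num.min r (e / 2 / M).
have m0 : 0 < m by rewrite lt_min r0.
apply/nbhs_ballP; exists m => // y /(ball_rV2 _ _ m0)[].
rewrite !lt_min => /andP[_ h0] /andP[h1 _].
have := Hr (y 0 1) h1; rewrite rvK => H1.
have -> : prim F x - prim F y = (prim F x - prim F (rv (x 0 0) (y 0 1))) + (prim F (rv (x 0 0) (y 0 1)) - prim F y).
  by rewrite subrKA.
apply: le_lt_trans (ler_normD _ _) _; rewrite [e]splitr; apply: ltr_leD => //.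
rewrite -{2}(rvK y); apply: le_trans (HM _ _ _) _.
by rewrite mulrC -ler_pdivlMr // ltW.
Qed.

Lemma partial0_prim k F : cc2 k F -> partial 0 (prim F) = F.
Proof. by move=> cF; apply/funext => x; rewrite -(rvK x); have [] := partial_rv0 (prim_derive0 (x 0 0) (x 0 1) cF). Qed.

Lemma partial1_prim k F : cc2 k.+1 F -> partial 1 (prim F) = prim (partial 1 F).
Proof. by move=> cF; apply/funext => x; rewrite -(rvK x); have [] := partial_rv1 (prim_derive1 (x 0 0) (x 0 1) cF). Qed.

Lemma ord2P (P : 'I_2 -> Prop) : P 0 -> P 1 -> forall i, P i.
Proof.
move=> P0 P1 [[|[|//]] p]; first by have -> : Ordinal p = 0 by exact: val_inj.
by have -> : Ordinal p = 1 by exact: val_inj.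
Qed.

(** The primitive gains no regularity in the second variable, where its derivative is
    [prim (partial 1 F)]. It need not have compact support either: to the right of the support of
    [F] it equals the inner integral. *)
Lemma prim_ck1 F : cc2 1 F -> ck 1 setT (prim F).
Proof.
move=> cF.
have cp i : continuous (partial i (prim F)).
  move: i; apply: ord2P; first by rewrite (partial0_prim cF); exact: cc2_cont cF.
  by rewrite (partial1_prim cF); exact: prim_continuous (cc2_partial 1 cF).
apply/ckSP; split=> [x _|i]; last by apply/ck0P => x _; exact: cp.
apply: (@differentiable_C1 _ setT) => //; first exact: openT.
- move=> i y _; move: i; rewrite -(rvK y); apply: ord2P.
    by have [] := partial_rv0 (prim_derive0 (y 0 0) (y 0 1) cF).
  by have [] := partial_rv1 (prim_derive1 (y 0 0) (y 0 1) cF).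
- by move=> i; exact: cp.
Qed.

(** Fubini's theorem through primitives. The integral in [t] of [prim F (rv s t)] has, as a function
    of [s], the derivative appearing under the outer integral on the left; it vanishes for very
    negative [s] and equals [Int2 F] for large [s]. *)
Lemma Int2_swap k F : cc2 k F -> Int1 (fun s => Int1 (fun t => F (rv s t))) = Int2 F.
Proof.
move=> cF; have [N N0 FN] := cc2_supp cF; have [M FM] := cc2_bounded cF.
have cs : continuous (fun s => Int1 (fun t => F (rv s t))).
  apply: (@continuous_under R (fun s t => F (rv s t)) setT N M) => //.
  - by move=> t; have [] := cc2_cc1_0 t cF.
  - by move=> s; have [] := cc2_cc1_1 s cF.
  - by move=> s t tN; apply: FN; right.
have ds (s : R) : is_derive s 1 (fun s => Int1 (fun t => prim F (rv s t))) (Int1 (fun t => F (rv s t))).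
  apply: (@derive_under R (fun s t => prim F (rv s t)) (fun s t => F (rv s t)) setT N M) => //.
  - by move=> x y; exact: prim_derive0 cF.
  - by move=> x; exact: prim_continuous1 cF.
  - move=> x y yN; rewrite /prim rv0 rv1 (@eq_Rintegral _ _ _ _ _ (cst 0)) ?Rintegral_cst ?mul0r // => t _.
    by apply: FN; right.
have FN0 t s : N < `|s| -> F (rv s t) = 0 by move=> sN; apply: FN; left.
rewrite -[RHS]subr0; apply: (Int1_prim (N := N + 1) cs ds).
- move=> s sN; have -> : (fun t => prim F (rv s t)) = fun=> 0.
    by apply/funext => t; rewrite /prim rv0 rv1 (prim_0 (FN0 t)) //; lra.
  by rewrite /Int1 Rintegral_cst // mul0r.
- move=> s sN; congr Int1; apply/funext => t.
  by rewrite /prim rv0 rv1 (prim_Int1 (FN0 t)) //; lra.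
Qed.

End Primitive.

(** * Affine changes of variables *)

Section Linear.
Variable R : realType.
Implicit Types (F : 'rV[R]_2 -> R).

Definition aff (a b c d e f : R) (x : 'rV[R]_2) : 'rV[R]_2 :=
  rv (a * x 0 0 + b * x 0 1 + e) (c * x 0 0 + d * x 0 1 + f).

Lemma continuous_rvf (T : topologicalType) (f g : T -> R) :
  continuous f -> continuous g -> continuous (fun x => rv (f x) (g x)).
Proof.
move=> cf cg x; apply: (@cvgD _ 'rV[R]_2); apply: cvgZr_tmp; [exact: cf|exact: cg].
Qed.

Lemma ck_lin k p q r : ck k setT (fun x : 'rV[R]_2 => p * x 0 0 + q * x 0 1 + r).
Proof.
apply: (ckD openT); last exact: ck_cst.
by apply: (ckD openT); apply: (ckZ openT); exact: ck_coord.
Qed.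

Lemma aff_continuous a b c d e f : continuous (aff a b c d e f).
Proof. by apply: continuous_rvf => x; exact: (ck_cont (ck_lin 0 _ _ _)). Qed.

Lemma cc2_aff k F a b c d e f : a * d - b * c != 0 -> cc2 k F -> cc2 k (F \o aff a b c d e f).
Proof.
move=> D0 cF; have [N N0 FN] := cc2_supp cF; split.
  have cj j : ck k setT (fun x => aff a b c d e f x 0 j).
    move: j; apply: ord2P; rewrite /aff; under eq_fun do rewrite ?rv0 ?rv1; exact: ck_lin.
  have ct x : setT x -> {for x, continuous (aff a b c d e f)} by move=> _; exact: aff_continuous.
  exact: (ck_comp (V := setT) openT (fun _ _ => I) cj ct cF.1).
(* Cramer's rule bounds [x] by this constant whenever its image lies in the square of half-side
   [N]. *)
pose C := (`|a| + `|b| + `|c| + `|d|) * (N + `|e| + `|f|) / `|a * d - b * c|.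
exists C => x xC; rewrite /= /aff.
set s := a * _ + _ + _; set t := c * _ + _ + _.
have [sN|sN] := ltP N `|s|; first by apply: FN; left.
have [tN|tN] := ltP N `|t|; first by apply: FN; right.
exfalso; move: xC; apply/negP; rewrite -leNgt.
have D1 : 0 < `|a * d - b * c| by rewrite normr_gt0.
have C0 : 0 <= C by rewrite /C !mulr_ge0 ?invr_ge0 ?addr_ge0 // ltW.
have x0 : (a * d - b * c) * x 0 0 = d * (s - e) - b * (t - f) by rewrite /s /t; ring.
have x1 : (a * d - b * c) * x 0 1 = a * (t - f) - c * (s - e) by rewrite /s /t; ring.
have se : `|s - e| <= N + `|e| + `|f|.
  by apply: le_trans (ler_normB _ _) _; have := normr_ge0 f; lra.
have tf : `|t - f| <= N + `|e| + `|f|.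
  by apply: le_trans (ler_normB _ _) _; have := normr_ge0 e; lra.
set K := N + _ + _ in se tf C0 *.
have K0 : 0 <= K by apply: le_trans se.
have lin (p q : R) u v : `|u| <= K -> `|v| <= K -> `|p * u - q * v| <= (`|p| + `|q|) * K.
  move=> uK vK; apply: le_trans (ler_normB _ _) _; rewrite !normrM mulrDl.
  by apply: lerD; apply: ler_wpM2l.
suff H i : `|x 0 i| <= C.
  rewrite [leLHS]/Num.norm /= mx_normrE; apply: bigmax_le => //= -[p q] _.
  by rewrite ord1; exact: H.
move: i; apply: ord2P; rewrite /C ler_pdivlMr // -normrM mulrC ?x0 ?x1.
  apply: le_trans (lin _ _ _ _ se tf) _; rewrite -/K; apply: ler_wpM2r => //.
  by have := normr_ge0 a; have := normr_ge0 c; lra.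
apply: le_trans (lin _ _ _ _ tf se) _; rewrite -/K; apply: ler_wpM2r => //.
by have := normr_ge0 b; have := normr_ge0 d; lra.
Qed.

(** The map is factored into two one-variable affine substitutions: first in [s] at fixed [t], with
    factor [a], then in [t] after exchanging the integrals, with factor [dl]. Their product is the
    determinant. *)
Lemma Int2_aff_ne0 k F a b c d e f : a != 0 -> a * d - b * c != 0 -> cc2 k F ->
  Int2 (F \o aff a b c d e f) = `|a * d - b * c|^-1 * Int2 F.
Proof.
move=> a0 D0 cF.
(* In terms of $u = a s + b t + e$ the second coordinate reads $(c/a) u + dl\, t + g$. *)
pose dl := (a * d - b * c) / a; pose g := f - c * e / a.
have dl0 : dl != 0 by rewrite mulf_neq0 // invr_eq0.
pose F1 := F \o aff 1 0 (c / a) dl 0 g.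
have cF1 : cc2 k F1 by apply: cc2_aff => //; rewrite mul1r mul0r subr0.
have -> : Int2 (F \o aff a b c d e f) = `|a|^-1 * Int2 F1.
  rewrite -(Int2Z _ cF1) /Int2; congr Int1; apply/funext => t.
  rewrite /inner (Int1Z _ (cc2_cc1_0 t cF1)) -(Int1_affine (b * t + e) a0 (cc2_cc1_0 t cF1)).
  congr Int1; apply/funext => s; rewrite /F1 /= /aff !rv0 !rv1; congr (F (rv _ _)).
    by ring.
  by rewrite /dl /g; field.
rewrite -(Int2_swap cF1) -(Int2_swap cF).
have -> : (fun s => Int1 (fun t => F1 (rv s t))) = fun s => `|dl|^-1 * Int1 (fun t => F (rv s t)).
  apply/funext => s; rewrite -(Int1_affine (c / a * s + g) dl0 (cc2_cc1_1 s cF)).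
  congr Int1; apply/funext => t; rewrite /F1 /= /aff !rv0 !rv1; congr (F (rv _ _)); ring.
rewrite Int1Z; last first.
  (* The function of [s] to be integrated is the inner integral of [F] with its two coordinates
     exchanged. *)
  have cs : cc2 k (F \o aff 0 1 1 0 0 0).
    by apply: cc2_aff => //; rewrite mulr0 mul1r sub0r oppr_eq0 oner_eq0.
  have := inner_cc1 cs; rewrite /inner; congr cc1; apply/funext => t.
  congr Int1; apply/funext => s; rewrite /= /aff !rv0 !rv1; congr (F (rv _ _)); ring.
rewrite mulrA -invfM -normrM; congr (`|_|^-1 * _).
by rewrite /dl; field.
Qed.

(** When $a = 0$, exchanging the two integration variables puts the nonzero entry [b] in its place
    and only changes the sign of the determinant. *)
Lemma Int2_aff k F a b c d e f : a * d - b * c != 0 -> cc2 k F ->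
  Int2 (F \o aff a b c d e f) = `|a * d - b * c|^-1 * Int2 F.
Proof.
move=> D0 cF; have [a0|a0] := eqVneq a 0; last exact: Int2_aff_ne0 cF.
have b0 : b != 0 by apply: contraNneq D0 => b0; rewrite a0 b0 !mul0r subrr.
have D0' : b * c - a * d != 0 by rewrite -opprB oppr_eq0.
have -> : Int2 (F \o aff a b c d e f) = Int2 (F \o aff b a d c e f).
  rewrite -(Int2_swap (cc2_aff e f D0 cF)) /Int2; congr Int1; apply/funext => s.
  rewrite /inner; congr Int1; apply/funext => t; rewrite /= /aff !rv0 !rv1; congr (F (rv _ _)); ring.
by rewrite (Int2_aff_ne0 _ _ b0 D0' cF) -normrN opprB.
Qed.

End Linear.

(** * Change of variables *)

Section Cutoff.
Variable R : realType.

Definition posp (t : R) : R := Num.max 0 t.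

Lemma posp_continuous : continuous posp.
Proof. by move=> t; apply: continuous_max; [exact: cst_continuous|exact: cvg_id]. Qed.

Lemma posp_ge0 t : 0 <= posp t.
Proof. by rewrite /posp le_max lexx. Qed.

Lemma posp_gt0 t : 0 < t -> 0 < posp t.
Proof. by move=> t0; rewrite /posp lt_max t0 orbT. Qed.

Lemma posp_eq0 t : t <= 0 -> posp t = 0.
Proof. by move=> t0; rewrite /posp max_l. Qed.

(** Powers of the positive part supply cutoffs of any finite class: the power $k+1$ is of class
    $C^k$. Only $t = 0$ needs care, and there the difference quotient at [h] is at most
    $|h|^{n+1}$. *)
Lemma is_derive_posp n (t : R) : is_derive t 1 (fun t => posp t ^+ n.+2) (n.+2%:R * posp t ^+ n.+1).
Proof.
have [t0|t0|->] := ltrgtP t 0.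
- rewrite (posp_eq0 (ltW t0)) expr0n mulr0.
  apply: (@near_eq_is_derive R R R (fun=> 0)).
  have : \forall u \near t, u < 0 by exact: lt_nbhsl.
  by apply: filterS => u u0; rewrite posp_eq0 ?ltW // expr0n.
- have -> : posp t = t by rewrite /posp max_r // ltW.
  apply: (@near_eq_is_derive R R R (fun u => u ^+ n.+2)).
    have : \forall u \near t, 0 < u by exact: lt_nbhsr.
    by apply: filterS => u u0; rewrite /posp max_r // ltW.
  split; first exact: exprn_derivable.
  by rewrite exp_derive [_ *: 1]mulr1.
rewrite posp_eq0 // expr0n mulr0.
suff H : (fun h : R => h^-1 *: (posp (h *: 1 + 0) ^+ n.+2 - posp 0 ^+ n.+2)) @ 0^' --> (0 : R).
  by split; [apply/cvg_ex; exists 0|apply: cvg_lim].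
apply/cvgr0Pnorm_lt => e e0.
have m0 : 0 < Num.min 1 e by rewrite lt_min ltr01.
near=> h; have h0 : h != 0 by near: h; exact: nbhs_dnbhs_neq.
have : `|h| < Num.min 1 e by near: h; exact: dnbhs0_lt.
rewrite lt_min => /andP[h1 he].
rewrite addr0 [h *: 1]mulr1 (posp_eq0 (lexx 0)) expr0n subr0 -[_ *: _]/(_ * _).
rewrite normrM normfV normrX mulrC ltr_pdivrMr ?normr_gt0 //.
have ph : `|posp h| <= `|h|.
  by rewrite ger0_norm ?posp_ge0 // /posp ge_max normr_ge0 ler_norm.
apply: le_lt_trans (_ : `|h| ^+ n.+2 < _).
  by apply: lerXn2r; rewrite ?nnegrE.
rewrite exprSr ltr_pM2r ?normr_gt0 //; apply: le_lt_trans he.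
by rewrite exprSr ler_piMl // exprn_ile1 // ltW.
Unshelve. all: by end_near. Qed.

Lemma ck_posp n k (U : set 'rV[R]_n) f : open U -> ck k U f -> ck k U (fun x => posp (f x) ^+ k.+1).
Proof.
move=> oU; elim: k f => [|k IH] f.
  move=> /ck0P cf; apply/ck0P => x Ux.
  by apply: (@continuous_comp _ _ _ f posp); [exact: cf|exact: posp_continuous].
move=> cf; have [df pf] := (ckSP _ _ _).1 cf; apply/ckSP; split=> [x Ux|i].
  apply: (@differentiable_comp1 _ _ (fun t => posp t ^+ k.+2)); first exact: df.
  by have [] := is_derive_posp k (f x).
apply: ck_ext (ckM oU (ckZ oU k.+2%:R (IH _ (ckW cf))) (pf i)) => // x Ux.
rewrite (@partial_comp1 _ _ _ (fun t => posp t ^+ k.+2)); last by have [] := is_derive_posp k (f x).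
  by have [_ ->] := is_derive_posp k (f x).
exact: df.
Qed.

(** The quotient $p/(p+q)$, where [p] is positive exactly inside radius [r2] and [q] exactly outside
    radius [r1]; since $r_1 < r_2$ the denominator never vanishes. Squared distances keep the
    arguments smooth. *)
Lemma cutoff1 n k (r1 r2 : R) (i : 'I_n) (x0 : 'rV[R]_n) : 0 < r1 -> r1 < r2 ->
  exists h : 'rV[R]_n -> R, [/\ ck k setT h, forall x, 0 <= h x <= 1,
    forall x : 'rV[R]_n, `|x 0 i - x0 0 i| <= r1 -> h x = 1 & forall x : 'rV[R]_n, r2 <= `|x 0 i - x0 0 i| -> h x = 0].
Proof.
move=> r10 r12; have r20 : 0 < r2 by exact: lt_trans r12.
pose u (x : 'rV[R]_n) := (x 0 i - x0 0 i) * (x 0 i - x0 0 i).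
have cu : ck k setT u.
  have cl : ck k setT (fun x : 'rV[R]_n => x 0 i - x0 0 i).
    by apply: (ckB openT); [exact: ck_coord|exact: ck_cst].
  exact: (ckM openT).
have uE x : u x = `|x 0 i - x0 0 i| ^+ 2 by rewrite real_normK ?num_real // expr2.
pose p x := posp (r2 ^+ 2 - u x) ^+ k.+1.
pose q x := posp (u x - r1 ^+ 2) ^+ k.+1.
have cp : ck k setT p by apply: (ck_posp openT); apply: (ckB openT) => //; exact: ck_cst.
have cq : ck k setT q by apply: (ck_posp openT); apply: (ckB openT) => //; exact: ck_cst.
have p0 x : 0 <= p x by rewrite exprn_ge0 // posp_ge0.
have q0 x : 0 <= q x by rewrite exprn_ge0 // posp_ge0.
have pq x : 0 < p x + q x.
  have [h|h] := ltP (u x) (r2 ^+ 2).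
    by rewrite ltr_pwDl // exprn_gt0 // posp_gt0 // subr_gt0.
  rewrite ltr_wpDl // exprn_gt0 // posp_gt0 // subr_gt0; apply: lt_le_trans h.
  by rewrite ltrXn2r // ?nnegrE ltW.
exists (fun x => p x * (p x + q x)^-1); split.
- apply: (ckM openT) => //; apply: (ckV openT); first by move=> x _; rewrite gt_eqF.
  exact: (ckD openT).
- move=> x; rewrite mulr_ge0 ?invr_ge0 ?(ltW (pq x)) //=.
  by rewrite ler_pdivrMr // mul1r lerDl.
- move=> x xr; have -> : q x = 0.
    by rewrite /q posp_eq0 ?expr0n // subr_le0 uE lerXn2r // nnegrE // ltW.
  rewrite addr0 divff // gt_eqF //; move: (pq x).
  rewrite /q (@posp_eq0 (u x - _)) ?expr0n ?addr0 //.
  by rewrite subr_le0 uE lerXn2r // nnegrE // ltW.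
- move=> x xr; rewrite /p posp_eq0 ?expr0n ?mul0r //.
  by rewrite subr_le0 uE lerXn2r // nnegrE // ltW.
Qed.

(** Balls of the maximum norm are squares, so a product of one cutoff per coordinate is enough. *)
Lemma cutoff k (r1 r2 : R) (x0 : 'rV[R]_2) : 0 < r1 -> r1 < r2 ->
  exists h : 'rV[R]_2 -> R, [/\ ck k setT h, forall x, 0 <= h x <= 1,
    forall x, ball x0 r1 x -> h x = 1 & forall x, ~ ball x0 r2 x -> h x = 0].
Proof.
move=> r10 r12; have r20 : 0 < r2 by exact: lt_trans r12.
have [h [ch h01 h1 h0]] := cutoff1 k 0 x0 r10 r12.
have [g [cg g01 g1 g0]] := cutoff1 k 1 x0 r10 r12.
exists (fun x => h x * g x); split.
- exact: (ckM openT).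
- move=> x; have /andP[a b] := h01 x; have /andP[c d] := g01 x.
  by rewrite mulr_ge0 //= mulr_ile1.
- move=> x /(ball_rV2 _ _ r10)[/ltW a /ltW b].
  by rewrite h1 1?distrC // g1 1?distrC // mulr1.
- move=> x /(ball_rV2 _ _ r20) H.
  have [a|a] := leP r2 `|x 0 0 - x0 0 0|; first by rewrite h0 // mul0r.
  have [b|b] := leP r2 `|x 0 1 - x0 0 1|; first by rewrite g0 // mulr0.
  by exfalso; apply: H; split; rewrite distrC.
Qed.

End Cutoff.

Section ChangeOfVariables.
Variable R : realType.
Implicit Types (F : 'rV[R]_2 -> R) (tau : 'rV[R]_2 -> 'rV[R]_2).

Definition jac tau (x : 'rV[R]_2) : R :=
  partial 0 (fun y => tau y 0 0) x * partial 1 (fun y => tau y 0 1) x -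
  partial 1 (fun y => tau y 0 0) x * partial 0 (fun y => tau y 0 1) x.

Lemma ck_jac k U tau : open U -> (forall j, ck k.+1 U (fun x => tau x 0 j)) -> ck k U (jac tau).
Proof. by move=> oU ct; apply: (ckB oU); apply: (ckM oU); exact: ck_partial (ct _). Qed.

Lemma sum_ord2 (V : nmodType) (f : 'I_2 -> V) : \sum_i f i = f 0 + f 1.
Proof. by rewrite big_ord_recl big_ord1; congr (_ + f _); exact: val_inj. Qed.

Lemma open_norm_gt N : open [set y : 'rV[R]_2 | N < `|y|].
Proof.
apply: (@open_comp _ _ (fun y : 'rV[R]_2 => `|y|) [set z | N < z]); last exact: open_gt.
by move=> y _; exact: norm_continuous.
Qed.

Lemma ck_differentiable_vec k U tau x : (forall j, ck k.+1 U (fun x => tau x 0 j)) -> U x -> differentiable tau x.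
Proof. by move=> ct Ux; apply/differentiable_rowP => j; exact: (ck_diff (ct j)). Qed.

(* After P. Lax: if [d_0 g = F], then [F(tau) jac tau] differs from [F] by the divergence of a compactly
   supported field built from [g(tau)]. *)
Lemma Int2_lax F tau N : cc2 1 F -> (forall j, ck 2 setT (fun x => tau x 0 j)) ->
  (forall x, N < `|x| -> tau x = x) -> Int2 (fun x => F (tau x) * jac tau x) = Int2 F.
Proof.
move=> cF ct tN; pose g := prim F; have cg : ck 1 setT g by exact: prim_ck1.
have dt x : differentiable tau x by exact: (ck_differentiable_vec ct).
have ct0 x : setT x -> {for x, continuous tau}.
  by move=> _; exact: differentiable_continuous (dt x).
have ct1 j : ck 1 setT (fun x => tau x 0 j) by exact: ckW.
have cgt : ck 1 setT (fun x => g (tau x)) by exact: (ck_comp (V := setT) openT).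
(* Subtracting [g], which need not have compact support, makes the field vanish where [tau] is the
   identity. In the divergence the second derivatives of [tau] cancel by symmetry and the terms in
   [partial 1 g] cancel as well. *)
pose W0 x := g (tau x) * partial 1 (fun y => tau y 0 1) x - g x.
pose W1 x := - (g (tau x) * partial 0 (fun y => tau y 0 1) x).
have nearid x : N < `|x| -> \forall y \near x, tau y = y.
  move=> xN; have : nbhs x [set y : 'rV[R]_2 | N < `|y|] by apply: open_nbhs_nbhs; split => //; exact: open_norm_gt.
  by apply: filterS => y /tN.
have pid i j x : N < `|x| -> partial j (fun y => tau y 0 i) x = (i == j)%:R.
  move=> xN; rewrite -(congr1 (fun h => h x) (@partial_coordE R 2 j i)).
  by apply: partial_near; apply: filterS (nearid x xN) => y ->.
have cb i : ck 1 setT (partial i (fun y => tau y 0 1)) by exact: (ck_partial i (ct 1)).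
have cW0 : cc2 1 W0.
  split; first exact: (ckB openT (ckM openT cgt (cb 1)) cg).
  by exists N => x xN; rewrite /W0 pid // tN // mulr1 subrr.
have cW1 : cc2 1 W1.
  split; first exact: (ckN openT (ckM openT cgt (cb 0))).
  by exists N => x xN; rewrite /W1 pid // mulr0 oppr0.
have E x : F (tau x) * jac tau x = F x + (partial 0 W0 x + partial 1 W1 x).
  have dgt : differentiable (fun x => g (tau x)) x by exact: (ck_diff cgt).
  have dg y : differentiable g y by exact: (ck_diff cg).
  have dp i j : differentiable (partial i (fun y => tau y 0 j)) x by exact: (ck_diff (ck_partial i (ct j))).
  rewrite /W0 partialB; [|exact: (differentiableM dgt (dp 1 1))|exact: dg].
  rewrite /W1 partialN; last exact: (differentiableM dgt (dp 0 1)).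
  have chain i : partial i (fun y => g (tau y)) x =
      partial i (fun y => tau y 0 0) x * F (tau x) + partial i (fun y => tau y 0 1) x * partial 1 g (tau x).
    by rewrite (partial_comp i (dt x) (dg (tau x))) sum_ord2 {1}/g (partial0_prim cF).
  have -> : partial 0 (fun y => g (tau y) * partial 1 (fun y => tau y 0 1) y) x = _ := partialM 0 dgt (dp 1 1).
  have -> : partial 1 (fun y => g (tau y) * partial 0 (fun y => tau y 0 1) y) x = _ := partialM 1 dgt (dp 0 1).
  rewrite !chain (partial_partialC 0 1 openT I (ct 1)) [partial 0 g x](congr1 (fun h => h x) (partial0_prim cF)) /jac.
  clear; move: (F x) (F (tau x)) (g (tau x)) (partial 1 g (tau x)) (partial 1 (partial 0 _) x).
  move: (partial 0 _ x) (partial 1 _ x) (partial 0 _ x) (partial 1 _ x).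
  by move=> *; ring.
have -> : (fun x => F (tau x) * jac tau x) = fun x => F x + (partial 0 W0 x + partial 1 W1 x).
  by apply/funext.
have c0 := cc2_partial 0 cW0; have c1 := cc2_partial 1 cW1.
by rewrite (Int2D (k := 0) (cc2_le _ cF) (cc2D c0 c1)) // (Int2D c0 c1) (Int2_partial0 cW0) (Int2_partial1 cW1) !addr0.
Qed.

End ChangeOfVariables.

(** * Local change of variables *)

Section LocalChangeOfVariables.
Variable R : realType.
Implicit Types (F : 'rV[R]_2 -> R) (tau : 'rV[R]_2 -> 'rV[R]_2).

Lemma ballP_norm (x y : 'rV[R]_2) r : ball x r y <-> `|y - x| < r.
Proof. by rewrite -ball_normE /= distrC. Qed.

Lemma norm_rV2_le (x : 'rV[R]_2) m : `|x 0 0| <= m -> `|x 0 1| <= m -> `|x| <= m.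
Proof.
move=> x0 x1; have m0 : 0 <= m by apply: le_trans x0.
rewrite [leLHS]/Num.norm /= mx_normrE; apply: bigmax_le => //= -[p q] _.
by rewrite ord1 /=; move: q; apply: ord2P.
Qed.

Lemma open_dist_gt (x0 : 'rV[R]_2) r : open [set y : 'rV[R]_2 | r < `|y - x0|].
Proof.
apply: (@open_comp _ _ (fun y : 'rV[R]_2 => `|y - x0|) [set z | r < z]); last exact: open_gt.
move=> y _; apply: (@continuous_comp _ _ _ (fun y : 'rV[R]_2 => y - x0) (fun y => `|y|)).
  exact: (cvgB (@cvg_id _ (nbhs y)) (cvg_cst x0)).
exact: norm_continuous.
Qed.

Lemma partial_lincomb n (f g : 'rV[R]_n -> R) p q w i x : differentiable f x -> differentiable g x ->
  partial i (fun x => p * f x + q * g x + w) x = p * partial i f x + q * partial i g x.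
Proof.
move=> df dg.
have dpf : differentiable (fun x => p * f x) x by exact: (differentiableM (differentiable_cst _ _) df).
have dqg : differentiable (fun x => q * g x) x by exact: (differentiableM (differentiable_cst _ _) dg).
rewrite partialD; [|exact: (differentiableD dpf dqg)|exact: differentiable_cst].
by rewrite (partialD _ dpf dqg) (partialZ _ _ df) (partialZ _ _ dg) partial_cst addr0.
Qed.

Lemma ck_lincomb n k (U : set 'rV[R]_n) f g p q w : open U -> ck k U f -> ck k U g ->
  ck k U (fun x => p * f x + q * g x + w).
Proof. by move=> oU cf cg; exact: (ckD oU (ckD oU (ckZ oU _ cf) (ckZ oU _ cg)) (ck_cst _ _ _)). Qed.

Lemma ck_extend0 k (O : set 'rV[R]_2) f x0 r r' : open O -> ball x0 r' `<=` O -> r < r' ->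
  ck k O f -> (forall x, ~ ball x0 r x -> f x = 0) -> ck k setT f.
Proof.
move=> oO rO rr cf f0; apply: ck_local => x _.
have [xO|xO] := pselect (O x); first by exists O.
exists [set y : 'rV[R]_2 | r < `|y - x0|].
  split; first exact: open_dist_gt.
  by rewrite /=; apply: lt_le_trans rr _; rewrite leNgt; apply/negP => /ballP_norm/rO.
apply: ck_ext (ck_cst k _ 0); first exact: open_dist_gt.
by move=> y /= yr; rewrite f0 // => /ballP_norm; apply/negP; rewrite -leNgt ltW.
Qed.

Lemma diff0_small (f : 'rV[R]_2 -> R) (x0 : 'rV[R]_2) e : 0 < e -> differentiable f x0 ->
  (forall i, partial i f x0 = 0) -> f x0 = 0 -> \forall x \near x0, `|f x| <= e * `|x - x0|.
Proof.
move=> e0 df pf f0.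
have /eqaddoP/(_ _ e0) H := diff_locally df.
rewrite (near_shift 0 x0) subr0; apply: filterS H => h /=.
rewrite !fctE /= f0 add0r -(deriveE _ df) (deriveE_partial _ df) big1 ?subr0; last by move=> i _; rewrite pf mulr0.
by rewrite addrK.
Qed.

Definition jac2 (s0 s1 : 'rV[R]_2 -> R) x : R :=
  partial 0 s0 x * partial 1 s1 x - partial 1 s0 x * partial 0 s1 x.

(** A map tangent to the identity at [x0] is interpolated by a cutoff: $st = id + \eta (s - id)$
    agrees with it on the ball of radius [r] and is the identity off the ball of radius [2 * r], so
    [Int2_lax] applies to [st]. *)
Lemma near_id_cov (O : set 'rV[R]_2) (s0 s1 : 'rV[R]_2 -> R) (x0 : 'rV[R]_2) : open O -> O x0 ->
  ck 2 O s0 -> ck 2 O s1 -> s0 x0 = x0 0 0 -> s1 x0 = x0 0 1 ->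
  (forall i, partial i s0 x0 = (0 == i)%:R) -> (forall i, partial i s1 x0 = (1 == i)%:R) ->
  exists r, [/\ 0 < r, ball x0 r `<=` O, forall x, ball x0 r x -> 0 < jac2 s0 s1 x &
    forall E F, cc2 1 F -> (forall y, F y != 0 -> `|y - x0| < r / 2) ->
      (forall x, E x != 0 -> ball x0 r x) ->
      (forall x, ball x0 r x -> E x = jac2 s0 s1 x * F (rv (s0 x) (s1 x))) ->
      cc2 0 E /\ Int2 E = Int2 F].
Proof.
move=> oO Ox0 cs0 cs1 s00 s10 ps0 ps1.
pose t0 (x : 'rV[R]_2) : R := s0 x - x 0 0; pose t1 (x : 'rV[R]_2) : R := s1 x - x 0 1.
have ct0 : ck 2 O t0 by exact: (ckB oO cs0 (ck_coord _ _ _)).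
have ct1 : ck 2 O t1 by exact: (ckB oO cs1 (ck_coord _ _ _)).
have pt0 i : partial i t0 x0 = 0.
  rewrite /t0 partialB; [|exact: (ck_diff cs0)|exact: differentiable_coord].
  by rewrite ps0 partial_coordE subrr.
have pt1 i : partial i t1 x0 = 0.
  rewrite /t1 partialB; [|exact: (ck_diff cs1)|exact: differentiable_coord].
  by rewrite ps1 partial_coordE subrr.
have t00 : t0 x0 = 0 by rewrite /t0 s00 subrr.
have t10 : t1 x0 = 0 by rewrite /t1 s10 subrr.
(* With $|st(x) - x| \le |x - x_0|/4$, a point sent within $r/2$ of [x0] lies within $2r/3$ of it,
   hence in the ball where [E] is given by the formula. *)
have q0 : 0 < 4^-1 :> R by rewrite invr_gt0.
have n0 := diff0_small q0 (ck_diff ct0 Ox0) pt0 t00.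
have n1 := diff0_small q0 (ck_diff ct1 Ox0) pt1 t10.
have nO : nbhs x0 O by exact: open_nbhs_nbhs.
have cJ : {for x0, continuous (jac2 s0 s1)}.
  have c : ck 1 O (jac2 s0 s1).
    by apply: (ckB oO); apply: (ckM oO); [exact: (ck_partial _ cs0)|exact: (ck_partial _ cs1)|exact: (ck_partial _ cs0)|exact: (ck_partial _ cs1)].
  exact: (ck_cont c).
have nJ : \forall x \near x0, 0 < jac2 s0 s1 x.
  by apply: (cvgr_gt (jac2 s0 s1 x0) cJ); rewrite /jac2 !ps0 !ps1 /= mulr1 mulr0 subr0.
have [R0 /= R00 HR] := (nbhs_ballP _ _).1 (filterI nO (filterI nJ (filterI n0 n1))).
(* Four times [r], so that the cutoff ball of radius [2 * r] still sits well inside the good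
   ball. *)
have [r r0 rE] : exists2 r, 0 < r & R0 = 4 * r by exists (R0 / 4); [rewrite divr_gt0|field].
have r2 : r < 2 * r by lra.
have [eta [ce e01 e1 e0]] := cutoff 2 x0 r0 r2.
have R2 : 2 * r < R0 by lra.
have rR : r <= R0 by lra.
have HRr x : ball x0 r x -> ball x0 R0 x by exact: le_ball.
have RO : ball x0 R0 `<=` O by move=> x /HR[].
exists r; split; [exact: r0|by move=> x /HRr/HR[]|by move=> x /HRr/HR[_ []]|move=> E F cF FS ES EF].
pose st (x : 'rV[R]_2) := rv (x 0 0 + eta x * t0 x) (x 0 1 + eta x * t1 x).
have ex0 f : ck 2 O f -> ck 2 setT (fun x => eta x * f x).
  move=> cf; apply: (ck_extend0 oO RO R2).
    exact: (ckM oO (ck_sub (@subsetT _ O) ce) cf).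
  by move=> x xR; rewrite e0 // mul0r.
have cst_ j : ck 2 setT (fun x => st x 0 j).
  move: j; apply: ord2P; rewrite /st; [under eq_fun do rewrite rv0|under eq_fun do rewrite rv1].
    exact: (ckD openT (ck_coord _ _ _) (ex0 _ ct0)).
  exact: (ckD openT (ck_coord _ _ _) (ex0 _ ct1)).
have st_out x : ~ ball x0 (2 * r) x -> st x = x.
  by move=> xR; rewrite /st e0 // !mul0r !addr0 rvK.
have st_small x : `|st x - x| <= 4^-1 * `|x - x0|.
  have [xR|xR] := pselect (ball x0 R0 x); last first.
    have -> : st x = x by apply: st_out => h; apply: xR; apply: le_ball h; exact: ltW.
    by rewrite subrr normr0 mulr_ge0 // ltW.
  have [_ [_ [h0 h1]]] := HR x xR.
  have /andP[el eu] := e01 x.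
  have d0 : (st x - x) 0 0 = eta x * t0 x by rewrite mxE [(- x) 0 0]mxE /st rv0 addrC addKr.
  have d1 : (st x - x) 0 1 = eta x * t1 x by rewrite mxE [(- x) 0 1]mxE /st rv1 addrC addKr.
  by apply: norm_rV2_le; rewrite ?d0 ?d1 normrM (ger0_norm el);
    [apply: le_trans h0|apply: le_trans h1]; rewrite ler_piMl.
have near1 x : ball x0 r x -> \forall y \near x, st y = rv (s0 y) (s1 y).
  move=> xr; have : nbhs x (ball x0 r) by apply: open_nbhs_nbhs; split => //; exact: ball_open.
  apply: filterS => y yr; rewrite /st e1 // !mul1r /t0 /t1.
  by congr rv; rewrite addrC subrK.
have jst x : ball x0 r x -> jac st x = jac2 s0 s1 x.
  move=> xr.
  have E0 i : partial i (fun y => st y 0 0) x = partial i s0 x.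
    by apply: partial_near; apply: filterS (near1 x xr) => y ->; rewrite rv0.
  have E1 i : partial i (fun y => st y 0 1) x = partial i s1 x.
    by apply: partial_near; apply: filterS (near1 x xr) => y ->; rewrite rv1.
  by rewrite /jac !E0 !E1.
have EE : E = fun x => F (st x) * jac st x.
  apply/funext => x; have [xr|xr] := pselect (ball x0 r x).
    by rewrite EF // jst // (nbhs_singleton (near1 x xr)) mulrC.
  have -> : E x = 0 by apply/eqP; apply: contra_notT xr; exact: ES.
  apply/esym/eqP; rewrite mulf_eq0; apply/orP; left; apply: contra_notT xr => /FS H.
  apply/ballP_norm; have := st_small x; have := ler_distD (st x) x x0.
  by rewrite [`|x - st x|]distrC; move: H r0; clear; lra.
have outN x : `|x0| + R0 < `|x| -> ~ ball x0 (2 * r) x.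
  move=> xN /ballP_norm xR; have := ler_normD (x - x0) x0; rewrite subrK.
  by move: xN xR R2; clear; lra.
split; last first.
  rewrite EE; apply: (@Int2_lax R F st (`|x0| + R0) cF cst_) => x /outN; exact: st_out.
split; last first.
  exists (`|x0| + R0) => x /outN xr; apply/eqP; apply: contra_notT xr => /ES.
  by apply: le_ball; exact: ltW.
have cst0 x : setT x -> {for x, continuous st}.
  by move=> _; apply: differentiable_continuous; exact: (ck_differentiable_vec cst_).
have cst1 j : ck 0 setT (fun x => st x 0 j) by exact: ck_le (cst_ j).
have cF0 : ck 0 setT F by exact: ck_le cF.1.
have cj : ck 0 setT (jac st) by exact: ck_le (ck_jac openT cst_).
by rewrite EE; exact: (ckM openT (ck_comp (V := setT) openT (fun _ _ => I) cst1 cst0 cF0) cj).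
Qed.

(** Write [tau] as $L \circ s$, with [L] its affine approximation at [x0]; then [s] is tangent to
    the identity there. [near_id_cov] treats [s], and [Int2_aff] treats [L] and yields the
    determinant. *)
Lemma local_cov (O : set 'rV[R]_2) tau x0 : open O -> O x0 ->
  (forall j, ck 2 O (fun x => tau x 0 j)) -> jac tau x0 != 0 ->
  exists r, [/\ 0 < r, ball x0 r `<=` O & exists2 r', 0 < r' &
    forall E F, cc2 1 F -> (forall y, F y != 0 -> ball (tau x0) r' y) ->
      (forall x, E x != 0 -> ball x0 r x) ->
      (forall x, ball x0 r x -> E x = `|jac tau x| * F (tau x)) -> Int2 E = Int2 F].
Proof.
move=> oO Ox0 ct.
set D := jac tau x0 => Dn0.
have : D = jac tau x0 by [].
rewrite /jac; set a := partial 0 _ x0; set d := partial 1 _ x0; set b := partial 1 _ x0; set c := partial 0 _ x0 => DE.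
set y0 := tau x0.
(* The constants make $s(x) = x_0 + J^{-1}(\tau(x) - y_0)$, with [J] the Jacobian matrix of [tau] at
   [x0]. *)
pose e := x0 0 0 - (d * y0 0 0 - b * y0 0 1) / D.
pose f := x0 0 1 - (a * y0 0 1 - c * y0 0 0) / D.
pose s0 x : R := (d / D) * tau x 0 0 + (- b / D) * tau x 0 1 + e.
pose s1 x : R := (- c / D) * tau x 0 0 + (a / D) * tau x 0 1 + f.
have cs0 : ck 2 O s0 by exact: (ck_lincomb _ _ _ oO (ct 0) (ct 1)).
have cs1 : ck 2 O s1 by exact: (ck_lincomb _ _ _ oO (ct 0) (ct 1)).
have dt x j : O x -> differentiable (fun x => tau x 0 j) x by move=> Ox; exact: (ck_diff (ct j)).
have ps0 x i : O x -> partial i s0 x = (d / D) * partial i (fun y => tau y 0 0) x + (- b / D) * partial i (fun y => tau y 0 1) x.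
  by move=> Ox; exact: (partial_lincomb _ _ _ _ (dt x 0 Ox) (dt x 1 Ox)).
have ps1 x i : O x -> partial i s1 x = (- c / D) * partial i (fun y => tau y 0 0) x + (a / D) * partial i (fun y => tau y 0 1) x.
  by move=> Ox; exact: (partial_lincomb _ _ _ _ (dt x 0 Ox) (dt x 1 Ox)).
have s00 : s0 x0 = x0 0 0 by rewrite /s0 -/y0 /e; field; exact: Dn0.
have s10 : s1 x0 = x0 0 1 by rewrite /s1 -/y0 /f; field; exact: Dn0.
have ps00 i : partial i s0 x0 = (0 == i)%:R.
  rewrite ps0 //; move: i; apply: ord2P; rewrite -/a -/b -/c -/d /=.
    by transitivity (D / D); [rewrite {3}DE; field|rewrite divff].
  by field.
have ps10 i : partial i s1 x0 = (1 == i)%:R.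
  rewrite ps1 //; move: i; apply: ord2P; rewrite -/a -/b -/c -/d /=.
    by field.
  by transitivity (D / D); [rewrite {3}DE; field|rewrite divff].
have [r [r0 rO J0 cov]] := near_id_cov oO Ox0 cs0 cs1 s00 s10 ps00 ps10.
have JE x : O x -> jac2 s0 s1 x = jac tau x / D.
  move=> Ox; rewrite /jac2 !ps0 // !ps1 // /jac.
  move: (partial 0 _ x) (partial 1 _ x) (partial 0 _ x) (partial 1 _ x) => u v u' v'.
  transitivity ((u' * v - v' * u) * (a * d - b * c) / (D * D)); first by field.
  by rewrite -DE; field.
pose K := `|a| + `|b| + `|c| + `|d| + 1.
have K0 : 0 < K by rewrite ltr_wpDl // !addr_ge0.
have [Kbd Kca] : `|b| + `|d| < K /\ `|c| + `|a| < K.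
  have gen (p q u v : R) : `|q| + `|v| < `|p| + `|q| + `|u| + `|v| + 1 /\ `|u| + `|p| < `|p| + `|q| + `|u| + `|v| + 1.
    have := normr_ge0 p; have := normr_ge0 q; have := normr_ge0 u; have := normr_ge0 v.
    by clear => *; split; lra.
  exact: (gen a b c d).
(* [K] exceeds the absolute row sums of the adjugate of [J], so $L^{-1}$ sends the ball of radius
   [r'] about [y0] into the ball of radius $r/2$ about [x0]. *)
pose r' := r / 2 * `|D| / K.
have D1 : 0 < `|D| by rewrite normr_gt0.
have r'0 : 0 < r' by rewrite /r' !mulr_gt0 ?invr_gt0.
exists r; split; [exact: r0|exact: rO|exists r'; first exact: r'0].
move=> E F cF FS ES EF.
pose L := aff a b c d (y0 0 0 - a * x0 0 0 - b * x0 0 1) (y0 0 1 - c * x0 0 0 - d * x0 0 1).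
have D2 : a * d - b * c != 0 by rewrite -DE.
have cF' : cc2 1 (F \o L) by exact: cc2_aff.
have F'S z : (F \o L) z != 0 -> `|z - x0| < r / 2.
  move=> /FS /(ball_rV2 _ _ r'0)[].
  rewrite /L /aff rv0 rv1; set u := _ - _ => u1; set v := _ - _ => v1.
  have z0 : D * (z 0 0 - x0 0 0) = b * v - d * u by rewrite DE /u /v; ring.
  have z1 : D * (z 0 1 - x0 0 1) = c * u - a * v by rewrite DE /u /v; ring.
  have lin p q u' v' : `|u'| < r' -> `|v'| < r' -> `|p| + `|q| < K -> `|p * u' - q * v'| < r / 2 * `|D|.
    move=> u'1 v'1 pq; apply: (@le_lt_trans _ _ ((`|p| + `|q|) * r')).
      apply: le_trans (ler_normB _ _) _; rewrite !normrM mulrDl.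
      by apply: lerD; apply: ler_wpM2l => //; exact: ltW.
    rewrite /r' mulrCA [X in _ < X](_ : _ = r / 2 * `|D| * 1); last by rewrite mulr1.
    rewrite ltr_pM2l; last by rewrite !mulr_gt0.
    by rewrite ltr_pdivrMr // mul1r.
  have r20 : 0 < r / 2 by rewrite divr_gt0.
  have dv (p q : R) : D * p = q -> `|q| < r / 2 * `|D| -> `|p| < r / 2.
    by move=> <-; rewrite normrM mulrC ltr_pM2r.
  apply/(norm_rV2_lt _ r20); rewrite [(z - x0) 0 0]mxE [(z - x0) 0 1]mxE [(- x0) 0 0]mxE [(- x0) 0 1]mxE.
  split; [exact: (dv _ _ z0 (lin _ _ _ _ v1 u1 Kbd))|exact: (dv _ _ z1 (lin _ _ _ _ u1 v1 Kca))].
have Lst x : L (rv (s0 x) (s1 x)) = tau x.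
  rewrite /L /aff rv0 rv1 -[RHS]rvK /s0 /s1 /e /f; congr rv.
    transitivity (y0 0 0 + (tau x 0 0 - y0 0 0) * (a * d - b * c) / D); first by field.
    by rewrite -DE; field.
  transitivity (y0 0 1 + (tau x 0 1 - y0 0 1) * (a * d - b * c) / D); first by field.
  by rewrite -DE; field.
have ES' x : `|D|^-1 * E x != 0 -> ball x0 r x by rewrite mulf_eq0 => /norP[_ /ES].
(* Since $|\mathrm{jac}\,\tau| = |D|\,\mathrm{jac}(s)$, the lemma for [s] concerns $E/|D|$; the
   affine map contributes the same factor to the integral of [F], and the two cancel. *)
have [cE iE] : cc2 0 (fun x => `|D|^-1 * E x) /\ Int2 (fun x => `|D|^-1 * E x) = Int2 (F \o L).
  apply: (cov _ _ cF' F'S ES') => x xr.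
  rewrite EF //= Lst -(gtr0_norm (J0 x xr)) JE; last exact: rO.
  by rewrite normrM normfV; ring.
have D1n : `|D| != 0 by exact: lt0r_neq0.
have EE : E = fun x => `|D| * (`|D|^-1 * E x) by apply/funext => x; rewrite mulrA (divff D1n) mul1r.
have iL : Int2 (F \o L) = `|D|^-1 * Int2 F by rewrite DE; exact: Int2_aff D2 cF.
apply: (etrans (congr1 (@Int2 R) EE)).
apply: (etrans (Int2Z `|D| cE)).
apply: (etrans (congr1 (fun z => `|D| * z) (etrans iE iL))).
exact: (mulVKf D1n).
Qed.

End LocalChangeOfVariables.

(** A primitive of a nonnegative function is monotone; with equal end values it is constant, so its
    derivative is zero. *)
Lemma Int1_eq0 (R : realType) (f : R -> R) : cc1 f -> (forall x, 0 <= f x) -> Int1 f = 0 -> forall x, f x = 0.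
Proof.
move=> cf f0 I0 x; have [F [N [dF F0 F1]]] := prim_exists cf.
have mF a b : a <= b -> F a <= F b.
  move=> ab; have [] := @MVT_segment R F f a b ab.
    by apply: continuous_subspaceT => t; have [d _] := dF t; exact/differentiable_continuous/derivable1_diffP.
  by move=> t _ E; rewrite -subr_ge0 E mulr_ge0 // subr_ge0.
have FE : F = fun=> 0.
  apply/funext => t; apply/eqP; rewrite eq_le; apply/andP; split.
    rewrite -I0 -(F1 (Num.max t N)) ?le_max ?lexx ?orbT //.
    by apply: mF; rewrite le_max lexx.
  rewrite -(F0 (Num.min t (- N))) ?ge_min ?lexx ?orbT //.
  by apply: mF; rewrite ge_min lexx.
by have [_ <-] := dF x; rewrite FE derive_cst.
Qed.

Lemma Int2_eq0 (R : realType) k (F : 'rV[R]_2 -> R) : cc2 k F -> (forall x, 0 <= F x) -> Int2 F = 0 -> forall x, F x = 0.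
Proof.
move=> cF F0 I0 x; rewrite -(rvK x).
apply: (@Int1_eq0 R (fun s => F (rv s (x 0 1)))); [exact: cc2_cc1_0 cF|by []|].
by apply: (Int1_eq0 (inner_cc1 cF) _ I0) => t; exact: Int1_ge0.
Qed.

Lemma psumr_seq_eq0 (R : numDomainType) (T : eqType) (s : seq T) (F : T -> R) :
  (forall p, 0 <= F p) -> \sum_(p <- s) F p = 0 -> forall p, p \in s -> F p = 0.
Proof.
move=> F0 /eqP; rewrite psumr_eq0 // => /allP h p /h /eqP; exact.
Qed.

Lemma mid_lt (R : realFieldType) (r r' : R) : r < r' -> r < (r + r') / 2 /\ (r + r') / 2 < r'.
Proof. by move=> rr; split; lra. Qed.

Lemma wedge_ring (R : comNzRingType) (s p p' q q' a a' b b' : R) :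
  (p * b + q * b') * (s * (p' * a + q' * a')) - (p' * b + q' * b') * (s * (p * a + q * a')) =
  s * (p * q' - p' * q) * (b * a' - b' * a).
Proof. ring. Qed.

(** * Stokes' theorem on an atlas *)

Lemma compact_cover_top (M : topologicalType) (m0 : M) (A : set M) : compact A -> cover_compact A.
Proof.
move=> cA.
pose Mp : ptopologicalType := HB.pack M (isPointed.Build M m0).
have : compact (A : set Mp) by exact: cA.
by rewrite compact_cover.
Qed.

Lemma open_within_preimage (T U : topologicalType) (A : set T) (f : T -> U) (B : set U) :
  open A -> {within A, continuous f} -> open B -> open (A `&` f @^-1` B).
Proof.
move=> oA; rewrite continuous_open_subspace // => cf oB.
rewrite openE => x [Ax Bx]; apply: filterI; first exact: open_nbhs_nbhs.
by apply: cf; [rewrite inE|exact: open_nbhs_nbhs].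
Qed.

Lemma compact_ball_le (R : realType) (x0 : 'rV[R]_2) r : compact [set y : 'rV[R]_2 | `|y - x0| <= r].
Proof.
apply: bounded_closed_compact.
  exists (`|x0| + `|r|); split; first exact: num_real.
  move=> m mr x /= xr; have := ler_normD (x - x0) x0; rewrite subrK.
  by have := ler_norm r; move: mr xr; clear; lra.
have -> : [set y : 'rV[R]_2 | `|y - x0| <= r] = ~` [set y | r < `|y - x0|].
  by apply/seteqP; split => y /=; rewrite leNgt => /negP.
exact/open_closedC/open_dist_gt.
Qed.

Lemma third_half_lt (R : realType) (r : R) : 0 < r -> r / 3 < r / 2 /\ r / 2 < r.
Proof. by move=> r0; split; lra. Qed.

Local Notation coord := Defs.coord.

Section Atlas.
Variables (R : realType) (M : topologicalType) (I : Type) (c : I -> chart R M).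
Hypothesis haus : hausdorff_space M.
Hypothesis coverM : forall p, exists i, source (c i) p.

Definition overlap i j : set 'rV[R]_2 := target (c i) `&` param (c i) @^-1` source (c j).

Definition transition i j (x : 'rV[R]_2) : 'rV[R]_2 := coord (c j) (param (c i) x).

Hypothesis ck_transition : forall i j k l, ck k (overlap i j) (fun x => transition i j x 0 l).

Lemma open_overlap i j : open (overlap i j).
Proof.
by apply: open_within_preimage; [exact: target_open|exact: param_continuous|exact: source_open].
Qed.

Lemma transition_continuous i j x : overlap i j x -> {for x, continuous (transition i j)}.
Proof.
move=> Ox; apply: differentiable_continuous.
exact: (@ck_differentiable_vec _ 0 _ _ _ (fun l => ck_transition i j 1 l) Ox).
Qed.

Definition reg k (h : M -> R) := forall i, ck k (target (c i)) (fun x => h (param (c i) x)).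

Lemma chart_nbhs i p (B : set 'rV[R]_2) : source (c i) p -> open B -> B (coord (c i) p) ->
  open [set m | source (c i) m /\ B (coord (c i) m)].
Proof.
by move=> sp oB Bp; apply: open_within_preimage => //; [exact: source_open|exact: Defs.coord_continuous].
Qed.

(** A cutoff in one chart, extended by zero. Regularity in the other charts rests on the Hausdorff
    property: the image of the closed ball of radius [r2] is compact, hence closed, so the function
    is zero near every point outside the chart. The radius [r3] keeps that closed ball in the
    target. *)
Lemma bump_exists k i (x0 : 'rV[R]_2) r1 r2 r3 : 0 < r1 -> r1 < r2 -> r2 < r3 ->
  ball x0 r3 `<=` target (c i) ->
  exists h : M -> R, [/\ reg k h, forall m, 0 <= h m,
    forall m, source (c i) m -> ball x0 r1 (coord (c i) m) -> 0 < h m &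
    forall m, h m != 0 -> source (c i) m /\ ball x0 r2 (coord (c i) m)].
Proof.
move=> r10 r12 r23 r3t.
have [eta [ce e01 e1 e0]] := cutoff k x0 r10 r12.
pose h m : R := if `[< source (c i) m >] then eta (coord (c i) m) else 0.
have hS m : h m != 0 -> source (c i) m /\ ball x0 r2 (coord (c i) m).
  rewrite /h; case: asboolP => [sm|_ /eqP //] hm; split => //.
  by apply: contrapT => /e0 h0; rewrite h0 eqxx in hm.
exists h; split => //; first last.
- by move=> m sm bm; rewrite /h; case: asboolP => // _; rewrite e1.
- by move=> m; rewrite /h; case: asboolP => // _; have /andP[] := e01 (coord (c i) m).
move=> j; apply: ck_local => x tx.
have [sx|sx] := pselect (source (c i) (param (c j) x)).
  exists (overlap j i); first by split; [exact: open_overlap|split].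
  apply: (@ck_ext _ _ k _ (fun y => eta (transition j i y))); first exact: open_overlap.
    by move=> y [_ sy]; rewrite /h; case: asboolP.
  have cT := @ck_comp R 2 2 k (overlap j i) setT eta (transition j i) (@open_overlap j i).
  apply: cT; [by []|by move=> l; exact: ck_transition|by move=> y; exact: transition_continuous|exact: ce].
pose C := [set param (c i) y | y in [set y : 'rV[R]_2 | `|y - x0| <= r2]].
have sub : [set y : 'rV[R]_2 | `|y - x0| <= r2] `<=` target (c i).
  by move=> y /= yr; apply: r3t; apply/ballP_norm; exact: le_lt_trans r23.
have cC : closed C.
  apply: compact_closed => //; apply: continuous_compact; last exact: compact_ball_le.
  exact: continuous_subspaceW sub (@param_continuous _ _ (c i)).
have nC : ~ C (param (c j) x).
  by move=> [y /sub yt E]; apply: sx; rewrite -E; exact: param_source.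
pose V := target (c j) `&` param (c j) @^-1` ~` C.
have oV : open V.
  by apply: open_within_preimage; [exact: target_open|exact: param_continuous|exact: closed_openC].
exists V; first by split.
apply: (ck_ext oV _ (ck_cst k V 0)) => y [ty nCy].
apply/esym/eqP; apply: contra_notT nCy => /hS[sy /ballP_norm/ltW by_].
by exists (coord (c i) (param (c j) y)) => //; rewrite coordK.
Qed.

Lemma reg_sum k (T : Type) (s : seq T) (h : T -> M -> R) : (forall t, reg k (h t)) ->
  reg k (fun m => \sum_(t <- s) h t m).
Proof. by move=> rh i; apply: (ck_sum (@target_open _ _ (c i))) => t; exact: rh. Qed.

Hypothesis compactM : compact [set: M].

(** Each function is supported in a chart ball of radius [r p], and a strictly larger ball still
    lies in the target and in the prescribed neighbourhood [W p]. The strict room between the radii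
    is what extension by zero requires. *)
Lemma partition_of_unity k (m0 : M) (ip : M -> I) (W : M -> set M) :
  (forall p, source (c (ip p)) p) -> (forall p, open (W p)) -> (forall p, W p p) ->
  exists (s : seq M) (chi : M -> M -> R) (r r' : M -> R),
   [/\ forall p, [/\ 0 < r p, r p < r' p, ball (coord (c (ip p)) p) (r' p) `<=` target (c (ip p)) &
         forall x, ball (coord (c (ip p)) p) (r' p) x -> W p (param (c (ip p)) x)],
       forall p, reg k (chi p), forall p m, 0 <= chi p m,
       forall p m, chi p m != 0 -> source (c (ip p)) m /\ ball (coord (c (ip p)) p) (r p) (coord (c (ip p)) m) &
       forall m, \sum_(p <- s) chi p m = 1].
Proof.
move=> sp oW Wp.
have H p : exists f : R * R * (M -> R), [/\ 0 < f.1.1, f.1.1 < f.1.2,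
     ball (coord (c (ip p)) p) f.1.2 `<=` target (c (ip p)),
     forall x, ball (coord (c (ip p)) p) f.1.2 x -> W p (param (c (ip p)) x) &
     [/\ reg k f.2, forall m, 0 <= f.2 m,
       forall m, f.2 m != 0 -> source (c (ip p)) m /\ ball (coord (c (ip p)) p) f.1.1 (coord (c (ip p)) m) &
       exists V, [/\ open V, V p & forall m, V m -> 0 < f.2 m]]].
  set i := ip p; set x0 := coord (c i) p.
  have oO : open (target (c i) `&` param (c i) @^-1` W p).
    by apply: open_within_preimage; [exact: target_open|exact: param_continuous|exact: oW].
  have Ox0 : (target (c i) `&` param (c i) @^-1` W p) x0.
    by split; [exact: (coord_target (sp p))|rewrite /= coordK //; exact: sp].
  have [r r0 rO] := (nbhs_ballP _ _).1 (open_nbhs_nbhs (conj oO Ox0)).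
  have r0' : 0 < r by [].
  have r1 : 0 < r / 3 by rewrite divr_gt0.
  have [r12 r23] := third_half_lt r0'.
  have rt : ball x0 r `<=` target (c i) by move=> x /rO[].
  have [h [rh h0 h1 hS]] := bump_exists k r1 r12 r23 rt.
  exists (r / 2, r, h); split => //=; first exact: lt_trans r12.
    by move=> x /rO[].
  split => //; exists [set m | source (c i) m /\ ball x0 (r / 3) (coord (c i) m)].
  have bx0 : ball x0 (r / 3) x0 by exact: ballxx.
  split; [by apply: (chart_nbhs (sp p)) => //; exact: ball_open|by split; [exact: sp|]|].
  by move=> m [sm bm]; exact: h1.
have [f Hf] := choice H.
have HV p : exists V, [/\ open V, V p & forall m, V m -> 0 < (f p).2 m].
  by have [_ _ _ _ [_ _ _]] := Hf p.
have [V HV'] := choice HV.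
have [D _ DV] : finite_subset_cover setT V [set: M].
  apply: (compact_cover_top m0 compactM) => [p _|m _]; first by have [] := HV' p.
  by exists m => //; have [] := HV' m.
(* The finite subcover makes the sum [Psi] positive everywhere, so division by it normalises the
   bumps. *)
pose s : seq M := finmap.enum_fset D; pose psi p m := (f p).2 m; pose Psi m := \sum_(p <- s) psi p m.
have psi0 p m : 0 <= psi p m by have [_ _ _ _ [_ H0 _ _]] := Hf p; exact: H0.
have Psi0 m : 0 < Psi m.
  have [p pD Vm] := DV m Logic.I.
  rewrite /Psi (big_rem p) //=.
  apply: ltr_pwDl; first by have [_ _ H1] := HV' p; exact: H1.
  by apply: sumr_ge0 => q _.
exists s, (fun p m => psi p m / Psi m), (fun p => (f p).1.1), (fun p => (f p).1.2); split.
- by move=> p; have [? ? ? ? _] := Hf p.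
- move=> p i; have oT := @target_open _ _ (c i).
  have r1 : reg k (psi p) by have [_ _ _ _ []] := Hf p.
  have r2 : reg k Psi by apply: reg_sum => q; have [_ _ _ _ []] := Hf q.
  apply: (ckM oT (r1 i)); apply: (ckV oT) => // x _.
  by rewrite gt_eqF.
- by move=> p m; rewrite divr_ge0 // ltW.
- move=> p m; rewrite mulf_eq0 => /norP[h _].
  by have [_ _ _ _ [_ _ HS _]] := Hf p; exact: HS.
- by move=> m; rewrite -mulr_suml -/(Psi m) divff // gt_eqF.
Qed.

Lemma overlap_transition i j x : overlap i j x -> overlap j i (transition i j x).
Proof.
move=> [tx sx]; split; first exact: coord_target.
by rewrite /= /transition coordK //; exact: param_source.
Qed.

Lemma transitionK i j x : overlap i j x -> transition j i (transition i j x) = x.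
Proof. by move=> [tx sx]; rewrite /transition coordK // paramK. Qed.

Lemma param_transition i j x : overlap i j x -> param (c j) (transition i j x) = param (c i) x.
Proof. by move=> [tx sx]; rewrite /transition coordK. Qed.

Lemma overlap_nbhs i j x : overlap i j x -> nbhs x (overlap i j).
Proof. by move=> Ox; apply: open_nbhs_nbhs; split => //; exact: open_overlap. Qed.

Lemma transition_diff i j x : overlap i j x -> differentiable (transition i j) x.
Proof. exact: (@ck_differentiable_vec _ 0 _ _ _ (fun l => ck_transition i j 1 l)). Qed.

Lemma partial_transition i j h m x : reg 1 h -> overlap i j x ->
  partial m (fun y => h (param (c i) y)) x =
  partial m (fun y => transition i j y 0 0) x * partial 0 (fun y => h (param (c j) y)) (transition i j x) +
  partial m (fun y => transition i j y 0 1) x * partial 1 (fun y => h (param (c j) y)) (transition i j x).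
Proof.
move=> rh Ox.
rewrite -(sum_ord2 (fun n => partial m (fun y => transition i j y 0 n) x * partial n (fun y => h (param (c j) y)) (transition i j x))).
rewrite -partial_comp; [|exact: transition_diff|exact: (ck_diff (rh j) (overlap_transition Ox).1)].
apply: partial_near; apply: filterS (overlap_nbhs Ox) => y Oy.
by rewrite param_transition.
Qed.

(** Chain rule for the composite of the two inverse transitions; it gives the nonvanishing that
    [local_cov] asks for. *)
Lemma jac_transition i j x : overlap i j x ->
  jac (transition i j) x * jac (transition j i) (transition i j x) = 1.
Proof.
move=> Ox; have Oy := overlap_transition Ox.
have E m l : partial m (fun y => transition i j y 0 0) x * partial 0 (fun y => transition j i y 0 l) (transition i j x) +
  partial m (fun y => transition i j y 0 1) x * partial 1 (fun y => transition j i y 0 l) (transition i j x) = (l == m)%:R.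
  rewrite -(sum_ord2 (fun n => partial m (fun y => transition i j y 0 n) x * partial n (fun y => transition j i y 0 l) (transition i j x))).
  rewrite -partial_comp; [|exact: transition_diff|exact: (ck_diff (ck_transition j i 1 l) Oy)].
  rewrite -(congr1 (fun h => h x) (@partial_coordE R 2 m l)).
  apply: partial_near; apply: filterS (overlap_nbhs Ox) => y Oy'.
  by rewrite transitionK.
have := E 0 0; have := E 0 1; have := E 1 0; have := E 1 1; rewrite /jac /=.
move: (partial 0 _ x) (partial 1 _ x) (partial 0 _ x) (partial 1 _ x) => p q u v.
move: (partial 0 _ _) (partial 1 _ _) (partial 0 _ _) (partial 1 _ _) => p' q' u' v' e11 e10 e01 e00.
transitivity ((u * p' + p * q') * (v * u' + q * v') - (u * u' + p * v') * (v * p' + q * q')); first by ring.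
by rewrite e11 e10 e01 e00; ring.
Qed.

Lemma jac_transition_neq0 i j x : overlap i j x -> jac (transition i j) x != 0.
Proof.
move=> Ox; apply/eqP => J0; have := jac_transition Ox.
by rewrite J0 mul0r => /esym/eqP; rewrite oner_eq0.
Qed.

(** Functions in a chart go through [param], which is arbitrary off the target, so they are cut to
    zero there before integration. *)
Definition ext i (f : 'rV[R]_2 -> R) : 'rV[R]_2 -> R := f \_ (target (c i)).

Lemma extE i f x : target (c i) x -> ext i f x = f x.
Proof. by move=> tx; rewrite /ext patchE mem_set. Qed.

Lemma ext_out i f x : ~ target (c i) x -> ext i f x = 0.
Proof. by move=> tx; rewrite /ext patchE memNset. Qed.

Lemma ext_cc2 k i f x0 r r' : ck k (target (c i)) f ->
  (forall x, target (c i) x -> f x != 0 -> ball x0 r x) -> r < r' ->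
  ball x0 r' `<=` target (c i) -> cc2 k (ext i f).
Proof.
move=> cf fS rr r't.
have e0 x : ~ ball x0 r x -> ext i f x = 0.
  move=> xr; have [tx|tx] := pselect (target (c i) x); last exact: ext_out.
  by rewrite extE //; apply/eqP; apply: contra_notT xr => h; exact: fS.
split.
  apply: (ck_extend0 (@target_open _ _ (c i)) r't rr) => //.
  by apply: (ck_ext (@target_open _ _ (c i)) _ cf) => x tx; rewrite extE.
exists (`|x0| + r) => x xN; apply: e0 => /ballP_norm xr.
have := ler_normD (x - x0) x0; rewrite subrK => h.
by have := lt_le_trans xN h; rewrite addrC ltrD2r ltNge (ltW xr).
Qed.

Lemma param_ball_closed i x0 r r' : r < r' -> ball x0 r' `<=` target (c i) ->
  closed [set param (c i) y | y in [set y : 'rV[R]_2 | `|y - x0| <= r]].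
Proof.
move=> rr r't; have sub : [set y : 'rV[R]_2 | `|y - x0| <= r] `<=` target (c i).
  by move=> y /= yr; apply: r't; apply/ballP_norm; exact: le_lt_trans rr.
apply: compact_closed => //; apply: continuous_compact; last exact: compact_ball_le.
exact: continuous_subspaceW sub (@param_continuous _ _ (c i)).
Qed.

(** A density has the same integral in both charts. [local_cov] only gives this near a point, so the
    density is multiplied by a partition of unity subordinate to neighbourhoods on which the
    equality is known, and the pieces are summed. *)
Lemma Int2_transition i j f g x0 r r' y0 t t' :
  r < r' -> ball x0 r' `<=` target (c i) -> t < t' -> ball y0 t' `<=` target (c j) ->
  ck 1 (target (c i)) f -> ck 1 (target (c j)) g ->
  (forall x, overlap i j x -> f x = `|jac (transition i j) x| * g (transition i j x)) ->
  (forall x, target (c i) x -> f x != 0 -> [/\ ball x0 r x, overlap i j x & ball y0 t (transition i j x)]) ->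
  (forall y, target (c j) y -> g y != 0 -> [/\ ball y0 t y, overlap j i y & ball x0 r (transition j i y)]) ->
  Int2 (ext i f) = Int2 (ext j g).
Proof.
move=> rr rt tt tt' cf cg law fS gS.
have oi := @target_open _ _ (c i); have oj := @target_open _ _ (c j).
have cfE th : reg 1 th -> cc2 1 (ext i (fun x => th (param (c i) x) * f x)).
  move=> rth; apply: (ext_cc2 (ckM oi (rth i) cf) _ rr rt) => x tx.
  by rewrite mulf_eq0 => /norP[_ /(fS x tx)[]].
have cgE th : reg 1 th -> cc2 1 (ext j (fun x => th (param (c j) x) * g x)).
  move=> rth; apply: (ext_cc2 (ckM oj (rth j) cg) _ tt tt') => x tx.
  by rewrite mulf_eq0 => /norP[_ /(gS x tx)[]].
have H p : exists W : set M, [/\ open W, W p & forall th, reg 1 th -> (forall m, th m != 0 -> W m) ->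
    Int2 (ext i (fun x => th (param (c i) x) * f x)) = Int2 (ext j (fun x => th (param (c j) x) * g x))].
  have [[si sj]|nsij] := pselect (source (c i) p /\ source (c j) p).
    pose x1 := coord (c i) p.
    have Ox1 : overlap i j x1 by split; [exact: coord_target|rewrite /= coordK].
    have tx1 : transition i j x1 = coord (c j) p by rewrite /transition coordK.
    have [r1 [r10 r1O [r1' r1'0 cov]]] := local_cov (@open_overlap i j) Ox1 (fun l => ck_transition i j 2 l) (jac_transition_neq0 Ox1).
    exists ([set m | source (c i) m /\ ball x1 r1 (coord (c i) m)] `&`
            [set m | source (c j) m /\ ball (transition i j x1) r1' (coord (c j) m)]); split.
    - apply: openI; apply: (chart_nbhs (p := p)) => //; try exact: ball_open; try exact: ballxx.
      by rewrite tx1; exact: ballxx.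
    - by split; split => //; rewrite ?tx1; exact: ballxx.
    move=> th rth thS; apply: cov; first exact: cgE.
    - move=> y; have [ty|ty] := pselect (target (c j) y); last by rewrite ext_out ?eqxx.
      by rewrite extE // mulf_eq0 => /norP[/thS[_ [_]]]; rewrite paramK.
    - move=> x; have [tx|tx] := pselect (target (c i) x); last by rewrite ext_out ?eqxx.
      by rewrite extE // mulf_eq0 => /norP[/thS[[_ +] _]]; rewrite paramK.
    - move=> x /r1O Ox; rewrite extE; last exact: Ox.1.
      rewrite extE; last exact: (overlap_transition Ox).1.
      by rewrite law // param_transition // mulrCA.
  (* [C] is closed, contains all points where either density is nonzero, and lies in both sources.
     It misses [p], and off [C] both pieces vanish. *)
  pose C := [set param (c i) y | y in [set y : 'rV[R]_2 | `|y - x0| <= r]] `&`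
            [set param (c j) y | y in [set y : 'rV[R]_2 | `|y - y0| <= t]].
  have cC : closed C by apply: closedI; [exact: param_ball_closed rr rt|exact: param_ball_closed tt tt'].
  exists (~` C); split; first exact: closed_openC.
    move=> [[x xr xp] [y yr yp]]; apply: nsij; split.
      rewrite -xp; apply: param_source; apply: rt; apply/ballP_norm; exact: le_lt_trans rr.
    rewrite -yp; apply: param_source; apply: tt'; apply/ballP_norm; exact: le_lt_trans tt.
  move=> th rth thS.
  have -> : ext i (fun x => th (param (c i) x) * f x) = fun=> 0.
    apply/funext => x; have [tx|tx] := pselect (target (c i) x); last by rewrite ext_out.
    rewrite extE //; apply/eqP; rewrite mulf_eq0; apply/orP.
    have [|fx] := eqVneq (f x) 0; first by right.
    left; apply: contraT => /thS []; have [/ballP_norm/ltW b1 Ox /ballP_norm/ltW b2] := fS x tx fx.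
    by split; [exists x|exists (transition i j x) => //; exact: param_transition].
  have -> : ext j (fun x => th (param (c j) x) * g x) = fun=> 0.
    apply/funext => x; have [tx|tx] := pselect (target (c j) x); last by rewrite ext_out.
    rewrite extE //; apply/eqP; rewrite mulf_eq0; apply/orP.
    have [|gx] := eqVneq (g x) 0; first by right.
    left; apply: contraT => /thS []; have [/ballP_norm/ltW b1 Ox /ballP_norm/ltW b2] := gS x tx gx.
    by split; [exists (transition j i x) => //; exact: param_transition|exists x].
  by [].
have [W HW] := choice H; have [ip Hip] := choice coverM.
(* A partition of unity takes a base point; if [M] is empty, so are all targets, and both integrals
   are zero. *)
have [fz|] := pselect (forall m : M, False).
  have t0 : forall k y, target (c k) y -> False by move=> k y _; exact: fz (param (c k) y).
  transitivity (Int2 (fun _ : 'rV[R]_2 => 0 : R)); last symmetry;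
    by congr Int2; apply/funext => x; apply: ext_out; exact: t0.
move=> /existsNP[m0 _].
have [s [chi [ra [ra' [Hr rchi chi0 chiS chi1]]]]] := partition_of_unity 1 m0 Hip
   (fun p => let: And3 a _ _ := HW p in a) (fun p => let: And3 _ a _ := HW p in a).
have chiW p m : chi p m != 0 -> W p m.
  move=> /chiS[sm bm]; have [_ lr _ HWp] := Hr p.
  have := HWp (coord (c (ip p)) m); rewrite coordK //; apply.
  by apply: le_ball bm; exact: ltW.
have fE : ext i f = fun x => \sum_(p <- s) ext i (fun x => chi p (param (c i) x) * f x) x.
  apply/funext => x; have [tx|tx] := pselect (target (c i) x).
    by rewrite extE //; under eq_bigr do rewrite extE //; rewrite -mulr_suml chi1 mul1r.
  by rewrite ext_out // big1 // => p _; rewrite ext_out.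
have gE : ext j g = fun x => \sum_(p <- s) ext j (fun x => chi p (param (c j) x) * g x) x.
  apply/funext => x; have [tx|tx] := pselect (target (c j) x).
    by rewrite extE //; under eq_bigr do rewrite extE //; rewrite -mulr_suml chi1 mul1r.
  by rewrite ext_out // big1 // => p _; rewrite ext_out.
rewrite fE gE (Int2_sum _ _ (fun p => cfE _ (rchi p))) (Int2_sum _ _ (fun p => cgE _ (rchi p))).
by apply: eq_bigr => p _; have [_ _ HI] := HW p; apply: HI => // m; exact: chiW.
Qed.

(** The image of the closed ball is closed, so off it [h] is zero on a neighbourhood and its
    derivatives vanish. Only the closed ball of radius [r] is obtained, hence the weak
    inequality. *)
Lemma partial_support i j (h : M -> R) x0 r r' l y : r < r' -> ball x0 r' `<=` target (c i) ->
  (forall m, h m != 0 -> source (c i) m /\ ball x0 r (coord (c i) m)) ->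
  target (c j) y -> partial l (fun y => h (param (c j) y)) y != 0 ->
  overlap j i y /\ `|transition j i y - x0| <= r.
Proof.
move=> rr rt hS ty; apply: contra_neqP => ny.
have cC := param_ball_closed rr rt.
pose V := target (c j) `&` param (c j) @^-1` ~` [set param (c i) y | y in [set y : 'rV[R]_2 | `|y - x0| <= r]].
have oV : open V.
  by apply: open_within_preimage; [exact: target_open|exact: param_continuous|exact: closed_openC].
rewrite -(congr1 (fun h => h y) (@partial_cst R 2 l 0)); apply: partial_near.
have Vy : V y.
  split => // -[z zr E]; apply: ny.
  have tz : target (c i) z by apply: rt; apply/ballP_norm; exact: le_lt_trans rr.
  split; first by split => //=; rewrite -E; exact: param_source.
  by rewrite /transition -E paramK.
apply: filterS (open_nbhs_nbhs (conj oV Vy)) => z [tz nz].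
apply/eqP; apply: contra_notT nz => /hS[sz /ballP_norm/ltW bz].
by exists (coord (c i) (param (c j) z)) => //; rewrite coordK.
Qed.

(** * Stokes' theorem for a one-form twisted by the orientation *)

Variable alpha : I -> 'I_2 -> 'rV[R]_2 -> R.
Hypothesis ck_alpha : forall i l, ck 2 (target (c i)) (alpha i l).
Hypothesis alpha_law : forall i j l x, overlap i j x -> alpha i l x =
  Num.sg (jac (transition i j) x) *
   (partial l (fun y => transition i j y 0 0) x * alpha j 0 (transition i j x) +
    partial l (fun y => transition i j y 0 1) x * alpha j 1 (transition i j x)).

Definition dalpha i x := partial 0 (alpha i 1) x - partial 1 (alpha i 0) x.

Definition wedge i (h : M -> R) x :=
  partial 0 (fun y => h (param (c i) y)) x * alpha i 1 x -
  partial 1 (fun y => h (param (c i) y)) x * alpha i 0 x.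

(** The two pulled back covectors produce the Jacobian and the twist of [alpha] produces its sign.
    Their product is the absolute value, the law of a density handled by [Int2_transition]. *)
Lemma wedge_law i j h x : reg 1 h -> overlap i j x ->
  wedge i h x = `|jac (transition i j) x| * wedge j h (transition i j x).
Proof.
move=> rh Ox; rewrite /wedge !(partial_transition _ rh Ox) !(alpha_law _ Ox) normrEsg; exact: wedge_ring.
Qed.

Lemma ck_wedge i h : reg 2 h -> ck 1 (target (c i)) (wedge i h).
Proof.
move=> rh; have oi := @target_open _ _ (c i).
by apply: (ckB oi); apply: (ckM oi); (try exact: ckW); exact: ck_partial (rh i).
Qed.

Lemma wedge_sum i (T : Type) (s : seq T) (h : T -> M -> R) x : (forall t, reg 1 (h t)) -> target (c i) x ->
  wedge i (fun m => \sum_(t <- s) h t m) x = \sum_(t <- s) wedge i (h t) x.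
Proof.
move=> rh tx; rewrite /wedge !partial_sum; try by move=> t; exact: (ck_diff (rh t i) tx).
by rewrite !mulr_suml -sumrB.
Qed.

Lemma wedge_cst i (a : R) x : wedge i (fun=> a) x = 0.
Proof. by rewrite /wedge !partial_cst !mul0r subrr. Qed.

Hypothesis dalpha_gt0 : forall i x, target (c i) x -> 0 < dalpha i x.

Lemma ck_dalpha i : ck 1 (target (c i)) (dalpha i).
Proof. by apply: (ckB (@target_open _ _ (c i))); exact: ck_partial. Qed.

Lemma ext_partial i f x0 r r' l x : ball x0 r' `<=` target (c i) -> r < r' ->
  (forall x, target (c i) x -> f x != 0 -> ball x0 r x) ->
  partial l (ext i f) x = ext i (partial l f) x.
Proof.
move=> rt rr fS; have [tx|tx] := pselect (target (c i) x).
  rewrite extE //; apply: partial_near.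
  by apply: filterS (open_nbhs_nbhs (conj (@target_open _ _ (c i)) tx)) => y ty; rewrite extE.
rewrite ext_out // -(congr1 (fun h => h x) (@partial_cst R 2 l 0)); apply: partial_near.
have xr : r < `|x - x0|.
  by rewrite ltNge; apply: contra_notN tx => xr; apply: rt; apply/ballP_norm; exact: le_lt_trans rr.
apply: filterS (open_nbhs_nbhs (conj (@open_dist_gt _ x0 r) xr)) => y /= yr.
have [ty|ty] := pselect (target (c i) y); last exact: ext_out.
rewrite extE //; apply/eqP; apply: contraT => /(fS y ty)/ballP_norm h.
by rewrite ltNge (ltW h) in yr.
Qed.

(* With a partition of unity [chi_p],
   sum_p int chi_p d alpha = - sum_(p, q) int_p chi_q d chi_p /\ alpha = - sum_(p, q) int_q chi_q d chi_p /\ alpha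
   by invariance under the coordinate changes, and the last sum vanishes since [sum_p d chi_p = 0]. *)
Theorem no_positive_exact_form (m0 : M) : False.
Proof.
have [ip Hip] := choice coverM.
have [s [chi [r [r' [Hr rchi chi0 chiS chi1]]]]] := partition_of_unity 2 m0 Hip
   (fun=> openT) (fun=> Logic.I).
(* The differential of [chi p] is only confined to the closed ball of radius [r p]; the midpoint
   [rho p] gives an open ball that contains it and stays inside radius [r' p]. *)
pose x0 p := coord (c (ip p)) p; pose rho p := (r p + r' p) / 2.
have rr p : r p < r' p by have [] := Hr p.
have rt p : ball (x0 p) (r' p) `<=` target (c (ip p)) by have [] := Hr p.
have [rrho rhor] : (forall p, r p < rho p) /\ (forall p, rho p < r' p).
  by split=> p; have [] := mid_lt (rr p).
have oi p := @target_open _ _ (c (ip p)).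
have chi_1 p : reg 1 (chi p) by move=> i; exact: ckW (rchi p i).
have chiS' p x : target (c (ip p)) x -> chi p (param (c (ip p)) x) != 0 -> ball (x0 p) (r p) x.
  by move=> tx /chiS[_]; rewrite paramK.
have wS p q x : target (c (ip q)) x -> wedge (ip q) (chi p) x != 0 ->
    overlap (ip q) (ip p) x /\ ball (x0 p) (rho p) (transition (ip q) (ip p) x).
  move=> tx w0.
  have [l Hl] : exists l, partial l (fun y => chi p (param (c (ip q)) y)) x != 0.
    apply: contra_neqP w0 => /forallNP h.
    have h' l : partial l (fun y => chi p (param (c (ip q)) y)) x = 0 by apply/eqP; apply: contra_notT (h l).
    by rewrite /wedge !h' !mul0r subrr.
  have [Ov b] := partial_support (rr p) (rt p) (chiS p) tx Hl.
  by split => //; apply/ballP_norm; exact: le_lt_trans (rrho p).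
have wS' p x : target (c (ip p)) x -> wedge (ip p) (chi p) x != 0 -> ball (x0 p) (rho p) x.
  by move=> tx w0; have [_] := wS p p x tx w0; rewrite /transition paramK.
pose f p q x := chi q (param (c (ip p)) x) * wedge (ip p) (chi p) x.
pose g p q x := chi q (param (c (ip q)) x) * wedge (ip q) (chi p) x.
have cf p q : ck 1 (target (c (ip p))) (f p q) by apply: (ckM (oi p) (chi_1 q _)); exact: ck_wedge.
have cg p q : ck 1 (target (c (ip q))) (g p q) by apply: (ckM (oi q) (chi_1 q _)); exact: ck_wedge.
have ccf p q : cc2 1 (ext (ip p) (f p q)).
  apply: (ext_cc2 (cf p q) _ (rhor p) (rt p)) => x tx; rewrite /f mulf_eq0 => /norP[_]; exact: wS'.
have ccg p q : cc2 1 (ext (ip q) (g p q)).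
  apply: (ext_cc2 (cg p q) _ (rr q) (rt q)) => x tx; rewrite /g mulf_eq0 => /norP[h _]; exact: chiS'.
have swap p q : Int2 (ext (ip p) (f p q)) = Int2 (ext (ip q) (g p q)).
  apply: (Int2_transition (rhor p) (rt p) (rr q) (rt q)) => //.
  - by move=> x Ox; rewrite /f /g param_transition // (wedge_law (chi_1 p) Ox) mulrCA.
  - move=> x tx; rewrite /f mulf_eq0 => /norP[c0 w0]; have [sq bq] := chiS _ _ c0.
    by split; [exact: wS'|split|].
  - move=> y ty; rewrite /g mulf_eq0 => /norP[c0 w0]; have [Ov b] := wS _ _ _ ty w0.
    by split => //; exact: chiS'.
pose D p x := chi p (param (c (ip p)) x) * dalpha (ip p) x.
have cD p : cc2 1 (ext (ip p) (D p)).
  apply: (ext_cc2 _ _ (rr p) (rt p)); first by apply: (ckM (oi p) (chi_1 p _)); exact: ck_dalpha.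
  by move=> x tx; rewrite /D mulf_eq0 => /norP[h _]; exact: chiS'.
pose W p l x := chi p (param (c (ip p)) x) * alpha (ip p) l x.
have WS p l x : target (c (ip p)) x -> W p l x != 0 -> ball (x0 p) (r p) x.
  by move=> tx; rewrite /W mulf_eq0 => /norP[h _]; exact: chiS'.
have cW p l : cc2 2 (ext (ip p) (W p l)).
  by apply: (ext_cc2 _ (WS p l) (rr p) (rt p)); apply: (ckM (oi p) (rchi p _)); exact: ck_alpha.
have stokes p : Int2 (ext (ip p) (D p)) = - \sum_(q <- s) Int2 (ext (ip p) (f p q)).
  apply/eqP; rewrite -addr_eq0; apply/eqP.
  rewrite -(Int2_sum _ _ (ccf p)) -(Int2D (cD p) (cc2_sum _ _ (ccf p))).
  (* The right side is the integral of $d(\chi_p \alpha)$, zero by the divergence theorem. The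
     product rule splits it into $\chi_p\, d\alpha$ and $d\chi_p \wedge \alpha$, the latter spread
     over the partition by $\sum_q \chi_q = 1$. *)
  transitivity (Int2 (fun x => partial 0 (ext (ip p) (W p 1)) x + (-1) * partial 1 (ext (ip p) (W p 0)) x)).
    congr Int2; apply/funext => x; rewrite !(ext_partial _ _ (rt p) (rr p) (WS p _)).
    have [tx|tx] := pselect (target (c (ip p)) x); last first.
      by rewrite !ext_out // mulr0 !add0r big1 // => q _; rewrite ext_out.
    have dchi := ck_diff (chi_1 p (ip p)) tx.
    have da l := ck_diff (ck_alpha (ip p) l) tx.
    rewrite !extE // !partialM //; under eq_bigr do rewrite extE //.
    rewrite -mulr_suml chi1 /D /dalpha /wedge; ring.
  rewrite (Int2D (cc2_partial 0 (cW p 1)) (cc2Z _ (cc2_partial 1 (cW p 0)))).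
  by rewrite (Int2Z _ (cc2_partial 1 (cW p 0))) (Int2_partial0 (cW p 1)) (Int2_partial1 (cW p 0)) mulr0 addr0.
have D0 : \sum_(p <- s) Int2 (ext (ip p) (D p)) = 0.
  under eq_bigr do rewrite stokes; rewrite sumrN exchange_big big1 ?oppr0 // => q _ /=.
  under eq_bigr do rewrite swap; rewrite -(Int2_sum _ _ (fun p => ccg p q)) -[RHS](@Int2_0 R).
  congr Int2; apply/funext => x; have [tx|tx] := pselect (target (c (ip q)) x); last first.
    by rewrite big1 // => p _; rewrite ext_out.
  under eq_bigr do rewrite extE //; rewrite /g -mulr_sumr -wedge_sum //.
  have -> : (fun m => \sum_(p <- s) chi p m) = fun=> 1 by apply/funext.
  by rewrite wedge_cst mulr0.
have Dp p x : 0 <= ext (ip p) (D p) x.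
  have [tx|tx] := pselect (target (c (ip p)) x); last by rewrite ext_out.
  by rewrite extE // mulr_ge0 // ltW // dalpha_gt0.
have Dz p : p \in s -> forall x, ext (ip p) (D p) x = 0.
  move=> ps; apply: (Int2_eq0 (cD p) (Dp p)).
  by apply: (psumr_seq_eq0 _ D0 ps) => q; apply: Int1_ge0 => t; apply: Int1_ge0.
(* The functions $\chi_p\, d\alpha$ are nonnegative with total integral zero, hence vanish; as
   $d\alpha > 0$, every $\chi_p$ is zero at [m0], although they sum to 1. *)
have := chi1 m0; rewrite big_seq big1 => [/esym/eqP|p ps]; first by rewrite oner_eq0.
apply/eqP; apply: contraT => c0; have [sm _] := chiS _ _ c0.
have := Dz p ps (coord (c (ip p)) m0); rewrite extE; last exact: coord_target.
by rewrite /D coordK // => /eqP; rewrite mulf_eq0 (negPf c0) gt_eqF // dalpha_gt0 //; exact: coord_target.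
Qed.

End Atlas.

(** * Gauss curvature from an orthonormal coframe *)

Lemma christoffel_coframe_ring (R : realFieldType) (D W T0 T1 P Q u v p0 p1 q0 q1 pj qj : R) : D != 0 ->
  q1 * T0 - q0 * T1 = 2 * (D * P - W * qj) -> p0 * T1 - p1 * T0 = 2 * (D * Q + W * pj) ->
  2^-1 * ((u / D * (q1 / D) + v / D * (- p1 / D)) * T0 + (u / D * (- q0 / D) + v / D * (p0 / D)) * T1) =
  u / D * (P + - (W / D) * qj) + v / D * (Q - - (W / D) * pj).
Proof.
move=> D0 h1 h2.
transitivity (2^-1 * (u * (q1 * T0 - q0 * T1) + v * (p0 * T1 - p1 * T0)) / D ^+ 2); first by field.
by rewrite h1 h2; field.
Qed.

(** A linear elimination: the difference of the two differentiated identities, corrected by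
    multiples of the undifferentiated ones, is the goal. Each [f_equal2] line adds one multiple. *)
Lemma curvature_ring (R : comNzRingType) (s a01 c01 c10 c0 c1 a00' a01' a10' a11' w01' w11'
  G011 G111 G001 G101 g000 g001 g010 g011 g100 g101 g110 g111 a0 a1 w0 w1 : R) :
  w0 * g011 + w1 * g111 = w11' - s * (c1 * a1) -> w0 * g001 + w1 * g101 = w01' - s * (c0 * a1) ->
  a0 * g011 + a1 * g111 = a11' + s * (c1 * w1) -> a0 * g010 + a1 * g110 = a10' + s * (c1 * w0) ->
  a0 * g001 + a1 * g101 = a01' + s * (c0 * w1) -> a0 * g000 + a1 * g100 = a00' + s * (c0 * w0) ->
  a10' * g001 + a0 * G001 + (a11' * g101 + a1 * G101) = a01 + s * (c10 * w1 + c0 * w11') ->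
  a00' * g011 + a0 * G011 + (a01' * g111 + a1 * G111) = a01 + s * (c01 * w1 + c1 * w01') ->
  (G011 - G001 + (g011 * g000 - g001 * g010 + (g111 * g001 - g101 * g011))) * a0 +
  (G111 - G101 + (g011 * g100 - g001 * g110 + (g111 * g101 - g101 * g111))) * a1 = s * ((c01 - c10) * w1).
Proof.
have z (u v : R) : u = v -> u - v = 0 by move=> ->; rewrite subrr.
move=> /z f11 /z f01 /z e11 /z e10 /z e01 /z e00 /z d1 /z d0; apply/eqP; rewrite -subr_eq0; apply/eqP.
have {}d0 := f_equal2 (fun x y => x - y) d0 d1.
have {}d0 := f_equal2 (fun x y => x + g011 * y) d0 e00.
have {}d0 := f_equal2 (fun x y => x + g111 * y) d0 e01.
have {}d0 := f_equal2 (fun x y => x - g001 * y) d0 e10.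
have {}d0 := f_equal2 (fun x y => x - g101 * y) d0 e11.
have {}d0 := f_equal2 (fun x y => x + s * c0 * y) d0 f11.
have {}d0 := f_equal2 (fun x y => x - s * c1 * y) d0 f01.
move: d0; rewrite !mulr0 !subr0 !addr0 => <-; ring.
Qed.

Section OrthonormalCoframe.
Variables (R : realType) (U : set 'rV[R]_2) (p q : 'I_2 -> 'rV[R]_2 -> R) (g : 'rV[R]_2 -> 'M[R]_2).
Hypothesis oU : open U.
Hypothesis ck_p : forall i, ck 3 U (p i).
Hypothesis ck_q : forall i, ck 3 U (q i).

Definition curl (w : 'I_2 -> 'rV[R]_2 -> R) x := partial 0 (w 1) x - partial 1 (w 0) x.

Definition coframe_det x := p 0 x * q 1 x - p 1 x * q 0 x.

(** The one-form [alpha] determined by $dp = -\alpha \wedge q$ and $dq = \alpha \wedge p$. *)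
Definition connection_form i x := - ((curl p x * p i x + curl q x * q i x) / coframe_det x).

Hypothesis det_neq0 : forall x, U x -> coframe_det x != 0.
Hypothesis gE : forall x, U x -> forall i j, g x i j = p i x * p j x + q i x * q j x.

Lemma ck_connection_form i : ck 2 U (connection_form i).
Proof.
have W (w : 'I_2 -> 'rV[R]_2 -> R) : (forall i, ck 3 U (w i)) -> (forall i, ck 2 U (w i)) * ck 2 U (curl w).
  by move=> cw; split=> [j|]; [exact: ckW|apply: (ckB oU); exact: ck_partial].
have [Wp Cp] := W p ck_p; have [Wq Cq] := W q ck_q.
have cD : ck 2 U coframe_det := ckB oU (ckM oU (Wp 0) (Wq 1)) (ckM oU (Wp 1) (Wq 0)).
exact: (ckN oU (ckM oU (ckD oU (ckM oU Cp (Wp i)) (ckM oU Cq (Wq i))) (ckV oU det_neq0 cD))).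
Qed.

Lemma partial_metric m i j x : U x -> partial m (fun y => g y i j) x =
  partial m (p i) x * p j x + p i x * partial m (p j) x + (partial m (q i) x * q j x + q i x * partial m (q j) x).
Proof.
move=> Ux; have dp k := ck_diff (ck_p k) Ux; have dq k := ck_diff (ck_q k) Ux.
rewrite -!partialM // -partialD; [|exact: differentiableM|exact: differentiableM].
by apply: partial_near; apply: filterS (open_nbhs_nbhs (conj oU Ux)) => y Uy; exact: gE.
Qed.

Lemma det2 (A : 'M[R]_2) : \det A = A 0 0 * A 1 1 - A 1 0 * A 0 1.
Proof.
rewrite (expand_det_col _ 0) sum_ord2 /cofactor !det_mx11 !mxE /= addn0 expr0 mul1r expr1 mulN1r mulrN.
by congr (_ * A _ _ - _ * A _ _); exact: val_inj.
Qed.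

Lemma det_metric x : U x -> \det (g x) = coframe_det x ^+ 2.
Proof. by move=> Ux; rewrite det2 !gE // /coframe_det; ring. Qed.

(** [dual_p] and [dual_q] are the components of the vector frame dual to $(p, q)$. *)
Definition dual_p (k : 'I_2) x := (if k == 0 then q 1 x else - q 0 x) / coframe_det x.
Definition dual_q (k : 'I_2) x := (if k == 0 then - p 1 x else p 0 x) / coframe_det x.

Lemma inv_metric x k l : U x -> invmx (g x) k l = dual_p k x * dual_p l x + dual_q k x * dual_q l x.
Proof.
move=> Ux; pose B := \matrix_(k, l) (dual_p k x * dual_p l x + dual_q k x * dual_q l x).
have gu : g x \in unitmx by rewrite unitmxE det_metric // unitfE expf_neq0 // det_neq0.
suff -> : invmx (g x) = B by rewrite mxE.
rewrite -[RHS](mulKmx gu) -[LHS]mulmx1; congr (_ *m _).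
apply/matrixP => i j; rewrite !mxE sum_ord2 !mxE !gE //; have := det_neq0 Ux.
rewrite /dual_p /dual_q /coframe_det /=.
by move: i j; apply: ord2P; apply: ord2P => /= h; field.
Qed.

(** Here [T l] is twice the Christoffel symbol with lowered index. The two combinations contract it
    with the dual frame, cleared of the denominator [coframe_det]. *)
Lemma lowered_christoffel i j x : U x ->
  let T l := partial i (fun y => g y j l) x + partial j (fun y => g y i l) x - partial l (fun y => g y i j) x in
  q 1 x * T 0 - q 0 x * T 1 = 2 * (coframe_det x * partial i (p j) x - (curl p x * p i x + curl q x * q i x) * q j x) /\
  p 0 x * T 1 - p 1 x * T 0 = 2 * (coframe_det x * partial i (q j) x + (curl p x * p i x + curl q x * q i x) * p j x).
Proof.
move=> Ux T; rewrite /T !partial_metric // /curl /coframe_det.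
move: i j {T}; apply: ord2P; apply: ord2P;
move: (p 0 x) (p 1 x) (q 0 x) (q 1 x) => p0 p1 q0 q1;
move: (partial 0 (p 0) x) (partial 0 (p 1) x) (partial 1 (p 0) x) (partial 1 (p 1) x) => a b a' b';
move: (partial 0 (q 0) x) (partial 0 (q 1) x) (partial 1 (q 0) x) (partial 1 (q 1) x) => d e d' e';
by split; ring.
Qed.

Lemma christoffel_coframe k i j x : U x -> christoffel g k i j x =
  dual_p k x * (partial i (p j) x + connection_form i x * q j x) +
  dual_q k x * (partial i (q j) x - connection_form i x * p j x).
Proof.
move=> Ux; rewrite /christoffel sum_ord2 !inv_metric //; have := lowered_christoffel i j Ux.
have := det_neq0 Ux; rewrite /dual_p /dual_q /connection_form /=.
move: (if k == 0 then q 1 x else _) (if k == 0 then - p 1 x else _) => u v.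
move: (_ - partial 0 _ x) (_ - partial 1 _ x) (partial i (p j) x) (partial i (q j) x) => T0 T1 P Q.
by move=> D0 [h1 h2]; exact: christoffel_coframe_ring D0 h1 h2.
Qed.

Lemma sum_dual x : U x -> [/\ dual_p 0 x * p 0 x + dual_p 1 x * p 1 x = 1,
   dual_q 0 x * p 0 x + dual_q 1 x * p 1 x = 0,
   dual_p 0 x * q 0 x + dual_p 1 x * q 1 x = 0 &
   dual_q 0 x * q 0 x + dual_q 1 x * q 1 x = 1].
Proof.
by move=> Ux; have := det_neq0 Ux; rewrite /dual_p /dual_q /coframe_det /=; split; field.
Qed.

(** In invariant form $\nabla_i p = -\alpha_i q$; the companion [q_christoffel] is $\nabla_i q =
    \alpha_i p$. *)
Lemma p_christoffel i j x : U x -> p 0 x * christoffel g 0 i j x + p 1 x * christoffel g 1 i j x =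
  partial i (p j) x + connection_form i x * q j x.
Proof.
move=> Ux; rewrite !christoffel_coframe //; have [e1 e2 _ _] := sum_dual Ux.
move: (_ + connection_form i x * q j x) (_ - connection_form i x * p j x) => X Y.
by rewrite -[RHS]mul1r -[RHS]addr0 -(mul0r Y) -e1 -e2; ring.
Qed.

Lemma q_christoffel i j x : U x -> q 0 x * christoffel g 0 i j x + q 1 x * christoffel g 1 i j x =
  partial i (q j) x - connection_form i x * p j x.
Proof.
move=> Ux; rewrite !christoffel_coframe //; have [_ _ e1 e2] := sum_dual Ux.
move: (_ + connection_form i x * q j x) (_ - connection_form i x * p j x) => X Y.
by rewrite -[RHS]mul1r -[RHS]add0r -(mul0r X) -e1 -e2; ring.
Qed.

Lemma ck_christoffel k i j : ck 1 U (christoffel g k i j).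
Proof.
have W (w : 'I_2 -> 'rV[R]_2 -> R) : (forall i, ck 3 U (w i)) -> (forall i, ck 1 U (w i)) * (forall i j, ck 1 U (partial i (w j))).
  by move=> cw; split=> [j0|i0 j0]; [exact: ckW (ckW (cw j0))|exact: ckW (ck_partial i0 (cw j0))].
have [Wp Cp] := W p ck_p; have [Wq Cq] := W q ck_q.
have cD : ck 1 U coframe_det := ckB oU (ckM oU (Wp 0) (Wq 1)) (ckM oU (Wp 1) (Wq 0)).
have cV := ckV oU det_neq0 cD.
have dp : ck 1 U (dual_p k).
  by apply: (ckM oU _ cV); move: (k); apply: ord2P => /=; [exact: Wq 1|exact: (ckN oU (Wq 0))].
have dq : ck 1 U (dual_q k).
  by apply: (ckM oU _ cV); move: (k); apply: ord2P => /=; [exact: (ckN oU (Wp 1))|exact: Wp 0].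
have ca := ckW (ck_connection_form i).
have := ckD oU (ckM oU dp (ckD oU (Cp i j) (ckM oU ca (Wq j)))) (ckM oU dq (ckB oU (Cq i j) (ckM oU ca (Wp j)))).
by apply: (ck_ext oU) => x Ux; rewrite christoffel_coframe.
Qed.

Lemma partial_christoffel_sum (a w : 'I_2 -> 'rV[R]_2 -> R) s m i j x :
  (forall i, ck 3 U (a i)) -> (forall i, ck 3 U (w i)) -> U x ->
  (forall y, U y -> a 0 y * christoffel g 0 i j y + a 1 y * christoffel g 1 i j y =
     partial i (a j) y + s * (connection_form i y * w j y)) ->
  partial m (a 0) x * christoffel g 0 i j x + a 0 x * partial m (christoffel g 0 i j) x +
  (partial m (a 1) x * christoffel g 1 i j x + a 1 x * partial m (christoffel g 1 i j) x) =
  partial m (partial i (a j)) x +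
   s * (partial m (connection_form i) x * w j x + connection_form i x * partial m (w j) x).
Proof.
move=> ca cw Ux E.
have da l := ck_diff (ca l) Ux; have dw l := ck_diff (cw l) Ux.
have dG l := ck_diff (ck_christoffel l i j) Ux; have dc := ck_diff (ck_connection_form i) Ux.
have dpa := ck_diff (ck_partial i (ca j)) Ux.
rewrite -!partialM // -partialD; [|exact: differentiableM|exact: differentiableM].
rewrite -partialZ; last exact: differentiableM.
rewrite -partialD //; last by apply: differentiableM; [exact: differentiable_cst|exact: differentiableM].
by apply: partial_near; apply: filterS (open_nbhs_nbhs (conj oU Ux)) => y Uy; exact: E.
Qed.

(** The second structure equation, obtained by differentiating the formulas for $\nabla p$ and
    $\nabla q$ and antisymmetrising. The sign [s] lets one statement cover both covectors: $(p, q)$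
    with 1 and $(q, p)$ with -1. *)
Lemma curvature_coframe (a w : 'I_2 -> 'rV[R]_2 -> R) s x :
  (forall i, ck 3 U (a i)) -> (forall i, ck 3 U (w i)) -> U x ->
  (forall y i j, U y -> a 0 y * christoffel g 0 i j y + a 1 y * christoffel g 1 i j y =
     partial i (a j) y + s * (connection_form i y * w j y)) ->
  (forall y i j, U y -> w 0 y * christoffel g 0 i j y + w 1 y * christoffel g 1 i j y =
     partial i (w j) y - s * (connection_form i y * a j y)) ->
  \sum_l curvature g l 0 1 1 x * a l x = s * (curl connection_form x * w 1 x).
Proof.
move=> ca cw Ux Ea Ew; rewrite sum_ord2 /curvature !sum_ord2 /curl.
have := partial_christoffel_sum 0 ca cw Ux (fun y => Ea y 1 1).
have := partial_christoffel_sum 1 ca cw Ux (fun y => Ea y 0 1).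
rewrite (partial_partialC 0 1 oU Ux (ckW (ca 1))).
have e00 := Ea x 0 0 Ux; have e01 := Ea x 0 1 Ux; have e10 := Ea x 1 0 Ux; have e11 := Ea x 1 1 Ux.
have f01 := Ew x 0 1 Ux; have f11 := Ew x 1 1 Ux; move=> d1 d0.
exact: (curvature_ring f11 f01 e11 e10 e01 e00 d1 d0).

Qed.

Lemma gauss_curvature_coframe x : U x ->
  gauss_curvature_of_metric g x = curl connection_form x / coframe_det x.
Proof.
move=> Ux; rewrite /gauss_curvature_of_metric det_metric //; set K := \sum_l _.
(* The index is lowered with $g = p^2 + q^2$; the two contractions then add up to
   [curl connection_form] times [coframe_det], against a denominator that is its square. *)
have -> : K = (\sum_l curvature g l 0 1 1 x * p l x) * p 0 x + (\sum_l curvature g l 0 1 1 x * q l x) * q 0 x.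
  by rewrite /K !sum_ord2 !gE //; ring.
have Ep y i j : U y -> p 0 y * christoffel g 0 i j y + p 1 y * christoffel g 1 i j y =
     partial i (p j) y + 1 * (connection_form i y * q j y) by move=> Uy; rewrite p_christoffel // mul1r.
have Eq y i j : U y -> q 0 y * christoffel g 0 i j y + q 1 y * christoffel g 1 i j y =
     partial i (q j) y - 1 * (connection_form i y * p j y) by move=> Uy; rewrite q_christoffel // mul1r.
rewrite (curvature_coframe ck_p ck_q Ux Ep Eq) (@curvature_coframe q p (-1) x ck_q ck_p Ux).
- by have := det_neq0 Ux; rewrite /coframe_det; move: (curl _ x) => t h; field.
- by move=> y i j Uy; rewrite Eq // !mul1r mulN1r.
- by move=> y i j Uy; rewrite Ep // mulN1r mul1r opprK.
Qed.

End OrthonormalCoframe.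

(** * The shape operator of a surface in [Sol_3] *)

Section SolMetric.
Variable R : realType.
Implicit Type q : 'rV[R]_3.

(** All three diagonal entries of the metric become $e^{2 s_a z}$ with $s = (1, -1, 0)$, so the
    Christoffel symbols have one formula for all indices. *)
Definition sol_exponent (a : 'I_3) : R := [:: 1; -1; 0]`_a.

Definition sol_weight (a : 'I_3) q : R := expR (2 * sol_exponent a * q 0 ord_max).

Lemma ord3P (P : 'I_3 -> Prop) : P 0 -> P 1 -> P ord_max -> forall i, P i.
Proof.
move=> P0 P1 P2 [[|[|[|//]]] p].
- by have -> : Ordinal p = 0 by exact: val_inj.
- by have -> : Ordinal p = 1 by exact: val_inj.
- by have -> : Ordinal p = ord_max by exact: val_inj.
Qed.

Lemma sol_metricE q i j : sol_metric q i j = (i == j)%:R * sol_weight i q.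
Proof.
suff E : [:: expR (2 * q 0 ord_max); expR (- (2 * q 0 ord_max)); 1]`_i = sol_weight i q.
  by rewrite -E mulr_natl /sol_metric !mxE.
rewrite /sol_weight /sol_exponent; move: i; apply: ord3P => /=; first by rewrite mulr1.
  by rewrite mulrN1 mulNr.
by rewrite mulr0 mul0r expR0.
Qed.

Lemma sol_weight_gt0 a q : 0 < sol_weight a q.
Proof. exact: expR_gt0. Qed.

Lemma sol_metric_diag q : sol_metric q = diag_mx (\row_a sol_weight a q).
Proof. by apply/matrixP => i j; rewrite sol_metricE !mxE mulr_natl. Qed.

Lemma sol_metric_form m n (A : 'M[R]_(m, 3)) (B : 'M[R]_(n, 3)) q i j :
  (A *m sol_metric q *m B^T) i j = \sum_k sol_weight k q * (A i k * B j k).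
Proof.
by rewrite sol_metric_diag mul_mx_diag mxE; apply: eq_bigr => k _; rewrite !mxE; ring.
Qed.

Lemma inv_sol_metric q : invmx (sol_metric q) = diag_mx (\row_a (sol_weight a q)^-1).
Proof.
pose B : 'M[R]_3 := diag_mx (\row_a (sol_weight a q)^-1).
have E : sol_metric q *m B = 1%:M.
  rewrite sol_metric_diag mulmx_diag; apply/matrixP => i j; rewrite !mxE.
  by rewrite divff // gt_eqF // sol_weight_gt0.
have [u _] := mulmx1_unit E.
by rewrite -[LHS]mulmx1 -E mulKmx.
Qed.

Lemma differentiable_sol_weight a q : differentiable (sol_weight a) q.
Proof.
apply: (ck_diff (k := 0) (U := setT) _ Logic.I); apply: (ck_exp openT); apply: (ckZ openT); exact: ck_coord.
Qed.

Lemma partial_sol_weight m a q :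
  partial m (sol_weight a) q = (ord_max == m)%:R * (2 * sol_exponent a * sol_weight a q).
Proof.
have dc : differentiable (fun y : 'rV[R]_3 => y 0 ord_max) q.
  by apply: (ck_diff (k := 0) (U := setT) _ Logic.I); exact: ck_coord.
rewrite partial_exp ?partialZ ?partial_coordE //; last exact: (differentiableM (differentiable_cst _ _) dc).
by rewrite /sol_weight; ring.
Qed.

Lemma partial_sol_metric m i j q : partial m (fun y => sol_metric y i j) q =
  (i == j)%:R * ((ord_max == m)%:R * (2 * sol_exponent i * sol_weight i q)).
Proof.
rewrite -partial_sol_weight -partialZ; last exact: differentiable_sol_weight.
by congr (partial m _ q); apply/funext => y; rewrite sol_metricE.
Qed.

Lemma sol_christoffelE k a b q : sol_weight k q * christoffel (@sol_metric R) k a b q =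
  (b == k)%:R * (ord_max == a)%:R * (sol_exponent b * sol_weight b q) +
  (a == k)%:R * (ord_max == b)%:R * (sol_exponent a * sol_weight a q) -
  (a == b)%:R * (ord_max == k)%:R * (sol_exponent a * sol_weight a q).
Proof.
rewrite /christoffel (bigD1 k) //= big1 ?addr0.
  rewrite !partial_sol_metric inv_sol_metric !mxE eqxx mulr1n.
  have := sol_weight_gt0 k q; move: (sol_weight k q) => w w0; field.
  by rewrite gt_eqF.
by move=> l lk; rewrite inv_sol_metric !mxE eq_sym (negPf lk) mulr0n mul0r.
Qed.

Lemma sum_delta n (k : 'I_n) (F : 'I_n -> R) : \sum_i (i == k)%:R * F i = F k.
Proof.
rewrite (bigD1 k) //= eqxx mul1r big1 ?addr0 // => i ik.
by rewrite (negPf ik) mul0r.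
Qed.

(** The pairing of [Y] with the Christoffel term in the derivative of [V] along [T], once the
    Kronecker symbols have collapsed the triple sum. *)
Lemma sol_connection_form (q T V Y : 'I_3 -> R) z :
  \sum_k sol_weight k z * (Y k * \sum_a \sum_b christoffel (@sol_metric R) k a b z * T a * V b) =
  \sum_k sol_exponent k * sol_weight k z * (T ord_max * Y k * V k + T k * Y k * V ord_max) -
  Y ord_max * \sum_k sol_exponent k * sol_weight k z * T k * V k.
Proof.
transitivity (\sum_k \sum_a \sum_b (sol_weight k z * christoffel (@sol_metric R) k a b z) * (Y k * T a * V b)).
  apply: eq_bigr => k _; rewrite !mulr_sumr; apply: eq_bigr => a _; rewrite !mulr_sumr.
  by apply: eq_bigr => b _; ring.
under eq_bigr => k _.
  under eq_bigr => a _.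
    under eq_bigr => b _.
      rewrite sol_christoffelE; set w := sol_weight ^~ z.
      have -> : forall p q r p' q' r' : R, (p * q * (sol_exponent b * w b) + p' * q' * (sol_exponent a * w a) - r * r' * (sol_exponent a * w a)) * (Y k * T a * V b) =
         p * (q * (sol_exponent b * w b * (Y k * T a * V b))) + q' * (p' * (sol_exponent a * w a * (Y k * T a * V b))) -
         r * (r' * (sol_exponent a * w a * (Y k * T a * V b))) by move=> *; ring.
      rewrite [ord_max == a]eq_sym [ord_max == b]eq_sym [a == b]eq_sym.
      over.
    rewrite sumrB big_split /= !sum_delta.
    over.
  rewrite sumrB big_split /= !sum_delta.
  under [X in _ - X]eq_bigr => a _ do rewrite eq_sym.
  rewrite -mulr_sumr.
  over.
rewrite sumrB /= sum_delta mulr_sumr; congr (_ - _); apply: eq_bigr => k _; ring.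
Qed.

End SolMetric.

Lemma solve2 (R : fieldType) (h0 h1 a0 a1 g00 g01 g10 g11 : R) : g00 * g11 - g10 * g01 != 0 ->
  a0 * g01 + a1 * g11 = - h1 -> a0 * g00 + a1 * g10 = - h0 ->
  a0 = (h1 * g10 - h0 * g11) / (g00 * g11 - g10 * g01) /\
  a1 = (h0 * g01 - h1 * g00) / (g00 * g11 - g10 * g01).
Proof.
move=> D0 e1 e0; have -> : h1 = - (a0 * g01 + a1 * g11) by rewrite e1 opprK.
have -> : h0 = - (a0 * g00 + a1 * g10) by rewrite e0 opprK.
by split; field.
Qed.

(** With trace $2f$ the quantity is $(a-e)^2/2 + 2bd$; multiplying by $g_{00} g_{11} > 0$ allows
    self-adjointness to absorb the product $bd$. *)
Lemma selfadjoint_discr (R : realFieldType) (f a b d e g00 g01 g11 : R) : a + e = 2 * f ->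
  0 < g00 * g11 - g01 * g01 -> a * g01 + b * g11 = d * g00 + e * g01 ->
  0 <= a ^+ 2 + 2 * (b * d) + e ^+ 2 - 2 * f ^+ 2.
Proof.
move=> tr D0 sa.
have P : 0 < g00 * g11 by have := sqr_ge0 g01; rewrite expr2; move: D0; lra.
rewrite -(pmulr_rge0 _ P).
have -> : f = (a + e) / 2 by rewrite tr; field.
(* The first half is nonnegative, and the second is zero because self-adjointness reads $(a-e)
   g_{01} = d g_{00} - b g_{11}$. *)
have E : g00 * g11 * (a ^+ 2 + 2 * (b * d) + e ^+ 2 - 2 * ((a + e) / 2) ^+ 2) =
  2^-1 * ((a - e) ^+ 2 * (g00 * g11 - g01 * g01) + (d * g00 + b * g11) ^+ 2) +
  2^-1 * (((a - e) * g01) ^+ 2 - (d * g00 - b * g11) ^+ 2) by field.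
have E' : (a - e) * g01 = d * g00 - b * g11.
  by apply/eqP; rewrite -subr_eq0; apply/eqP; rewrite -(subrr (a * g01 + b * g11)) [in X in _ = _ - X]sa; ring.
rewrite E E' subrr mulr0 addr0 mulr_ge0 ?invr_ge0 // addr_ge0 ?sqr_ge0 // mulr_ge0 ?sqr_ge0 //.
exact: ltW.
Qed.

Lemma pos_factors (R : realFieldType) (d K : R) : 0 <= d -> 1 <= K * d -> 0 < d /\ 0 < K.
Proof.
move=> d0 h; have dd : 0 < d.
  rewrite lt_neqAle d0 andbT; apply: contraTneq h => <-.
  by rewrite mulr0 -ltNge ltr01.
by split=> //; rewrite -(pmulr_lgt0 _ dd); exact: lt_le_trans h.
Qed.

(** The hypotheses give $m^2 = f^2 - \det A$, so $f \pm m$ are the eigenvalues; the conclusions are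
    the entries of $(A - (f-m))(A - (f+m)) = 0$. *)
Lemma eigenrow_ring (R : realFieldType) (f m a b d e : R) : a + e = 2 * f ->
  m ^+ 2 = (a ^+ 2 + 2 * (b * d) + e ^+ 2 - 2 * f ^+ 2) / 2 ->
  [/\ (a - (f - m) * 1) * a + (b - (f - m) * 0) * d = (f + m) * (a - (f - m) * 1),
      (a - (f - m) * 1) * b + (b - (f - m) * 0) * e = (f + m) * (b - (f - m) * 0),
      (d - (f - m) * 0) * a + (e - (f - m) * 1) * d = (f + m) * (d - (f - m) * 0) &
      (d - (f - m) * 0) * b + (e - (f - m) * 1) * e = (f + m) * (e - (f - m) * 1)].
Proof.
move=> tr; have -> : e = 2 * f - a by rewrite -tr; ring.
rewrite !expr2 => H; split; lra.
Qed.

(** Two left eigenvectors for [l] are parallel once [l] is a simple eigenvalue, that is, once the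
    trace differs from [2 * l]. *)
Lemma collinear_ring (R : comNzRingType) (l a b d e u0 u1 w0 w1 : R) :
  u0 * a + u1 * d = l * u0 -> u0 * b + u1 * e = l * u1 ->
  w0 * a + w1 * d = l * w0 -> w0 * b + w1 * e = l * w1 ->
  (a + e - 2 * l) * (u0 * w1 - u1 * w0) = 0.
Proof.
move=> h1 h2 h3 h4.
transitivity ((u0 * a + u1 * d - l * u0) * w1 - (w0 * a + w1 * d - l * w0) * u1 +
   ((w0 * b + w1 * e - l * w1) * u0 - (u0 * b + u1 * e - l * u1) * w0)); first by ring.
by rewrite h1 h2 h3 h4 !subrr !mul0r subrr addr0.
Qed.

Lemma coframe_metric_ring (R : comNzRingType) (s e0 e1 g00 g01 g11 : R) :
  s ^+ 2 = g00 * g11 - g01 * g01 -> (e0 * g00 + e1 * g01) * e0 + (e0 * g01 + e1 * g11) * e1 = 1 ->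
  [/\ g00 = (e0 * g00 + e1 * g01) * (e0 * g00 + e1 * g01) + - (s * e1) * - (s * e1),
      g01 = (e0 * g00 + e1 * g01) * (e0 * g01 + e1 * g11) + - (s * e1) * (s * e0),
      g01 = (e0 * g01 + e1 * g11) * (e0 * g00 + e1 * g01) + (s * e0) * - (s * e1) &
      g11 = (e0 * g01 + e1 * g11) * (e0 * g01 + e1 * g11) + (s * e0) * (s * e0)].
Proof.
move=> ss h.
have E (t a b c d : R) : t * ((e0 * g00 + e1 * g01) * e0 + (e0 * g01 + e1 * g11) * e1) = a * b + (g00 * g11 - g01 * g01) * (c * d) ->
  t = a * b + (s * c) * (s * d).
  by rewrite h mulr1 -ss => ->; rewrite expr2; ring.
by split; rewrite -?mulrN; apply: E; ring.
Qed.

Lemma normalised_ring (R : fieldType) (s a b g00 g01 g10 g11 : R) : s != 0 ->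
  s ^+ 2 = (a * g00 + b * g10) * a + (a * g01 + b * g11) * b ->
  (a / s * g00 + b / s * g10) * (a / s) + (a / s * g01 + b / s * g11) * (b / s) = 1.
Proof.
move=> s0 ss.
transitivity (((a * g00 + b * g10) * a + (a * g01 + b * g11) * b) / s ^+ 2); first by field.
by rewrite -ss divff // expf_neq0.
Qed.

Lemma jacobianE (R : realType) n m (f : 'rV[R]_n -> 'rV[R]_m) x i j : differentiable f x ->
  'J f x i j = partial i (fun y => f y 0 j) x.
Proof.
move=> df; rewrite -partial_coord // /jacobian /lin1_mx mxE /partial.
by rewrite deriveE.
Qed.

Lemma normal_orth_sum (R : realFieldType) (s w t n d : 'I_3 -> R) :
  \sum_k (2 * s k * t ord_max * w k * (n k * n k) + w k * (d k * n k + n k * d k)) = 0 ->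
  \sum_k w k * (d k * n k) + \sum_k s k * w k * (t ord_max * n k * n k + t k * n k * n ord_max) -
  n ord_max * (\sum_k s k * w k * t k * n k) = 0.
Proof.
move=> h; transitivity (2^-1 * 0 : R); last by rewrite mulr0.
by rewrite -[X in _ = _ * X]h !big_ord_recl !big_ord0; field.
Qed.

Lemma second_form_sum (R : comNzRingType) (s w ti tj n S S' : 'I_3 -> R) :
  (forall k, S k = S' k) ->
  - (\sum_k (2 * s k * ti ord_max * w k * (tj k * n k) + w k * (S k * n k))) +
  \sum_k s k * w k * (ti ord_max * tj k * n k + ti k * tj k * n ord_max) -
  tj ord_max * (\sum_k s k * w k * ti k * n k) =
  - (\sum_k (2 * s k * tj ord_max * w k * (ti k * n k) + w k * (S' k * n k))) +
  \sum_k s k * w k * (tj ord_max * ti k * n k + tj k * ti k * n ord_max) -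
  ti ord_max * (\sum_k s k * w k * tj k * n k).
Proof. by move=> SS; rewrite !big_ord_recl !big_ord0 !SS; ring. Qed.

Lemma quad_form2 (R : comNzRingType) (u : 'rV[R]_2) (G : 'M[R]_2) : (u *m G *m u^T) 0 0 =
   (u 0 0 * G 0 0 + u 0 1 * G 1 0) * u 0 0 + (u 0 0 * G 0 1 + u 0 1 * G 1 1) * u 0 1.
Proof. by rewrite mxE sum_ord2 !mxE !sum_ord2. Qed.

(** * The second fundamental form and the principal coframe in one chart *)

Section ChartGeometry.
Variables (R : realType) (M : topologicalType) (phi xi : M -> 'rV[R]_3) (c : chart R M).

Local Notation T := (tangent_frame phi c).
Local Notation N := (nabla_normal phi xi c).
Local Notation g := (induced_metric phi c).
Local Notation A := (shape_operator phi xi c).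
Local Notation pos x := (phi (param c x)).
Local Notation nor x := (xi (param c x)).

Hypothesis smooth_phi : smooth_on (target c) (phi \o param c).
Hypothesis smooth_xi : smooth_on (target c) (xi \o param c).
Hypothesis immersion : forall x, target c x -> row_free (T x).
Hypothesis unit_xi : forall p, xi p *m sol_metric (phi p) *m (xi p)^T = 1%:M.
Hypothesis normal_xi : forall x, target c x -> T x *m sol_metric (pos x) *m (nor x)^T = 0.

Let oc : open (target c) := @target_open _ _ c.

Lemma ck_pos k a : ck k (target c) (fun x => pos x 0 a).
Proof. exact: smooth_on_ck oc smooth_phi. Qed.

Lemma ck_nor k a : ck k (target c) (fun x => nor x 0 a).
Proof. exact: smooth_on_ck oc smooth_xi. Qed.

Lemma tangentE x i a : target c x -> T x i a = partial i (fun y => pos y 0 a) x.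
Proof. by move=> tx; rewrite /tangent_frame jacobianE //; exact: (smooth_phi [::]). Qed.

Lemma ck_tangent k i a : ck k (target c) (fun x => T x i a).
Proof. by apply: (ck_ext oc _ (ck_partial i (ck_pos k.+1 a))) => x tx; rewrite tangentE. Qed.

Lemma ck_weight k a : ck k (target c) (fun x => sol_weight a (pos x)).
Proof. by apply: (ck_exp oc); apply: (ckZ oc); exact: ck_pos. Qed.

Lemma partial_weight i a x : target c x ->
  partial i (fun y => sol_weight a (pos y)) x = 2 * sol_exponent R a * T x i ord_max * sol_weight a (pos x).
Proof.
move=> tx; have d := ck_diff (ck_pos 1 ord_max) tx.
rewrite partial_exp ?partialZ // -?tangentE //; last exact: ck_diff (ckZ oc _ (ck_pos 1 ord_max)) tx.
by rewrite /sol_weight mulrC.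
Qed.

Lemma partial_inner i (X Y : 'I_3 -> 'rV[R]_2 -> R) x : target c x ->
  (forall k, differentiable (X k) x) -> (forall k, differentiable (Y k) x) ->
  partial i (fun y => \sum_k sol_weight k (pos y) * (X k y * Y k y)) x =
  \sum_k (2 * sol_exponent R k * T x i ord_max * sol_weight k (pos x) * (X k x * Y k x) +
          sol_weight k (pos x) * (partial i (X k) x * Y k x + X k x * partial i (Y k) x)).
Proof.
move=> tx dX dY; have dw k := ck_diff (ck_weight 1 k) tx.
rewrite partial_sum; last by move=> k; apply: differentiableM => //; exact: differentiableM.
apply: eq_bigr => k _; rewrite partialM //; last exact: differentiableM.
by rewrite partialM // partial_weight.
Qed.

Lemma partial_near0 i (f : 'rV[R]_2 -> R) a x : target c x -> (forall y, target c y -> f y = a) -> partial i f x = 0.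
Proof.
move=> tx f0; rewrite -(congr1 (fun h => h x) (@partial_cst R 2 i a)); apply: partial_near.
by apply: filterS (open_nbhs_nbhs (conj oc tx)).
Qed.

Lemma nablaE x i k : target c x -> N x i k = partial i (fun y => nor y 0 k) x +
  \sum_a \sum_b christoffel (@sol_metric R) k a b (pos x) * T x i a * nor x 0 b.
Proof.
move=> tx; rewrite /nabla_normal; have := jacobianE i k (smooth_xi [::] tx).
by move: ('J _ x) => J <-; rewrite mxE; congr (_ + _); rewrite mxE.
Qed.

Lemma nabla_inner i (Y : 'I_3 -> R) x : target c x ->
  \sum_k sol_weight k (pos x) * (N x i k * Y k) =
  \sum_k sol_weight k (pos x) * (partial i (fun y => nor y 0 k) x * Y k) +
  \sum_k sol_exponent R k * sol_weight k (pos x) *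
     (T x i ord_max * Y k * nor x 0 k + T x i k * Y k * nor x 0 ord_max) -
  Y ord_max * \sum_k sol_exponent R k * sol_weight k (pos x) * T x i k * nor x 0 k.
Proof.
move=> tx; rewrite -addrA -sol_connection_form // -big_split; apply: eq_bigr => k _ /=.
rewrite nablaE // mulrDl mulrDr; congr (_ + _ * _); exact: mulrC.
Qed.

(** Differentiating $\langle \xi, \xi \rangle = 1$ with a metric connection. *)
Lemma nabla_normal_orth x i : target c x -> \sum_k sol_weight k (pos x) * (N x i k * nor x 0 k) = 0.
Proof.
move=> tx; rewrite nabla_inner //.
have d k := ck_diff (ck_nor 1 k) tx.
have : partial i (fun y => \sum_k sol_weight k (pos y) * (nor y 0 k * nor y 0 k)) x = 0.
  by apply: (@partial_near0 _ _ 1) => // y ty; rewrite -sol_metric_form unit_xi mxE.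
rewrite (@partial_inner _ (fun k y => nor y 0 k) (fun k y => nor y 0 k)) // => h.
by apply: normal_orth_sum h.
Qed.

Lemma partial_tangent_orth x i j : target c x ->
  \sum_k sol_weight k (pos x) * (partial i (fun y => nor y 0 k) x * T x j k) =
  - \sum_k (2 * sol_exponent R k * T x i ord_max * sol_weight k (pos x) * (T x j k * nor x 0 k) +
           sol_weight k (pos x) * (partial i (partial j (fun y => pos y 0 k)) x * nor x 0 k)).
Proof.
move=> tx; have d k := ck_diff (ck_nor 1 k) tx; have d' k := ck_diff (ck_tangent 1 j k) tx.
have : partial i (fun y => \sum_k sol_weight k (pos y) * (T y j k * nor y 0 k)) x = 0.
  by apply: (@partial_near0 _ _ 0) => // y ty; rewrite -sol_metric_form normal_xi // mxE.
rewrite (@partial_inner _ (fun k y => T y j k) (fun k y => nor y 0 k)) // => h.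
apply/eqP; rewrite -subr_eq0 opprK -big_split /= -[X in _ == X]h; apply/eqP; apply: eq_bigr => k _.
have -> : partial i (partial j (fun y => pos y 0 k)) x = partial i (fun y => T y j k) x.
  by apply: partial_near; apply: filterS (open_nbhs_nbhs (conj oc tx)) => y ty; rewrite tangentE.
ring.
Qed.

(** This is $\langle \bar\nabla_i \xi, \partial_j \phi \rangle$, the opposite of the usual second
    fundamental form. *)
Definition second_form x i j := \sum_k sol_weight k (pos x) * (N x i k * T x j k).

(** Differentiating $\langle \partial_j \phi, \xi \rangle = 0$ moves the derivative onto [phi],
    where second partial derivatives commute; the Christoffel terms are symmetric too. *)
Lemma second_formC x i j : target c x -> second_form x i j = second_form x j i.
Proof.
move=> tx; rewrite /second_form (nabla_inner i (fun k => T x j k) tx) (nabla_inner j (fun k => T x i k) tx).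
rewrite (partial_tangent_orth i j tx) (partial_tangent_orth j i tx).
apply: (second_form_sum (sol_exponent R) (fun k => sol_weight k (pos x)) (T x i) (T x j) (fun k => nor x 0 k)
  (S := fun k => partial i (partial j (fun y => pos y 0 k)) x) (S' := fun k => partial j (partial i (fun y => pos y 0 k)) x)).
by move=> k; exact: partial_partialC oc tx (ck_pos 2 k).
Qed.

Lemma ck_second_form k i j : ck k (target c) (fun x => second_form x i j).
Proof.
have H := fun x (tx : target c x) => esym (@nabla_inner i (fun k => T x j k) x tx).
apply: (ck_ext oc H).
apply: (ckB oc); first apply: (ckD oc).
- by apply: (ck_sum oc) => a; exact: (ckM oc (ck_weight k a) (ckM oc (ck_partial i (ck_nor k.+1 a)) (ck_tangent k j a))).
- apply: (ck_sum oc) => a; apply: (ckM oc); first exact: (ckZ oc _ (ck_weight k a)).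
  apply: (ckD oc).
    exact: (ckM oc (ckM oc (ck_tangent k i ord_max) (ck_tangent k j a)) (ck_nor k a)).
  exact: (ckM oc (ckM oc (ck_tangent k i a) (ck_tangent k j a)) (ck_nor k ord_max)).
- apply: (ckM oc (ck_tangent k j ord_max)); apply: (ck_sum oc) => a.
  exact: (ckM oc (ckM oc (ckZ oc _ (ck_weight k a)) (ck_tangent k i a)) (ck_nor k a)).
Qed.

Lemma metricE x i j : g x i j = \sum_k sol_weight k (pos x) * (T x i k * T x j k).
Proof. exact: sol_metric_form. Qed.

Lemma metricC x i j : g x i j = g x j i.
Proof. by rewrite !metricE; apply: eq_bigr => k _; rewrite [T x i k * _]mulrC. Qed.

Lemma ck_metric k i j : ck k (target c) (fun x => g x i j).
Proof.
have E : (fun x => g x i j) = fun x => \sum_k sol_weight k (pos x) * (T x i k * T x j k).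
  by apply/funext => x; exact: metricE.
rewrite E; apply: (ck_sum oc) => a.
exact: (ckM oc (ck_weight k a) (ckM oc (ck_tangent k i a) (ck_tangent k j a))).
Qed.

Lemma metric_pos x (v : 'rV[R]_2) : target c x -> v != 0 -> 0 < (v *m g x *m v^T) 0 0.
Proof.
move=> tx v0; have -> : v *m g x *m v^T = (v *m T x) *m sol_metric (pos x) *m (v *m T x)^T.
  by rewrite trmx_mul /induced_metric !mulmxA.
rewrite sol_metric_form lt_neqAle.
have w0 k : 0 <= sol_weight k (pos x) * ((v *m T x) 0 k * (v *m T x) 0 k).
  by apply: mulr_ge0; [exact/ltW/sol_weight_gt0|rewrite -expr2; exact: sqr_ge0].
apply/andP; split; last first.
  by apply: sumr_ge0 => k _; exact: w0.
apply: contra_neq v0 => /esym/eqP; rewrite psumr_eq0; last first.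
  by move=> k _; exact: w0.
move=> /allP h; apply: (row_free_inj (immersion tx)); rewrite mul0mx.
apply/matrixP => i k; rewrite ord1 [RHS]mxE; have := h k (mem_index_enum _).
by rewrite mulf_eq0 gt_eqF ?sol_weight_gt0 //= mulf_eq0 orbb => /eqP.
Qed.

Lemma metric_det_gt0 x : target c x -> 0 < \det (g x).
Proof.
move=> tx; pose v : 'rV[R]_2 := rv (- g x 0 1) (g x 0 0); pose e : 'rV[R]_2 := rv 1 0.
have F u := quad_form2 u (g x).
have e0 : e != 0 by apply/eqP => /matrixP/(_ 0 0); rewrite /e rv0 mxE => /eqP; rewrite oner_eq0.
have g00 : 0 < g x 0 0 by have := metric_pos tx e0; rewrite F /e rv0 rv1 !mulr0 !mul0r !addr0 mulr1 mul1r.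
have v0 : v != 0 by apply/eqP => /matrixP/(_ 0 1); rewrite /v rv1 [RHS]mxE => h; rewrite h ltxx in g00.
have := metric_pos tx v0; rewrite F /v rv0 rv1 det2 (metricC x 1 0) => h.
rewrite -(pmulr_rgt0 _ g00).
move: (g x 0 0) (g x 0 1) (g x 1 1) h => a b d h.
by have -> : a * (a * d - b * b) = (- b * a + a * b) * - b + (- b * b + a * d) * a by ring.
Qed.

(** The rows of [N x] are tangent, being orthogonal to the normal, so [pinvmx] recovers their exact
    coefficients. *)
Lemma shape_metric x i j : target c x -> (A x *m g x) i j = - second_form x i j.
Proof.
move=> tx; have gu : g x \in unitmx by rewrite unitmxE unitfE gt_eqF // metric_det_gt0.
pose S := N x *m sol_metric (pos x) *m (T x)^T *m invmx (g x).
pose P : 'M[R]_(2 + 1, 3) := col_mx (T x) (nor x).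
(* The part of [N x] left after orthogonal projection to the tangent plane. It is orthogonal to all
   rows of the invertible matrix [P], hence zero. *)
pose Z := N x - S *m T x.
have ZT : Z *m sol_metric (pos x) *m (T x)^T = 0.
  rewrite !mulmxBl; apply/eqP; rewrite subr_eq0; apply/eqP.
  rewrite -(mulmxA S (T x)) -(mulmxA S) -[T x *m _ *m _]/(g x) /S mulmxKV //.
have Zn : Z *m sol_metric (pos x) *m (nor x)^T = 0.
  rewrite !mulmxBl -(mulmxA S (T x)) -(mulmxA S) normal_xi // mulmx0 subr0.
  apply/matrixP => k l; rewrite ord1 sol_metric_form mxE; exact: nabla_normal_orth.
have PP : P *m sol_metric (pos x) *m P^T = block_mx (g x) 0 0 1%:M.
  rewrite tr_col_mx mul_col_mx mul_col_row normal_xi // unit_xi; congr (block_mx _ _ _ _).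
  have /(congr1 trmx) := normal_xi tx; rewrite !trmx_mul trmxK trmx0 mulmxA.
  by rewrite sol_metric_diag tr_diag_mx.
have [Pu Su] : ((P : 'M[R]_3) \in unitmx) /\ (sol_metric (pos x) \in unitmx).
  have : \det (P *m sol_metric (pos x) *m P^T) != 0.
    by rewrite PP (@det_ublock _ 2 1) det1 mulr1 gt_eqF // metric_det_gt0.
  by rewrite !det_mulmx !mulf_eq0 !negb_or !unitmxE !unitfE => /andP[/andP[]].
have Z0 : Z = 0.
  have : Z *m sol_metric (pos x) *m P^T = 0 by rewrite tr_col_mx mul_mx_row ZT Zn row_mx0.
  move=> h; have : Z *m sol_metric (pos x) = 0.
    have PTu : (P^T : 'M[R]_3) \in unitmx by rewrite unitmx_tr.
    by rewrite -[LHS](mulmxK PTu) h mul0mx.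
  by move=> h'; rewrite -[LHS](mulmxK Su) h' mul0mx.
have NE : N x = S *m T x by apply/eqP; rewrite -subr_eq0; apply/eqP.
rewrite /shape_operator mulNmx NE mulmxKp; last exact: immersion.
by rewrite mulNmx mulmxKV // mxE sol_metric_form.
Qed.

(** Regularity of [A] cannot be read off [pinvmx]; Cramer's rule expresses its entries through
    functions already known to be smooth. *)
Lemma shapeE x i : target c x ->
  A x i 0 = (second_form x i 1 * g x 1 0 - second_form x i 0 * g x 1 1) / \det (g x) /\
  A x i 1 = (second_form x i 0 * g x 0 1 - second_form x i 1 * g x 0 0) / \det (g x).
Proof.
move=> tx; have D0 : \det (g x) != 0 by rewrite gt_eqF // metric_det_gt0.
have := shape_metric i 0 tx; have := shape_metric i 1 tx.
move: D0; move: (A x) (g x) => B G; rewrite det2 !mxE !sum_ord2.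
move: (second_form x i 0) (second_form x i 1) (B i 0) (B i 1) (G 0 0) (G 0 1) (G 1 0) (G 1 1).
exact: solve2.
Qed.

Lemma ck_metric_det k : ck k (target c) (fun x => \det (g x)).
Proof.
have E : (fun x => \det (g x)) = fun x => g x 0 0 * g x 1 1 - g x 1 0 * g x 0 1.
  by apply/funext => x; rewrite det2.
by rewrite E; exact: (ckB oc (ckM oc (ck_metric k 0 0) (ck_metric k 1 1)) (ckM oc (ck_metric k 1 0) (ck_metric k 0 1))).
Qed.

Lemma ck_shape k i j : ck k (target c) (fun x => A x i j).
Proof.
have D0 x : target c x -> \det (g x) != 0 by move=> tx; rewrite gt_eqF // metric_det_gt0.
have cV := ckV oc D0 (ck_metric_det k).
have ch := ck_second_form k i; have cg := ck_metric k.
move: j; apply: ord2P.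
  apply: (ck_ext oc _ (ckM oc (ckB oc (ckM oc (ch 1) (cg 1 0)) (ckM oc (ch 0) (cg 1 1))) cV)) => x tx.
  by rewrite (shapeE i tx).1.
apply: (ck_ext oc _ (ckM oc (ckB oc (ckM oc (ch 0) (cg 0 1)) (ckM oc (ch 1) (cg 0 0))) cV)) => x tx.
by rewrite (shapeE i tx).2.
Qed.

Lemma shape_selfadjoint x : target c x -> A x 0 0 * g x 0 1 + A x 0 1 * g x 1 1 = A x 1 0 * g x 0 0 + A x 1 1 * g x 1 0.
Proof.
move=> tx; have := shape_metric 0 1 tx; rewrite second_formC // -shape_metric //.
by move: (A x) (g x) => B G; rewrite !mxE !sum_ord2.
Qed.

Variable f : R.
Hypothesis mean : forall x, target c x -> \tr (A x) = 2 * f.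

Definition discr x := \tr (A x *m A x) - 2 * f ^+ 2.

Hypothesis pinch : forall x, target c x -> 1 <= gauss_curvature_of_metric g x * discr x.

Lemma trace2 (B : 'M[R]_2) : \tr B = B 0 0 + B 1 1.
Proof. by rewrite /mxtrace sum_ord2. Qed.

Lemma discrE x : discr x = A x 0 0 ^+ 2 + 2 * (A x 0 1 * A x 1 0) + A x 1 1 ^+ 2 - 2 * f ^+ 2.
Proof.
rewrite /discr; move: (A x) => B; rewrite trace2 !mxE !sum_ord2.
by rewrite !expr2; move: (B 0 0) (B 0 1) (B 1 0) (B 1 1) => *; ring.
Qed.

Lemma discr_ge0 x : target c x -> 0 <= discr x.
Proof.
move=> tx; rewrite discrE.
have := mean tx; rewrite trace2 => tr; have := shape_selfadjoint tx.
have := metric_det_gt0 tx; rewrite det2 (metricC x 1 0).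
move: tr; move: (A x 0 0) (A x 0 1) (A x 1 0) (A x 1 1) (g x 0 0) (g x 0 1) (g x 1 1).
exact: selfadjoint_discr.
Qed.

Lemma pinch_pos x : target c x -> 0 < discr x /\ 0 < gauss_curvature_of_metric g x.
Proof.
move=> tx; have := pinch tx; have := discr_ge0 tx; move: (discr x) (gauss_curvature_of_metric _ _) => d K.
exact: pos_factors.
Qed.

(** Half the difference of the principal curvatures: its square is $f^2 - \det A$. *)
Definition gap x := Num.sqrt (discr x / 2).

Lemma ck_discr k : ck k (target c) discr.
Proof.
have a := ck_shape k.
apply: (ck_ext oc _ (ckB oc (ckD oc (ckD oc (ckM oc (a 0 0) (a 0 0)) (ckZ oc 2 (ckM oc (a 0 1) (a 1 0)))) (ckM oc (a 1 1) (a 1 1))) (ck_cst k _ (2 * f ^+ 2)))) => x tx.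
by rewrite discrE !expr2.
Qed.

Lemma gap_gt0 x : target c x -> 0 < gap x.
Proof. by move=> tx; rewrite sqrtr_gt0 divr_gt0 // (pinch_pos tx).1. Qed.

Lemma gap_sqr x : target c x -> gap x ^+ 2 = discr x / 2.
Proof. by move=> tx; rewrite sqr_sqrtr // divr_ge0 // discr_ge0. Qed.

Lemma ck_gap k : ck k (target c) gap.
Proof.
apply: (ck_sqrt oc) => [x tx|]; first by rewrite divr_gt0 // (pinch_pos tx).1.
exact: (ckM oc (ck_discr k) (ck_cst k _ (2^-1))).
Qed.

(* By Cayley-Hamilton, the rows of [A - (f - gap)] are left eigenvectors of [A] for [f + gap]. *)
Definition eig (r j : 'I_2) x := A x r j - (f - gap x) * (r == j)%:R.

Lemma eigP r j x : target c x -> eig r 0 x * A x 0 j + eig r 1 x * A x 1 j = (f + gap x) * eig r j x.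
Proof.
move=> tx; rewrite /eig; have := gap_sqr tx; rewrite discrE.
have := mean tx; rewrite trace2 => tr sq; have [e00 e01 e10 e11] := eigenrow_ring tr sq.
by move: r j; apply: ord2P; apply: ord2P.
Qed.

Lemma ck_eig k r j : ck k (target c) (eig r j).
Proof.
exact: (ckB oc (ck_shape k r j) (ckM oc (ckB oc (ck_cst k _ f) (ck_gap k)) (ck_cst k _ (r == j)%:R))).
Qed.

(** The trace of $A - (f - gap)$ is $2\, gap > 0$, so one of its diagonal entries is nonzero. *)
Lemma eig_neq0 x : target c x -> exists r j, eig r j x != 0.
Proof.
move=> tx; have := gap_gt0 tx; have := mean tx; rewrite trace2 => tr m0.
have [e0|] := eqVneq (eig 0 0 x) 0; last by exists 0, 0.
exists 1, 1; apply: contraTneq m0 => e1.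
have : gap x = (eig 0 0 x + eig 1 1 x - (A x 0 0 + A x 1 1 - 2 * f)) / 2 by rewrite /eig /=; field.
by rewrite e0 e1 tr subrr !addr0 subr0 mul0r => ->; rewrite ltxx.
Qed.

Definition eig_norm2 r x :=
  (eig r 0 x * g x 0 0 + eig r 1 x * g x 1 0) * eig r 0 x + (eig r 0 x * g x 0 1 + eig r 1 x * g x 1 1) * eig r 1 x.

(** Where row [r] can be normalised; the two such open sets cover the target by [eig_neq0]. *)
Definition eig_dom r := [set x | target c x /\ 0 < eig_norm2 r x].

Lemma eig_norm2_gt0 r j x : target c x -> eig r j x != 0 -> 0 < eig_norm2 r x.
Proof.
move=> tx e0; have v0 : rv (eig r 0 x) (eig r 1 x) != 0.
  apply: contra_neq e0 => v0; move: (congr1 (fun v : 'rV[R]_2 => v 0 j) v0); rewrite [RHS]mxE => <-.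
  by move: j; apply: ord2P; rewrite ?rv0 ?rv1.
by have := metric_pos tx v0; rewrite quad_form2 rv0 rv1.
Qed.

Lemma ck_eig_norm2 k r : ck k (target c) (eig_norm2 r).
Proof.
have ce := ck_eig k r; have cg := ck_metric k.
exact: (ckD oc (ckM oc (ckD oc (ckM oc (ce 0) (cg 0 0)) (ckM oc (ce 1) (cg 1 0))) (ce 0))
               (ckM oc (ckD oc (ckM oc (ce 0) (cg 0 1)) (ckM oc (ce 1) (cg 1 1))) (ce 1))).
Qed.

Lemma open_eig_dom r : open (eig_dom r).
Proof.
rewrite openE => x [tx nx]; apply: filterI; first exact: open_nbhs_nbhs.
have cx := ck_cont (ck_eig_norm2 0 r) tx.
by apply: (cx [set t : R | 0 < t]); apply: open_nbhs_nbhs; split; [exact: open_gt|exact: nx].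
Qed.

Definition unit_eig r j x := eig r j x / Num.sqrt (eig_norm2 r x).

Definition coframe1 r j x := unit_eig r 0 x * g x 0 j + unit_eig r 1 x * g x 1 j.

(** The area form of the coordinate orientation contracted with the unit field, which forces the
    coframe determinant to be the positive root of [\det g]. *)
Definition coframe2 r (j : 'I_2) x :=
  if j == 0 then - (Num.sqrt (\det (g x)) * unit_eig r 1 x) else Num.sqrt (\det (g x)) * unit_eig r 0 x.

Lemma ck_unit_eig k r j : ck k (eig_dom r) (unit_eig r j).
Proof.
have sub : eig_dom r `<=` target c by move=> x [].
have oe := @open_eig_dom r.
have c1 := ck_sqrt oe (fun x (H : eig_dom r x) => H.2) (ck_sub sub (ck_eig_norm2 k r)).
have n0 x : eig_dom r x -> Num.sqrt (eig_norm2 r x) != 0 by move=> [_ h]; rewrite gt_eqF // sqrtr_gt0.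
exact: (ckM oe (ck_sub sub (ck_eig k r j)) (ckV oe n0 c1)).
Qed.

Lemma ck_coframe1 k r j : ck k (eig_dom r) (coframe1 r j).
Proof.
have sub : eig_dom r `<=` target c by move=> x [].
have oe := @open_eig_dom r; have cg i := ck_sub sub (ck_metric k i j).
exact: (ckD oe (ckM oe (ck_unit_eig k r 0) (cg 0)) (ckM oe (ck_unit_eig k r 1) (cg 1))).
Qed.

Lemma ck_coframe2 k r j : ck k (eig_dom r) (coframe2 r j).
Proof.
have sub : eig_dom r `<=` target c by move=> x [].
have oe := @open_eig_dom r.
have cs := ck_sub sub (ck_sqrt oc metric_det_gt0 (ck_metric_det k)).
have ce i := ckM oe cs (ck_unit_eig k r i).
by rewrite /coframe2; move: j; apply: ord2P => /=; [exact: (ckN oe (ce 1))|exact: ce 0].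
Qed.

Lemma unit_eig_norm r x : eig_dom r x ->
  coframe1 r 0 x * unit_eig r 0 x + coframe1 r 1 x * unit_eig r 1 x = 1.
Proof.
move=> [tx n0]; apply: normalised_ring; last exact: sqr_sqrtr (ltW n0).
by rewrite gt_eqF // sqrtr_gt0.
Qed.

Lemma coframe_detE r x : eig_dom r x -> coframe_det (coframe1 r) (coframe2 r) x = Num.sqrt (\det (g x)).
Proof.
move=> ex; rewrite -[RHS]mulr1 -(unit_eig_norm ex) /coframe_det /coframe2 /=.
by move: (coframe1 r 0 x) (coframe1 r 1 x) (unit_eig r 0 x) (unit_eig r 1 x) (Num.sqrt _) => *; ring.
Qed.

Lemma coframe_det_neq0 r x : eig_dom r x -> coframe_det (coframe1 r) (coframe2 r) x != 0.
Proof.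
move=> ex; rewrite (coframe_detE ex) gt_eqF //; rewrite sqrtr_gt0; exact: metric_det_gt0 ex.1.
Qed.

Lemma coframe_metric r x : eig_dom r x -> forall i j,
  g x i j = coframe1 r i x * coframe1 r j x + coframe2 r i x * coframe2 r j x.
Proof.
move=> ex; have := unit_eig_norm ex.
have : Num.sqrt (\det (g x)) ^+ 2 = g x 0 0 * g x 1 1 - g x 0 1 * g x 0 1.
  by rewrite (sqr_sqrtr (ltW (metric_det_gt0 ex.1))) det2 (metricC x 1 0).
rewrite /coframe2 /coframe1 (metricC x 1 0).
move: (unit_eig r 0 x) (unit_eig r 1 x) (Num.sqrt (\det (g x))) (g x) (metricC x 1 0) => e0 e1 s G Gs ss en.
have [h1 h2 h3 h4] := coframe_metric_ring ss en.
by apply: ord2P; apply: ord2P; rewrite /= ?Gs.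
Qed.

Lemma curl_connection_gt0 r x : eig_dom r x -> 0 < curl (connection_form (coframe1 r) (coframe2 r)) x.
Proof.
move=> ex; have [tx _] := ex; have s0 : 0 < Num.sqrt (\det (g x)) by rewrite sqrtr_gt0 metric_det_gt0.
have := (pinch_pos tx).2; rewrite (gauss_curvature_coframe (@open_eig_dom r) (ck_coframe1 3 r) (ck_coframe2 3 r) (@coframe_det_neq0 r) (@coframe_metric r) ex).
by rewrite coframe_detE // pmulr_lgt0 // invr_gt0.
Qed.

Lemma ck_connection r j : ck 2 (eig_dom r) (connection_form (coframe1 r) (coframe2 r) j).
Proof.
exact: (ck_connection_form (@open_eig_dom r) (ck_coframe1 3 r) (ck_coframe2 3 r) (@coframe_det_neq0 r)).
Qed.

End ChartGeometry.

(** * Coordinate changes *)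

(** Exterior differentiation commutes with pullback. The sign [s] contributes no derivative, because
    $s^2 = 1$ gives $2 s\, ds = 0$. *)
Lemma curl_pullback (R : realType) (O V : set 'rV[R]_2) (tau : 'rV[R]_2 -> 'rV[R]_2) (s : 'rV[R]_2 -> R)
    (w w' : 'I_2 -> 'rV[R]_2 -> R) x :
  open O -> (forall y, O y -> V (tau y)) -> (forall l, ck 2 O (fun y => tau y 0 l)) ->
  ck 1 O s -> (forall y, O y -> s y ^+ 2 = 1) -> (forall i, ck 1 V (w' i)) ->
  (forall m y, O y -> w m y = s y * (partial m (fun z => tau z 0 0) y * w' 0 (tau y) +
                                     partial m (fun z => tau z 0 1) y * w' 1 (tau y))) ->
  O x -> curl w x = s x * jac tau x * curl w' (tau x).
Proof.
move=> oO tauV ct cs s1 cw' wE Ox.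
have nO : \near x, O x by exact: open_nbhs_nbhs.
have ds := ck_diff cs Ox.
have s0 l : partial l s x = 0.
  have : partial l (fun y => s y * s y) x = 0.
    rewrite -(congr1 (fun h => h x) (@partial_cst R 2 l 1)); apply: partial_near.
    by apply: filterS nO => y Oy; rewrite -expr2 s1.
  rewrite partialM // [s x * _]mulrC -mulr2n => /eqP; rewrite mulrn_eq0 /= mulf_eq0 => /orP[/eqP //|/eqP sx].
  by have := s1 x Ox; rewrite sx expr0n => /esym/eqP; rewrite oner_eq0.
have dt l := ck_diff (ct l) Ox.
have dtau : differentiable tau x by exact: (@ck_differentiable_vec _ 1 _ _ _ ct Ox).
have dp l m : differentiable (partial m (fun z => tau z 0 l)) x by exact: ck_diff (ck_partial m (ct l)) Ox.
have dw l := ck_diff (cw' l) (tauV x Ox).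
have dwt l : differentiable (fun y => w' l (tau y)) x by exact: differentiable_comp.
have E l m : partial l (w m) x = s x * (
    partial l (partial m (fun z => tau z 0 0)) x * w' 0 (tau x) + partial m (fun z => tau z 0 0) x *
      (partial l (fun z => tau z 0 0) x * partial 0 (w' 0) (tau x) + partial l (fun z => tau z 0 1) x * partial 1 (w' 0) (tau x)) +
    (partial l (partial m (fun z => tau z 0 1)) x * w' 1 (tau x) + partial m (fun z => tau z 0 1) x *
      (partial l (fun z => tau z 0 0) x * partial 0 (w' 1) (tau x) + partial l (fun z => tau z 0 1) x * partial 1 (w' 1) (tau x)))).
  transitivity (partial l (fun y => s y * (partial m (fun z => tau z 0 0) y * w' 0 (tau y) +
                                     partial m (fun z => tau z 0 1) y * w' 1 (tau y))) x).
    by apply: partial_near; apply: filterS nO => y; exact: wE.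
  have d0 := differentiableM (dp 0 m) (dwt 0); have d1 := differentiableM (dp 1 m) (dwt 1).
  rewrite (partialM _ ds (differentiableD d0 d1)) s0 mul0r add0r (partialD _ d0 d1).
  rewrite (partialM _ (dp 0 m) (dwt 0)) (partialM _ (dp 1 m) (dwt 1)).
  by rewrite (partial_comp l dtau (dw 0)) (partial_comp l dtau (dw 1)) !sum_ord2.
have S l := partial_partialC 0 1 oO Ox (ct l).
rewrite /curl !E !S /jac.
move: (partial 1 (partial 0 _) x) (partial 1 (partial 0 _) x) => a b.
move: (partial 0 (fun z => tau z 0 0) x) (partial 0 (fun z => tau z 0 1) x) => t00 t01.
move: (partial 1 (fun z => tau z 0 0) x) (partial 1 (fun z => tau z 0 1) x) => t10 t11.
move: (partial 0 (w' 0) _) (partial 0 (w' 1) _) (partial 1 (w' 0) _) (partial 1 (w' 1) _) => w00 w01 w10 w11.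
by move: (w' 0 _) (w' 1 _) (s x) => w0 w1 s'; ring.
Qed.

Lemma connection_change_ring (R : fieldType) (s sp sq J D cp cq p0 p1 q0 q1 t0 t1 : R) :
  sp ^+ 2 = 1 -> sq = sp * s -> s ^+ 2 = 1 -> J != 0 -> D != 0 ->
  - ((sp * J * cp * (sp * (t0 * p0 + t1 * p1)) + sq * J * cq * (sq * (t0 * q0 + t1 * q1))) / (sp * sq * J * D)) =
  s * (t0 * - ((cp * p0 + cq * q0) / D) + t1 * - ((cp * p1 + cq * q1) / D)).
Proof.
move=> sp1 -> s1 J0 D0.
have s0 : s != 0 by apply: contra_eq_neq s1 => ->; rewrite expr0n eq_sym oner_eq0.
have sp0 : sp != 0 by apply: contra_eq_neq sp1 => ->; rewrite expr0n eq_sym oner_eq0.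
have -> : sp * J * cp * (sp * (t0 * p0 + t1 * p1)) + sp * s * J * cq * (sp * s * (t0 * q0 + t1 * q1)) =
  sp ^+ 2 * (J * cp * (t0 * p0 + t1 * p1) + s ^+ 2 * (J * cq * (t0 * q0 + t1 * q1))) by ring.
have -> : sp * (sp * s) * J * D = sp ^+ 2 * (s * J * D) by ring.
rewrite sp1 s1 !mul1r.
have {1}-> : s = s^-1 by apply: (mulfI s0); rewrite -expr2 s1 divff.
by field; rewrite s0 J0 D0.
Qed.

Lemma jac_pullback_ring (R : comNzRingType) (sp sq p0 p1 q0 q1 t00 t01 t10 t11 : R) :
  sp * (t00 * p0 + t01 * p1) * (sq * (t10 * q0 + t11 * q1)) - sp * (t10 * p0 + t11 * p1) * (sq * (t00 * q0 + t01 * q1)) =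
  sp * sq * (t00 * t11 - t10 * t01) * (p0 * q1 - p1 * q0).
Proof. ring. Qed.

(* The unknown sign [sp] of the frame drops out: [sp ^+ 2 = 1] makes its derivatives vanish. *)
Lemma connection_form_change (R : realType) (O V : set 'rV[R]_2) (tau : 'rV[R]_2 -> 'rV[R]_2)
    (s sp : 'rV[R]_2 -> R) (p q p' q' : 'I_2 -> 'rV[R]_2 -> R) m x :
  open O -> (forall y, O y -> V (tau y)) -> (forall l, ck 2 O (fun y => tau y 0 l)) ->
  ck 1 O s -> (forall y, O y -> s y ^+ 2 = 1) -> ck 1 O sp -> (forall y, O y -> sp y ^+ 2 = 1) ->
  (forall i, ck 1 V (p' i)) -> (forall i, ck 1 V (q' i)) ->
  (forall m y, O y -> p m y = sp y * (partial m (fun z => tau z 0 0) y * p' 0 (tau y) +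
                                     partial m (fun z => tau z 0 1) y * p' 1 (tau y))) ->
  (forall m y, O y -> q m y = sp y * s y * (partial m (fun z => tau z 0 0) y * q' 0 (tau y) +
                                     partial m (fun z => tau z 0 1) y * q' 1 (tau y))) ->
  O x -> jac tau x != 0 -> coframe_det p' q' (tau x) != 0 ->
  connection_form p q m x = s x * (partial m (fun z => tau z 0 0) x * connection_form p' q' 0 (tau x) +
    partial m (fun z => tau z 0 1) x * connection_form p' q' 1 (tau x)).
Proof.
move=> oO tauV ct cs s1 cp sp1 cp' cq' pE qE Ox J0 D0.
have sq1 y : O y -> (sp y * s y) ^+ 2 = 1 by move=> Oy; rewrite exprMn s1 // sp1 // mulr1.
rewrite /connection_form (curl_pullback oO tauV ct cp sp1 cp' pE Ox).
rewrite (curl_pullback oO tauV ct (ckM oO cp cs) sq1 cq' qE Ox).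
have -> : coframe_det p q x = sp x * (sp x * s x) * jac tau x * coframe_det p' q' (tau x).
  by rewrite /coframe_det !pE // !qE // jac_pullback_ring.
rewrite pE // qE //.
exact: (connection_change_ring _ _ _ _ _ _ _ _ (sp1 x Ox) erefl (s1 x Ox) J0 D0).
Qed.

(* With [D] the Jacobian of the coordinate change, [e D] is the image of the frame vector [e], and
   [p = e g], [q = sqrt (det g) (- e1, e0)] on both sides. *)
Lemma coframe_change_ring (R : realFieldType) (r r' sg e0 e1 w0 w1 d00 d01 d10 d11 g00 g01 g11 : R) :
  let u0 := e0 * d00 + e1 * d10 in let u1 := e0 * d01 + e1 * d11 in
  let p0 := w0 * g00 + w1 * g01 in let p1 := w0 * g01 + w1 * g11 in
  let s := u0 * p0 + u1 * p1 in
  u0 * w1 = u1 * w0 -> p0 * w0 + p1 * w1 = 1 ->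
  (u0 * g00 + u1 * g01) * u0 + (u0 * g01 + u1 * g11) * u1 = 1 ->
  r = sg * (d00 * d11 - d10 * d01) * r' ->
  [/\ s ^+ 2 = 1,
      u0 * g00 + u1 * g01 = s * p0, u0 * g01 + u1 * g11 = s * p1,
      - (r * e1) = s * sg * (d00 * - (r' * w1) + d01 * (r' * w0)) &
      r * e0 = s * sg * (d10 * - (r' * w1) + d11 * (r' * w0))].
Proof.
move=> u0 u1 p0 p1 s col n1 n2 rE.
have E0 : u0 = s * w0.
  by rewrite -[LHS]mulr1 -n1 mulrDr [u0 * (p1 * w1)]mulrCA col /s; ring.
have E1 : u1 = s * w1.
  by rewrite -[LHS]mulr1 -n1 mulrDr [u1 * (p0 * w0)]mulrCA -col /s; ring.
have s2 : s ^+ 2 = 1.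
  by rewrite -[RHS]n2 -[LHS]mulr1 -[in LHS]n1 /p0 /p1 E0 E1; ring.
split=> //; try by rewrite E0 E1 /p0 /p1; ring.
- have -> : s * sg * (d00 * - (r' * w1) + d01 * (r' * w0)) = sg * r' * (d01 * (s * w0) - d00 * (s * w1)) by ring.
  by rewrite -E0 -E1 rE /u0 /u1; ring.
- have -> : s * sg * (d10 * - (r' * w1) + d11 * (r' * w0)) = sg * r' * (d11 * (s * w0) - d10 * (s * w1)) by ring.
  by rewrite -E0 -E1 rE /u0 /u1; ring.
Qed.

Lemma trace_sqr_similar (R : comUnitRingType) n (J A B : 'M[R]_n) : J \in unitmx -> A *m J = J *m B ->
  \tr (A *m A) = \tr (B *m B).
Proof.
move=> Ju E; have -> : A = J *m B *m invmx J by rewrite -E mulmxK.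
by rewrite mxtrace_mulC !mulmxA mulmxKV // mxtrace_mulC !mulmxA mulVmx // mul1mx.
Qed.

Lemma congruence2 (R : comNzRingType) (J G : 'M[R]_2) i j : (J *m G *m J^T) i j =
  (J i 0 * G 0 0 + J i 1 * G 1 0) * J j 0 + (J i 0 * G 0 1 + J i 1 * G 1 1) * J j 1.
Proof. by rewrite mxE sum_ord2 !mxE !sum_ord2. Qed.

(** Pushing the eigenvector [v] of [A] forward by [J] gives an eigenvector of [B] for the same
    eigenvalue; it is simple since $m' > 0$, so the result is parallel to [v']. The scalars [t] and
    [t'] stand for the norms. *)
Lemma collinear_change (R : realType) (f m m' t t' : R) (v v' : 'I_2 -> R) (A B J : 'M[R]_2) :
  (forall k, v 0 * A 0 k + v 1 * A 1 k = (f + m) * v k) ->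
  (forall k, v' 0 * B 0 k + v' 1 * B 1 k = (f + m') * v' k) ->
  (forall i k, A i 0 * J 0 k + A i 1 * J 1 k = J i 0 * B 0 k + J i 1 * B 1 k) ->
  \tr B = 2 * f -> m = m' -> 0 < m' ->
  (v 0 / t * J 0 0 + v 1 / t * J 1 0) * (v' 1 / t') = (v 0 / t * J 0 1 + v 1 / t * J 1 1) * (v' 0 / t').
Proof.
rewrite trace2 => h h' S tr mm m0.
pose u k := v 0 * J 0 k + v 1 * J 1 k.
have hu k : u 0 * B 0 k + u 1 * B 1 k = (f + m') * u k.
  transitivity (v 0 * (J 0 0 * B 0 k + J 0 1 * B 1 k) + v 1 * (J 1 0 * B 0 k + J 1 1 * B 1 k)).
    by rewrite /u; ring.
  rewrite -!S.
  transitivity ((v 0 * A 0 0 + v 1 * A 1 0) * J 0 k + (v 0 * A 0 1 + v 1 * A 1 1) * J 1 k); first by ring.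
  by rewrite !h mm /u; ring.
have := collinear_ring (hu 0) (hu 1) (h' 0) (h' 1).
rewrite tr => /eqP; rewrite mulf_eq0 => /orP[/eqP E|].
  have E' : - (2 * m') = 0 by rewrite -E; ring.
  by move/eqP: E'; rewrite oppr_eq0 mulf_eq0 (gt_eqF m0) pnatr_eq0.
rewrite subr_eq0 => /eqP E.
transitivity (u 0 * v' 1 / (t * t')); first by rewrite /u invfM; ring.
by rewrite E /u invfM; ring.
Qed.

Lemma coframe_change_aux (R : realType) (e w : 'I_2 -> R) (r r' sg : R) (J G G' : 'M[R]_2) :
  let u j := e 0 * J 0 j + e 1 * J 1 j in
  let p j := w 0 * G 0 j + w 1 * G 1 j in
  let s := u 0 * p 0 + u 1 * p 1 in
  G 1 0 = G 0 1 -> u 0 * w 1 = u 1 * w 0 -> p 0 * w 0 + p 1 * w 1 = 1 ->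
  (e 0 * G' 0 0 + e 1 * G' 1 0) * e 0 + (e 0 * G' 0 1 + e 1 * G' 1 1) * e 1 = 1 ->
  r = sg * \det J * r' ->
  (forall i j, G' i j = (J i 0 * G 0 0 + J i 1 * G 1 0) * J j 0 + (J i 0 * G 0 1 + J i 1 * G 1 1) * J j 1) ->
  [/\ s ^+ 2 = 1,
      forall m, e 0 * G' 0 m + e 1 * G' 1 m = s * (J m 0 * p 0 + J m 1 * p 1) &
      forall m : 'I_2, (if m == 0 then - (r * e 1) else r * e 0) =
        s * sg * (J m 0 * - (r' * w 1) + J m 1 * (r' * w 0))].
Proof.
rewrite det2 /= => G10; rewrite G10 => col n1 n2 rE GE.
set u := fun j => e 0 * J 0 j + e 1 * J 1 j.
have n2' : (u 0 * G 0 0 + u 1 * G 0 1) * u 0 + (u 0 * G 0 1 + u 1 * G 1 1) * u 1 = 1.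
  by rewrite -n2 !GE /u; ring.
have [s2 h1 h2 h3 h4] := coframe_change_ring col n1 n2' rE.
split=> //; last by apply: ord2P.
move=> m; transitivity (J m 0 * (u 0 * G 0 0 + u 1 * G 0 1) + J m 1 * (u 0 * G 0 1 + u 1 * G 1 1)).
  by rewrite !GE /u; ring.
rewrite /u h1 h2; have E (a b s' x y : R) : a * (s' * x) + b * (s' * y) = s' * (a * x + b * y) by ring.
exact: E.
Qed.

Lemma sqrt_sqrM (R : rcfType) (a b : R) : Num.sqrt (a ^+ 2 * b) = Num.sg a * a * Num.sqrt b.
Proof. by rewrite sqrtrM ?sqr_ge0 // sqrtr_sqr normrEsg. Qed.

Lemma nbhs_preimage (T U : topologicalType) (h : T -> U) x (B : set U) :
  {for x, continuous h} -> open B -> B (h x) -> nbhs x (h @^-1` B).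
Proof. by move=> ch oB Bx; apply: ch; exact: open_nbhs_nbhs. Qed.

Lemma congruence_mx (R : comNzRingType) m n (J : 'M[R]_m) (N T : 'M[R]_(m, n)) (H : 'M[R]_n) :
  - (J *m N *m H *m (J *m T)^T) = J *m - (N *m H *m T^T) *m J^T.
Proof. by rewrite trmx_mul mulmxN mulNmx !mulmxA. Qed.

(** * The principal coframe and its connection form under a change of chart *)

Section Surface.
Variables (R : realType) (M : topologicalType) (phi xi : M -> 'rV[R]_3) (atlas : set (chart R M)) (f : R).
Hypothesis surface : surface_in_sol phi xi atlas.
Hypothesis cmc : forall c p, atlas c -> source c p -> mean_curvature phi xi c p = f.
Hypothesis pinching : forall c p, atlas c -> source c p ->
  1 <= gauss_curvature phi c p * (shape_norm2 phi xi c p - 2 * f ^+ 2).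

Local Notation T := (tangent_frame phi).
Local Notation N := (nabla_normal phi xi).
Local Notation g := (induced_metric phi).
Local Notation A := (shape_operator phi xi).

Lemma trace_shape c : atlas c -> forall x, target c x -> \tr (A c x) = 2 * f.
Proof.
move=> ac x tx; have := cmc ac (param_source tx); rewrite /mean_curvature paramK // => <-.
by rewrite mulrC divfK.
Qed.

Lemma pinching_target c : atlas c -> forall x, target c x ->
  1 <= gauss_curvature_of_metric (g c) x * discr phi xi c f x.
Proof.
move=> ac x tx; have := pinching ac (param_source tx).
by rewrite /gauss_curvature /shape_norm2 paramK.
Qed.

Lemma immersed c : atlas c -> forall x, target c x -> row_free (T c x).
Proof. by move=> ac x tx; apply: (phi_immersion surface). Qed.

Lemma normal_field c : atlas c ->
  forall x, target c x -> T c x *m sol_metric (phi (param c x)) *m (xi (param c x))^T = 0.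
Proof. by move=> ac x tx; apply: (xi_normal surface). Qed.

Lemma metric_det_pos c x : atlas c -> target c x -> 0 < \det (g c x).
Proof. move=> ac; have := @metric_det_gt0 _ _ phi c (immersed ac) x; exact. Qed.

Section TwoCharts.
Variables c d : chart R M.
Hypotheses (ac : atlas c) (ad : atlas d).

Definition chart_overlap : set 'rV[R]_2 := target c `&` param c @^-1` source d.

Definition chart_change (x : 'rV[R]_2) : 'rV[R]_2 := coord d (param c x).

Local Notation tau := chart_change.
Local Notation D x := ('J chart_change x).

Lemma open_chart_overlap : open chart_overlap.
Proof. by apply: open_within_preimage; [exact: target_open|exact: param_continuous|exact: source_open]. Qed.

Lemma ck_chart_change k l : ck k chart_overlap (fun x => tau x 0 l).
Proof. exact: smooth_on_ck open_chart_overlap (atlas_compatible (sol_surface_smooth surface) ac ad). Qed.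

Lemma chart_change_target x : chart_overlap x -> target d (tau x).
Proof. by move=> [_ sx]; exact: coord_target. Qed.

Lemma param_chart_change x : chart_overlap x -> param d (tau x) = param c x.
Proof. by move=> [_ sx]; rewrite /chart_change coordK. Qed.

Lemma differentiable_chart_change x : chart_overlap x -> differentiable tau x.
Proof. exact: (@ck_differentiable_vec _ 0 _ _ _ (ck_chart_change 1)). Qed.

Lemma jacobian_change n (F : M -> 'rV[R]_n) x :
  smooth_on (target c) (F \o param c) -> smooth_on (target d) (F \o param d) -> chart_overlap x ->
  'J (F \o param c) x = D x *m 'J (F \o param d) (tau x).
Proof.
move=> sc sd Ox; apply/matrixP => i j.
have dt := differentiable_chart_change Ox; have ty := chart_change_target Ox.
rewrite jacobianE; last exact: (sc [::] x Ox.1).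
transitivity (partial i (fun y => (F \o param d) (tau y) 0 j) x).
  apply: partial_near; apply: filterS (open_nbhs_nbhs (conj open_chart_overlap Ox)) => y Oy.
  by rewrite /= param_chart_change.
have dF : differentiable (fun y => (F \o param d) y 0 j) (tau x).
  exact: (ck_diff (smooth_on_ck 1 j (@target_open _ _ d) sd) ty).
rewrite (partial_comp i dt dF) [RHS]mxE; apply: eq_bigr => k _.
by rewrite (jacobianE i k dt) (jacobianE k j (sd [::] _ ty)).
Qed.

Lemma tangent_change x : chart_overlap x -> T c x = D x *m T d (tau x).
Proof. exact: jacobian_change (phi_smooth surface ac) (phi_smooth surface ad). Qed.

Lemma nabla_change x : chart_overlap x -> N c x = D x *m N d (tau x).
Proof.
move=> Ox; rewrite /nabla_normal mulmxDr (jacobian_change (xi_smooth surface ac) (xi_smooth surface ad) Ox).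
congr (_ + _); rewrite tangent_change // param_chart_change //.
move: (D x) (T d _) => J Td; apply/matrixP => i k; rewrite [LHS]mxE [RHS]mxE.
under [RHS]eq_bigr => n _ do rewrite mxE mulr_sumr.
rewrite [RHS]exchange_big; apply: eq_bigr => a _ /=.
under [RHS]eq_bigr => n _ do rewrite mulr_sumr.
rewrite [RHS]exchange_big; apply: eq_bigr => b _ /=.
rewrite mxE mulr_sumr mulr_suml; apply: eq_bigr => n _; ring.
Qed.

Lemma metric_change x : chart_overlap x -> g c x = D x *m g d (tau x) *m (D x)^T.
Proof.
move=> Ox; rewrite /induced_metric tangent_change // param_chart_change //.
by rewrite trmx_mul !mulmxA.
Qed.

Lemma det_metric_change x : chart_overlap x -> \det (g c x) = \det (D x) ^+ 2 * \det (g d (tau x)).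
Proof. by move=> Ox; rewrite metric_change // !det_mulmx det_tr; ring. Qed.

Lemma jacobian_unit x : chart_overlap x -> D x \in unitmx.
Proof.
move=> Ox; rewrite unitmxE unitfE; have := metric_det_pos ac Ox.1; rewrite det_metric_change //.
by apply: contraTneq => ->; rewrite expr0n mul0r ltxx.
Qed.


Lemma shape_metric_mx (h : chart R M) : atlas h -> forall x, target h x ->
  A h x *m g h x = - (N h x *m sol_metric (phi (param h x)) *m (T h x)^T).
Proof.
move=> ah x tx; apply/matrixP => i j.
rewrite (shape_metric (phi_smooth surface ah) (xi_smooth surface ah) (immersed ah) (xi_unit surface) (normal_field ah) i j tx).
by rewrite [RHS]mxE sol_metric_form.
Qed.

(** The product of the shape operator with the metric transforms by congruence, since frame and
    normal derivative both transform by the Jacobian matrix; the invertible factor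
    [g d (tau x) *m (D x)^T] is then cancelled. *)
Lemma shape_change x : chart_overlap x -> A c x *m D x = D x *m A d (tau x).
Proof.
move=> Ox; have ty := chart_change_target Ox.
have gu : g d (tau x) *m (D x)^T \in unitmx.
  by rewrite unitmx_mul unitmx_tr jacobian_unit // andbT unitmxE unitfE gt_eqF // metric_det_pos.
have E : A c x *m D x *m (g d (tau x) *m (D x)^T) = D x *m A d (tau x) *m (g d (tau x) *m (D x)^T).
  have E1 : A c x *m D x *m (g d (tau x) *m (D x)^T) = A c x *m g c x by rewrite (metric_change Ox) !mulmxA.
  have E2 : D x *m A d (tau x) *m (g d (tau x) *m (D x)^T) = D x *m (A d (tau x) *m g d (tau x)) *m (D x)^T by rewrite !mulmxA.
  have tx := Ox.1.
  have h1 := shape_metric_mx ac tx.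
  have h2 := shape_metric_mx ad ty.
  have n := nabla_change Ox; have t := tangent_change Ox; have p := congr1 phi (param_chart_change Ox).
  have h3 := congruence_mx (D x) (N d (tau x)) (T d (tau x)) (sol_metric (phi (param d (tau x)))).
  have h4 := f_equal3 (fun a b e => - (a *m b *m e^T)) n (congr1 (@sol_metric R) (esym p)) t.
  have h5 := congr1 (fun Z => D x *m Z *m (D x)^T) h2.
  exact: (etrans E1 (etrans h1 (etrans h4 (etrans h3 (esym (etrans E2 h5)))))).
by rewrite -[LHS](mulmxK gu) E mulmxK.
Qed.

Lemma gap_change x : chart_overlap x -> gap phi xi c f x = gap phi xi d f (tau x).
Proof.
move=> Ox.
exact: (congr1 (fun t => Num.sqrt ((t - 2 * f ^+ 2) / 2)) (trace_sqr_similar (jacobian_unit Ox) (shape_change Ox))).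
Qed.

Lemma shape_change_entry x i k : chart_overlap x ->
  A c x i 0 * D x 0 k + A c x i 1 * D x 1 k = D x i 0 * A d (tau x) 0 k + D x i 1 * A d (tau x) 1 k.
Proof.
move=> Ox; have := congr1 (fun Z : 'M[R]_2 => Z i k) (shape_change Ox).
by rewrite mxE [RHS]mxE !sum_ord2.
Qed.

Lemma metric_change_entry x i j : chart_overlap x -> g c x i j =
  (D x i 0 * g d (tau x) 0 0 + D x i 1 * g d (tau x) 1 0) * D x j 0 +
  (D x i 0 * g d (tau x) 0 1 + D x i 1 * g d (tau x) 1 1) * D x j 1.
Proof.
by move=> Ox; exact: (etrans (congr1 (fun Z : 'M[R]_2 => Z i j) (metric_change Ox)) (congruence2 _ _ _ _)).
Qed.

Local Notation e r j x := (unit_eig phi xi c f r j x).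
Local Notation w s j x := (unit_eig phi xi d f s j x).
Local Notation dom r := (eig_dom phi xi c f r).
Local Notation dom' s := (eig_dom phi xi d f s).

Definition pushed r j x := e r 0 x * D x 0 j + e r 1 x * D x 1 j.

Lemma pushed_collinear r s x : chart_overlap x -> dom r x -> dom' s (tau x) ->
  pushed r 0 x * w s 1 (tau x) = pushed r 1 x * w s 0 (tau x).
Proof.
move=> Ox ex ey; have tx := Ox.1; have ty := chart_change_target Ox.
have h j := eigP (phi_smooth surface ac) (xi_smooth surface ac) (immersed ac) (xi_unit surface) (normal_field ac) (trace_shape ac) r j tx.
have h' j := eigP (phi_smooth surface ad) (xi_smooth surface ad) (immersed ad) (xi_unit surface) (normal_field ad) (trace_shape ad) s j ty.
have m0 := gap_gt0 (phi_smooth surface ad) (xi_smooth surface ad) (immersed ad) (xi_unit surface) (normal_field ad) (trace_shape ad) (pinching_target ad) ty.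
have tr := trace_shape ad ty.
have S i k := shape_change_entry i k Ox.
have gE := gap_change Ox.
exact: (collinear_change _ _ h h' S tr gE m0).
Qed.

Lemma jacobian_entry x m n : chart_overlap x -> D x m n = partial m (fun y => tau y 0 n) x.
Proof. by move=> Ox; exact: jacobianE (differentiable_chart_change Ox). Qed.

Lemma jac_chart_change x : chart_overlap x -> jac tau x = \det (D x).
Proof. by move=> Ox; rewrite det2 !(jacobian_entry _ _ Ox). Qed.

Lemma sqrt_det_change x : chart_overlap x ->
  Num.sqrt (\det (g c x)) = Num.sg (jac tau x) * \det (D x) * Num.sqrt (\det (g d (tau x))).
Proof.
move=> Ox; rewrite (jac_chart_change Ox).
exact: etrans (congr1 Num.sqrt (det_metric_change Ox)) (sqrt_sqrM _ _).
Qed.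

(** The inner product of the pushed forward unit field of one chart with that of the other. Both are
    unit and parallel, so it is 1 or -1. *)
Definition frame_sign r s x :=
  pushed r 0 x * coframe1 phi xi d f s 0 (tau x) + pushed r 1 x * coframe1 phi xi d f s 1 (tau x).

Lemma coframe_change r s x : chart_overlap x -> dom r x -> dom' s (tau x) ->
  [/\ frame_sign r s x ^+ 2 = 1,
    forall m, coframe1 phi xi c f r m x = frame_sign r s x *
      (D x m 0 * coframe1 phi xi d f s 0 (tau x) + D x m 1 * coframe1 phi xi d f s 1 (tau x)) &
    forall m, coframe2 phi xi c f r m x = frame_sign r s x * Num.sg (jac tau x) *
      (D x m 0 * coframe2 phi xi d f s 0 (tau x) + D x m 1 * coframe2 phi xi d f s 1 (tau x))].
Proof.
move=> Ox ex ey; have col := pushed_collinear Ox ex ey.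
have n1 := unit_eig_norm ey; have n2 := unit_eig_norm ex; have rE := sqrt_det_change Ox.
have mE i j := metric_change_entry i j Ox; have G10 := metricC phi d (tau x) 1 0.
exact: (@coframe_change_aux R (fun j => e r j x) (fun j => w s j (tau x)) (Num.sqrt (\det (g c x)))
  (Num.sqrt (\det (g d (tau x)))) (Num.sg (jac tau x)) (D x) (g d (tau x)) (g c x) G10 col n1 n2 rE mE).
Qed.

Lemma open_frame_dom (h : chart R M) r : atlas h -> open (eig_dom phi xi h f r).
Proof.
move=> ah; exact: (@open_eig_dom _ _ _ _ _ (phi_smooth surface ah) (xi_smooth surface ah) (immersed ah) (xi_unit surface)
  (normal_field ah) f (trace_shape ah) (pinching_target ah) r).
Qed.

Lemma chart_change_continuous x : chart_overlap x -> {for x, continuous tau}.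
Proof. by move=> Ox; apply: differentiable_continuous; exact: differentiable_chart_change. Qed.

Definition frame_overlap r s : set 'rV[R]_2 := [set x | [/\ chart_overlap x, dom r x & dom' s (tau x)]].

Lemma open_frame_overlap r s : open (frame_overlap r s).
Proof.
have H x : frame_overlap r s x -> nbhs x (frame_overlap r s).
  move=> [Ox ex ey].
  have nO := open_nbhs_nbhs (conj open_chart_overlap Ox).
  have nd := open_nbhs_nbhs (conj (@open_frame_dom c r ac) ex).
  have nd' := nbhs_preimage (chart_change_continuous Ox) (@open_frame_dom d s ad) ey.
  by apply: filterS3 nO nd nd' => y.
by rewrite openE => x; exact: H.
Qed.

Lemma jac_neq0 x : chart_overlap x -> jac tau x != 0.
Proof. by move=> Ox; rewrite (jac_chart_change Ox) -unitfE -unitmxE; exact: jacobian_unit. Qed.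

(** Where [J] is nonzero its sign equals $J / \sqrt{J^2}$, a composite of functions of known
    regularity. *)
Lemma ck_sign_jac (U : set 'rV[R]_2) : open U -> U `<=` chart_overlap -> ck 1 U (fun x => Num.sg (jac tau x)).
Proof.
move=> oU sub; have cj : ck 1 U (jac tau) by apply: (ck_jac oU) => j; exact: (ck_sub sub (ck_chart_change 2 j)).
have n0 x : U x -> jac tau x != 0 by move=> /sub; exact: jac_neq0.
have p0 x : U x -> 0 < jac tau x * jac tau x by move=> /n0 h; rewrite -expr2 exprn_even_gt0.
have s0 x : U x -> Num.sqrt (jac tau x * jac tau x) != 0 by move=> Ux; rewrite gt_eqF // sqrtr_gt0 p0.
apply: (ck_ext oU _ (ckM oU cj (ckV oU s0 (ck_sqrt oU p0 (ckM oU cj cj))))) => x Ux.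
by rewrite -expr2 sqrtr_sqr -[X in X / _]mulr_sg_norm mulfK // normr_eq0 n0.
Qed.

Lemma ck_frame_sign r s : ck 1 (frame_overlap r s) (frame_sign r s).
Proof.
have oW := @open_frame_overlap r s.
have sub : frame_overlap r s `<=` chart_overlap by move=> x [].
have sub1 : frame_overlap r s `<=` dom r by move=> x [].
have ce i := ck_sub sub1 (ck_unit_eig (phi_smooth surface ac) (xi_smooth surface ac) (immersed ac) (xi_unit surface)
  (normal_field ac) (trace_shape ac) (pinching_target ac) 1 r i).
have cd i j : ck 1 (frame_overlap r s) (fun x => D x i j).
  apply: (ck_ext oW _ (ck_sub sub (ck_partial i (ck_chart_change 2 j)))) => x /sub Ox.
  by rewrite (jacobian_entry _ _ Ox).
have cu j : ck 1 (frame_overlap r s) (pushed r j) by exact: (ckD oW (ckM oW (ce 0) (cd 0 j)) (ckM oW (ce 1) (cd 1 j))).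
have ct j : ck 1 (frame_overlap r s) (fun x => coframe1 phi xi d f s j (tau x)).
  apply: (ck_comp (V := dom' s) oW) => [x []||x /sub Ox|] //.
  - by move=> l; exact: (ck_sub sub (ck_chart_change 1 l)).
  - exact: chart_change_continuous.
  - exact: (ck_coframe1 (phi_smooth surface ad) (xi_smooth surface ad) (immersed ad) (xi_unit surface)
      (normal_field ad) (trace_shape ad) (pinching_target ad) 1 s j).
exact: (ckD oW (ckM oW (cu 0) (ct 0)) (ckM oW (cu 1) (ct 1))).
Qed.

Lemma connection_change r s m x : frame_overlap r s x ->
  connection_form (coframe1 phi xi c f r) (coframe2 phi xi c f r) m x = Num.sg (jac tau x) *
   (partial m (fun z => tau z 0 0) x * connection_form (coframe1 phi xi d f s) (coframe2 phi xi d f s) 0 (tau x) +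
    partial m (fun z => tau z 0 1) x * connection_form (coframe1 phi xi d f s) (coframe2 phi xi d f s) 1 (tau x)).
Proof.
move=> Wx; have oW := @open_frame_overlap r s.
have sub : frame_overlap r s `<=` chart_overlap by move=> y [].
have subV y : frame_overlap r s y -> dom' s (tau y) by case.
have H y (Wy : frame_overlap r s y) := let: And3 a b e := Wy in coframe_change a b e.
have ct l := ck_sub sub (ck_chart_change 2 l).
have s1 y : frame_overlap r s y -> Num.sg (jac tau y) ^+ 2 = 1.
  by move=> /sub Oy; rewrite sqr_sg jac_neq0.
have sp1 y : frame_overlap r s y -> frame_sign r s y ^+ 2 = 1 by move=> /H[].
have c1 := ck_coframe1 (phi_smooth surface ad) (xi_smooth surface ad) (immersed ad) (xi_unit surface)
      (normal_field ad) (trace_shape ad) (pinching_target ad) 1 s.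
have c2 := ck_coframe2 (phi_smooth surface ad) (xi_smooth surface ad) (immersed ad) (xi_unit surface)
      (normal_field ad) (trace_shape ad) (pinching_target ad) 1 s.
apply: (connection_form_change m oW subV ct (ck_sign_jac oW sub) s1 (ck_frame_sign r s) sp1 c1 c2 _ _ Wx (jac_neq0 (sub x Wx))
  (coframe_det_neq0 (immersed ad) (subV x Wx))).
- by move=> l y Wy; have [_ -> _] := H y Wy; rewrite !(jacobian_entry _ _ (sub y Wy)).
- by move=> l y Wy; have [_ _ ->] := H y Wy; rewrite !(jacobian_entry _ _ (sub y Wy)).
Qed.

End TwoCharts.

End Surface.

(** * Charts restricted to open subsets of their targets *)

Section RestrictChart.
Variables (R : realType) (M : topologicalType) (c : chart R M) (V : set 'rV[R]_2).
Hypotheses (oV : open V) (VT : V `<=` target c).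

Let src := source c `&` coord c @^-1` V.

Let src_open : open src.
Proof. exact: open_within_preimage (@source_open _ _ c) (@Defs.coord_continuous _ _ c) oV. Qed.

Let src_target p : src p -> V (coord c p). Proof. by case. Qed.

Let param_src x : V x -> src (param c x).
Proof. by move=> Vx; split; [exact: param_source (VT Vx)|rewrite /= paramK //; exact: VT]. Qed.

Let src_coordK p : src p -> param c (coord c p) = p. Proof. by move=> [sp _]; exact: coordK. Qed.

Let src_paramK x : V x -> coord c (param c x) = x. Proof. by move=> /VT; exact: paramK. Qed.

Let src_coord_continuous : {within src, continuous coord c}.
Proof. by apply: continuous_subspaceW (@Defs.coord_continuous _ _ c) => p []. Qed.

Let src_param_continuous : {within V, continuous param c}.
Proof. exact: continuous_subspaceW VT (@param_continuous _ _ c). Qed.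

Definition restrict_chart : chart R M :=
  Chart src_open oV src_target param_src src_coordK src_paramK src_coord_continuous src_param_continuous.

End RestrictChart.

Theorem theorem4p2 (R : realType) (M : topologicalType)
    (atlas : set (chart R M)) (phi xi : M -> 'rV[R]_3) (f : R) :
  surface_in_sol phi xi atlas ->
  compact [set: M] ->
  (forall c p, atlas c -> source c p -> mean_curvature phi xi c p = f) ->
  ~ (forall c p, atlas c -> source c p ->
       1 <= gauss_curvature phi c p *
            (shape_norm2 phi xi c p - 2 * f ^+ 2)).
Proof.
move=> surface compactM cmc pinching; have [m0 _] := sol_surface_nonempty surface.
have smooth := sol_surface_smooth surface.
(* The refined atlas is indexed by a chart together with the row of $A - (f - gap)$ that is
   normalised there. *)
pose I : Type := {c : chart R M | atlas c} * 'I_2.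
pose ch (i : I) : chart R M := sval i.1; have ach (i : I) : atlas (ch i) := svalP i.1.
pose dom (i : I) := eig_dom phi xi (ch i) f i.2.
have odom i : open (dom i) by exact: (@open_frame_dom _ _ _ _ _ _ surface cmc pinching (ch i) i.2 (ach i)).
have domT i : dom i `<=` target (ch i) by move=> x [].
pose cc i := restrict_chart (odom i) (@domT i).
pose alpha (i : I) := connection_form (coframe1 phi xi (ch i) f i.2) (coframe2 phi xi (ch i) f i.2).
have ov i j x : overlap cc i j x -> frame_overlap phi xi f (ch i) (ch j) i.2 j.2 x.
  by move=> [ex [sx ey]]; split; [split; [exact: (domT i x ex)|exact: sx]|exact: ex|exact: ey].
apply: (@no_positive_exact_form R M I cc (surface_hausdorff smooth) _ _ compactM alpha _ _ _ m0).
- move=> p; have [c ac sp] := atlas_cover smooth p.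
  have tp := coord_target sp.
  have [r [j ej]] := eig_neq0 (phi_smooth surface ac) (xi_smooth surface ac) (immersed surface ac) (xi_unit surface)
      (normal_field surface ac) (trace_shape cmc ac) (pinching_target pinching ac) tp.
  exists (exist _ c ac, r); split=> //; split=> //.
  exact: (eig_norm2_gt0 (immersed surface ac) tp ej).
- move=> i j k l; apply: (ck_sub _ (ck_chart_change surface (ach i) (ach j) k l)).
  by move=> x /ov[].
- move=> i l; exact: (ck_connection (phi_smooth surface (ach i)) (xi_smooth surface (ach i)) (immersed surface (ach i)) (xi_unit surface)
      (normal_field surface (ach i)) (trace_shape cmc (ach i)) (pinching_target pinching (ach i)) i.2 l).
- move=> i j l x /ov ox; exact: (connection_change surface cmc pinching (ach i) (ach j) l ox).
- move=> i x ex; exact: (curl_connection_gt0 (phi_smooth surface (ach i)) (xi_smooth surface (ach i)) (immersed surface (ach i)) (xi_unit surface)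
      (normal_field surface (ach i)) (trace_shape cmc (ach i)) (pinching_target pinching (ach i)) ex).
Qed.
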